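(* Let $(\Omega,\Sigma,\mu)$ be a $\sigma$-finite measure space, $1\le p_0,p_1<\infty$, $0<\theta<1$, and let $W_0,W_1:\Omega\to M_n(\mathbb{C})$ be matrix weights. Then $$(L^{p_0}(W_0),L^{p_1}(W_1))_\theta=L^{p_\theta}\big(|W_1W_0^{-1}|^\theta W_0\big)$$ isometrically, where $(\cdot,\cdot)_\theta$ is the complex interpolation method and $\frac1{p_\theta}=\frac{1-\theta}{p_0}+\frac{\theta}{p_1}$.
   Context: A matrix weight is a measurable $W:\Omega\to M_n(\mathbb{C})$ that is a.e. positive definite. For a measurable a.e. invertible $W:\Omega\to M_n(\mathbb{C})$, $L^p(W)$ is the space of (classes of) measurable $f:\Omega\to\mathbb{C}^n$ with $\|f\|_{L^p(W)}=\big(\int_\Omega|W(x)f(x)|^p\,d\mu(x)\big)^{1/p}<\infty$, where $|\cdot|$ is the Euclidean norm on $\mathbb{C}^n$ (note that the weight multiplies $f$ directly, with no power $1/p$). For a matrix $A$, $|A|=(A^*A)^{1/2}$. Couples are compatible through inclusion in the space $L^0(\Omega,\mathbb{C}^n)$ of measurable functions. $(\cdot,\cdot)_\theta$ is Calderón's (lower) complex interpolation method. *)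

(* Defs.v *)
From HB Require Import structures.
From mathcomp Require Import all_boot all_order all_algebra.
From mathcomp Require Import complex.
From mathcomp Require Import all_classical all_reals all_analysis.
From mathcomp Require Import measurable_realfun.

Set Implicit Arguments.
Unset Strict Implicit.
Unset Printing Implicit Defensive.

Import Order.TTheory GRing.Theory Num.Theory.
Import numFieldNormedType.Exports.

Local Open Scope classical_set_scope.
Local Open Scope ring_scope.
Local Open Scope complex_scope.
Local Open Scope sesquilinear_scope.
Local Open Scope quotient_scope.

Section complex_matrices.
Context {R : realType}.

Definition enorm n (v : 'cV[R[i]]_n) : R :=
  Num.sqrt (\sum_i (complex.Re (v i 0) ^+ 2 + complex.Im (v i 0) ^+ 2)).

(* In the order of R[i], 0 < z means that z is real and positive, so the
   condition forces A to be Hermitian. *)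
Definition posdefmx n (A : 'M[R[i]]_n) : Prop :=
  forall v : 'cV[R[i]]_n, v != 0 -> 0 < (v^t* *m A *m v) 0 0.

(* Power of a positive semidefinite matrix: the functional calculus t |-> t^a
   applied to the spectral decomposition A = P^-1 D P. Meaningful only when A
   is positive semidefinite; 0 `^ a = 0 for a > 0. *)
Definition powmx n (A : 'M[R[i]]_n) (a : R) : 'M[R[i]]_n :=
  invmx (spectralmx A) *m
  diag_mx (map_mx (fun z => ((complex.Re z) `^ a)%:C) (spectral_diag A)) *m
  spectralmx A.

Definition absmx n (A : 'M[R[i]]_n) : 'M[R[i]]_n := powmx (A^t* *m A) 2^-1.

End complex_matrices.

Section measurable_matrix_functions.
Context {d : measure_display} {T : measurableType d} {R : realType}.

(* Borel measurability of a matrix-valued function, entry by entry. *)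
Definition measurable_fun_mx m n (W : T -> 'M[R[i]]_(m, n)) : Prop :=
  forall i j, measurable_fun [set: T] (fun x => complex.Re (W x i j)) /\
              measurable_fun [set: T] (fun x => complex.Im (W x i j)).

Definition matrix_weight (mu : {measure set T -> \bar R}) n
    (W : T -> 'M[R[i]]_n) : Prop :=
  measurable_fun_mx W /\ \forall x \ae mu, posdefmx (W x).

Definition mvfun n : {pred T -> 'cV[R[i]]_n} :=
  fun f => `[< measurable_fun_mx f >].

Lemma mvfun_submod_closed n : submod_closed (@mvfun n).
Proof.
split=> [|a f g /asboolP mf /asboolP mg]; apply/asboolP => i j.
  by split; [under eq_fun do rewrite mxE | under eq_fun do rewrite mxE];
     exact: measurable_cst.
have [fr fi] := mf i j; have [gr gi] := mg i j; case: a => a b; split.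
  rewrite [X in measurable_fun _ X](_ : _ = fun x =>
      (a * complex.Re (f x i j) - b * complex.Im (f x i j)) +
      complex.Re (g x i j)).
    by apply: measurable_funD => //; apply: measurable_funB;
       exact: measurable_funM.
  by apply/funext => x; rewrite !mxE; case: (f x i j) (g x i j) => ? ? [].
rewrite [X in measurable_fun _ X](_ : _ = fun x =>
    (a * complex.Im (f x i j) + b * complex.Re (f x i j)) +
    complex.Im (g x i j)).
  by apply: measurable_funD => //; apply: measurable_funD;
     exact: measurable_funM.
by apply/funext => x; rewrite !mxE; case: (f x i j) (g x i j) => ? ? [].
Qed.

HB.instance Definition _ n :=
  GRing.isSubmodClosed.Build _ _ (@mvfun n) (@mvfun_submod_closed n).

Record mvfunType n :=
  MVFun { mvfun_val :> T -> 'cV[R[i]]_n; _ : mvfun_val \in @mvfun n }.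

HB.instance Definition _ n := [isSub for @mvfun_val n].
HB.instance Definition _ n := [Choice of mvfunType n by <:].
HB.instance Definition _ n := [SubChoice_isSubLmodule of mvfunType n by <:].

End measurable_matrix_functions.
Arguments mvfunType {d} T R n.

(* L^0(Omega, C^n): measurable functions modulo equality almost everywhere. *)
Section L0.
Context {d : measure_display} {T : measurableType d} {R : realType}.
Variables (mu : {measure set T -> \bar R}) (n : nat).

Definition mv_ae_eq (f g : mvfunType T R n) : bool :=
  `[< (f : T -> 'cV[R[i]]_n) = g %[ae mu] >].

Let mv_ae_eq_refl : reflexive mv_ae_eq.
Proof. by move=> f; apply/asboolP; exact: ae_eq_refl. Qed.

Let mv_ae_eq_sym : symmetric mv_ae_eq.
Proof.
by move=> f g; apply/idP/idP => /asboolP h; apply/asboolP; exact: ae_eq_sym.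
Qed.

Let mv_ae_eq_trans : transitive mv_ae_eq.
Proof.
by move=> g f h /asboolP fg /asboolP gh; apply/asboolP;
exact: ae_eq_trans fg gh.
Qed.

Canonical mv_ae_eq_canonical :=
  EquivRel mv_ae_eq mv_ae_eq_refl mv_ae_eq_sym mv_ae_eq_trans.

Definition L0 : Type := {eq_quot mv_ae_eq}.
HB.instance Definition _ := Choice.on L0.
HB.instance Definition _ := EqQuotient.on L0.

Lemma L0_eqP (f g : mvfunType T R n) :
  reflect ((f : T -> 'cV[R[i]]_n) = g %[ae mu]) (\pi_L0 f == \pi_L0 g).
Proof. by apply/(iffP idP); rewrite eqmodE// => /asboolP. Qed.

Lemma L0_reprP (f : mvfunType T R n) :
  (repr (\pi_L0 f) : T -> 'cV[R[i]]_n) = f %[ae mu].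
Proof. by apply/L0_eqP; rewrite reprK. Qed.

Let L0P (f : L0) : exists g : mvfunType T R n, f = \pi_L0 g.
Proof. by exists (repr f); rewrite reprK. Qed.

Definition L0_zero : L0 :=
  \pi_L0 (0 : mvfunType T R n).
Definition L0_opp (f : L0) : L0 :=
  \pi_L0 (- (repr f : mvfunType T R n)).
Definition L0_add (f g : L0) : L0 :=
  \pi_L0 ((repr f : mvfunType T R n) + (repr g : mvfunType T R n)).
Definition L0_scale (a : R[i]) (f : L0) : L0 :=
  \pi_L0 (a *: (repr f : mvfunType T R n)).

Let opp_pi f : L0_opp (\pi_L0 f) = \pi_L0 (- f).
Proof.
apply/eqP/L0_eqP; apply: filterS (L0_reprP f) => x fx Dx.
by rewrite -[RHS]/(- mvfun_val f x) -fx.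
Qed.

Let add_pi f g : L0_add (\pi_L0 f) (\pi_L0 g) = \pi_L0 (f + g).
Proof.
apply/eqP/L0_eqP; apply: filterS2 (L0_reprP f) (L0_reprP g) => x fx gx Dx.
by rewrite -[RHS]/(mvfun_val f x + mvfun_val g x) -fx// -gx.
Qed.

Let scale_pi a f : L0_scale a (\pi_L0 f) = \pi_L0 (a *: f).
Proof.
apply/eqP/L0_eqP; apply: filterS (L0_reprP f) => x fx Dx.
by rewrite -[RHS]/(a *: mvfun_val f x) -fx.
Qed.

Let addA : associative L0_add.
Proof.
move=> f g h; have [[? ->] [? ->] [? ->]] := And3 (L0P f) (L0P g) (L0P h).
by rewrite !add_pi addrA.
Qed.

Let addC : commutative L0_add.
Proof.
move=> f g; have [[? ->] [? ->]] := conj (L0P f) (L0P g).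
by rewrite !add_pi addrC.
Qed.

Let add0 : left_id L0_zero L0_add.
Proof. by move=> f; have [? ->] := L0P f; rewrite add_pi add0r. Qed.

Let addN : left_inverse L0_zero L0_opp L0_add.
Proof. by move=> f; have [? ->] := L0P f; rewrite opp_pi add_pi addNr. Qed.

HB.instance Definition _ := GRing.isZmodule.Build L0 addA addC add0 addN.

Let scaleA a b f : L0_scale a (L0_scale b f) = L0_scale (a * b) f.
Proof. by have [? ->] := L0P f; rewrite !scale_pi scalerA. Qed.

Let scale1 : left_id 1 L0_scale.
Proof. by move=> f; have [? ->] := L0P f; rewrite scale_pi scale1r. Qed.

Let scaleDr : right_distributive L0_scale L0_add.
Proof.
move=> a f g; have [[? ->] [? ->]] := conj (L0P f) (L0P g).
by rewrite !(add_pi, scale_pi) scalerDr.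
Qed.

Let scaleDl f : {morph L0_scale^~ f : a b / a + b >-> L0_add a b}.
Proof.
by move=> a b; have [? ->] := L0P f; rewrite !(add_pi, scale_pi) scalerDl.
Qed.

HB.instance Definition _ :=
  GRing.Zmodule_isLmodule.Build R[i] L0 scaleA scale1 scaleDr scaleDl.

Lemma L0_piD f g : \pi_L0 (f + g) = \pi_L0 f + \pi_L0 g.
Proof. by rewrite -add_pi. Qed.

Lemma L0_piZ a f : \pi_L0 (a *: f) = a *: \pi_L0 f.
Proof. by rewrite -scale_pi. Qed.

End L0.

Section weighted_Lp.
Context {d : measure_display} {T : measurableType d} {R : realType}.
Variables (mu : {measure set T -> \bar R}) (n : nat).

Definition Lp_norm (p : R) (W : T -> 'M[R[i]]_n) (f : L0 mu n) : \bar R :=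
  'N[mu]_p%:E[(fun x => (enorm (W x *m (repr f : mvfunType T R n) x))%:E)]%E.

Definition Lp_space (p : R) (W : T -> 'M[R[i]]_n) : set (L0 mu n) :=
  [set f | Lp_norm p W f < +oo]%E.

End weighted_Lp.
Arguments Lp_norm {d T R} mu {n} p W f.
Arguments Lp_space {d T R} mu {n} p W.

(* A compatible couple (X0, X1) in an ambient space V is given by two
   extended norms N0, N1 : V -> [0, +oo], with X_j = {x | N_j x < +oo}.
   R[i]^o is R[i] with the library's topology on a numFieldType. *)
Section complex_interpolation.
Context {R : realType} {V : lmodType R[i]}.
Variables N0 N1 : V -> \bar R.

Definition sum_norm (x : V) : \bar R :=
  ereal_inf [set (N0 y.1 + N1 y.2)%E | y in [set y : V * V | y.1 + y.2 = x]].

Definition strip : set R[i]^o := [set z | 0 <= complex.Re z <= 1].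

Definition open_strip : set R[i]^o := [set z | 0 < complex.Re z < 1].

Definition boundary_line_ok (N : V -> \bar R) (g : R -> V) : Prop :=
  [/\ forall t, (N (g t) < +oo)%E,
      forall t, N (g s - g t) @[s --> t] --> 0%E,
      N (g t) @[t --> +oo%R] --> 0%E &
      N (g t) @[t --> -oo%R] --> 0%E].

(* Calderon's space F(X0, X1); continuity, boundedness and analyticity are
   those of functions with values in the Banach space X0 + X1. The values of F
   outside the closed strip are irrelevant. *)
Definition calderon_F (F : R[i]^o -> V) : Prop :=
  [/\ exists M : R, forall z, strip z -> (sum_norm (F z) <= M%:E)%E,
      forall z, strip z ->
        sum_norm (F w - F z) @[w --> within strip (nbhs z)] --> 0%E,
      forall z, open_strip z -> exists2 D : V, (sum_norm D < +oo)%E &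
        sum_norm (h^-1 *: (F (z + h) - F z) - D) @[h --> (0 : R[i]^o)^']
          --> 0%E,
      boundary_line_ok N0 (fun t => F (0 +i* t)) &
      boundary_line_ok N1 (fun t => F (1 +i* t))].

Definition calderon_F_norm (F : R[i]^o -> V) : \bar R :=
  maxe (ereal_sup (range (fun t : R => N0 (F (0 +i* t)))))
       (ereal_sup (range (fun t : R => N1 (F (1 +i* t))))).

Definition interp_space (theta : R) : set V :=
  [set F theta%:C | F in calderon_F].

Definition interp_norm (theta : R) (x : V) : \bar R :=
  ereal_inf [set calderon_F_norm F | F in
    [set F | calderon_F F /\ F theta%:C = x]].

End complex_interpolation.

(* Main.v *)
(* Diagonalise (W1 W0^-1)^* (W1 W0^-1) pointwise, with eigenvalues l_j^2. In
   the spectral coordinates u of W0 f, the sizes of W0 f, W1 f and W f are the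
   Euclidean norms of (u_j), (l_j u_j) and (l_j^theta u_j), so that one may
   argue as for scalar weights. Put h = |W f|, p = p_theta,
   c = (h / tau)^(p / p1 - p / p0) and rho_j = c / l_j.

   Upper bound: if |f| <= tau in L^p(W), the function F(z) with coordinates
   m(z) (h / tau)^(p / p0 - 1) l_j^theta rho_j^z u_j takes the value f at theta
   and is bounded by about tau on the two boundary lines; the factor
   m(z) = k / (k + z - theta) gives decay at infinity at the cost of the
   constant k / (k - 1).

   Lower bound: if F(theta) = f, restrict to a set of finite measure on which
   h and the l_j are bounded above and below, and let tau be the norm of f
   there. Pairing F(z) with the field of coordinates
   (h / tau)^(p - p / p0 - 1) l_j^theta rho_j^-z u_j yields a holomorphic
   function on the strip, bounded by tau |F| on the boundary (Hoelder) and
   equal to tau^2 at theta; the three lines lemma gives tau <= |F|. *)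
Require Import Defs.
From HB Require Import structures.
From mathcomp Require Import all_boot all_order all_algebra.
From mathcomp Require Import complex.
From mathcomp Require Import all_classical all_reals all_analysis.
From mathcomp Require Import measurable_realfun ring lra.
Set Implicit Arguments.
Unset Strict Implicit.
Unset Printing Implicit Defensive.
Import Order.TTheory GRing.Theory Num.Theory.
Import numFieldNormedType.Exports.
Local Open Scope classical_set_scope.
Local Open Scope ring_scope.
Local Open Scope sesquilinear_scope.
Local Open Scope quotient_scope.

(** The decomposition chosen by [spectralmx] need not depend measurably on the point, so individual
    eigenvalues and eigenvectors cannot be treated as measurable functions. Every field in use is
    obtained instead by applying, at each point, one scalar symbol to the Gram matrix of [W1 W0^-1];
    such fields are measurable because rational functions of a matrix are, and limits follow. All
    dependence on z is put into a symbol evaluated at s = ln rho_j. A bound of the symbol by a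
    multiple of 1 + exp s then controls the norm of L^p0 + L^p1, and continuity and analyticity in z
    become scalar Taylor estimates, uniform in s with that weight. Damping cannot be avoided,
    because rho^(it) has modulus 1. In the pairing, the bounds on the set keep s in a compact
    interval, where rho^-z is bounded uniformly on the strip. *)

Section segment_integral.
Context {R : realType}.
Implicit Types (f g : R -> R) (a b c : R).

(** * Integrals of continuous functions over segments *)

Definition cont_on f a b := forall x, a <= x <= b -> {for x, continuous f}.

Definition sint f a b : R := \int[lebesgue_measure]_(x in `[a, b]) f x.

Lemma cont_on_integrable f a b : cont_on f a b ->
  (@lebesgue_measure R).-integrable `[a, b] (EFin \o f).
Proof.
move=> cf; apply: continuous_compact_integrable; first exact: segment_compact.
apply: continuous_in_subspaceT => x; rewrite inE/= in_itv/= => xab.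
exact: cf.
Qed.

Lemma sint_split f a b c : cont_on f a c -> a <= b -> b <= c ->
  sint f a c = sint f a b + sint f b c.
Proof.
move=> cf ab bc; rewrite /sint.
have itf := cont_on_integrable cf.
have := @Rintegral_itvB R f (BLeft a) (BRight c) b itf.
rewrite !bnd_simp => /(_ ab bc) e.
rewrite -(@Rintegral_itv_obnd_cbnd _ b (BRight c) f); last first.
  by apply: integrableS itf => //; apply: subset_itvr; rewrite bnd_simp.
by rewrite -e addrC subrK.
Qed.

Lemma sintB f g a b : cont_on f a b -> cont_on g a b ->
  sint (fun x => f x - g x) a b = sint f a b - sint g a b.
Proof. by move=> cf cg; apply: RintegralB => //; exact: cont_on_integrable. Qed.

Lemma cont_on_cst k a b : cont_on (fun=> k) a b.
Proof. by move=> x _; exact: cst_continuous. Qed.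

Lemma sint_cst k a b : a <= b -> sint (fun=> k) a b = k * (b - a).
Proof.
move=> ab; rewrite /sint Rintegral_cst//; congr (k * _).
apply: (etrans (congr1 fine (lebesgue_measure_itv `[a, b]%R))).
by rewrite /= lte_fin; case: ltP => //= ba; lra.
Qed.

Lemma sint_le f g a b : cont_on f a b -> cont_on g a b ->
  (forall x, a <= x <= b -> f x <= g x) -> sint f a b <= sint g a b.
Proof.
move=> cf cg fg; apply: le_Rintegral => //; try exact: cont_on_integrable.
Qed.

Lemma sint_near f a b k e : a <= b -> cont_on f a b ->
  (forall x, a <= x <= b -> `|f x - k| <= e) ->
  `|sint f a b - k * (b - a)| <= e * (b - a).
Proof.
move=> ab cf fk.
have h1 : sint f a b <= (k + e) * (b - a).
  rewrite -sint_cst//; apply: sint_le => //; first exact: cont_on_cst.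
  by move=> x /fk; rewrite ler_norml => /andP[_]; lra.
have h2 : (k - e) * (b - a) <= sint f a b.
  rewrite -sint_cst//; apply: sint_le => //; first exact: cont_on_cst.
  by move=> x /fk; rewrite ler_norml => /andP[+ _]; lra.
by rewrite ler_norml; apply/andP; split; lra.
Qed.

End segment_integral.

(** * Closed differential forms on rectangles *)

Section goursat.
Context {R : realType}.
Variables p q : R -> R -> R.

(** Differentiability of the form [p dx + q dy] together with its closedness at the point: the same
    [ga] is the y-derivative of [p] and the x-derivative of [q]. *)
Definition closed_diff_at (x y : R) := exists al be ga : R,
  forall e, 0 < e -> exists2 d, 0 < d & forall h k, `|h| < d -> `|k| < d ->
    `|p (x + h) (y + k) - p x y - (al * h + ga * k)| <= e * (`|h| + `|k|) /\
    `|q (x + h) (y + k) - q x y - (ga * h + be * k)| <= e * (`|h| + `|k|).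

(** The counterclockwise integral of [p dx + q dy] along the boundary of [a, b] x [c, d]. *)
Definition circulation (a b c d : R) : R :=
  sint (fun x => p x c) a b + sint (q b) c d
  - sint (fun x => p x d) a b - sint (q a) c d.

Lemma lipschitz_at_continuous (f : R -> R) x L : 0 <= L ->
  (exists2 d, 0 < d & forall h, `|h| < d -> `|f (x + h) - f x| <= L * `|h|) ->
  {for x, continuous f}.
Proof.
move=> L0 [d d0 H]; apply/cvgrPdist_le => e e0.
have m0 : 0 < Num.min d (e / (1 + L)) by rewrite lt_min d0 divr_gt0// ltr_pwDl.
apply/nbhs_ballP; exists (Num.min d (e / (1 + L))) => //= t.
rewrite /ball/= lt_min => /andP[]; rewrite distrC => td te.
have := H _ td; rewrite (addrC x) subrK distrC => /le_trans; apply.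
have : `|t - x| * (1 + L) < e by rewrite -ltr_pdivlMr// ltr_pwDl.
have := normr_ge0 (t - x); nra.
Qed.

Lemma closed_diff_contl x y : closed_diff_at x y ->
  {for x, continuous (fun x => p x y)}.
Proof.
move=> [al [be [ga H]]]; have [d d0 Hd] := H 1 ltr01.
apply: (@lipschitz_at_continuous _ _ (1 + `|al|)); first by rewrite addr_ge0.
exists d => // h hd; have z0 : `|0 : R| < d by rewrite normr0.
have [+ _] := Hd h 0 hd z0; rewrite normr0 !addr0 mulr0 addr0 => H1.
have := ler_normD (p (x + h) y - p x y - al * h) (al * h).
by rewrite subrK normrM; nra.
Qed.

Lemma closed_diff_contr x y : closed_diff_at x y -> {for y, continuous (q x)}.
Proof.
move=> [al [be [ga H]]]; have [d d0 Hd] := H 1 ltr01.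
apply: (@lipschitz_at_continuous _ _ (1 + `|be|)); first by rewrite addr_ge0.
exists d => // h hd; have z0 : `|0 : R| < d by rewrite normr0.
have [_ +] := Hd 0 h z0 hd; rewrite normr0 !addr0 mulr0 !add0r => H1.
have := ler_normD (q x (y + h) - q x y - be * h) (be * h).
by rewrite subrK normrM; nra.
Qed.

Definition closed_diff_on a b c d :=
  forall x y, a <= x <= b -> c <= y <= d -> closed_diff_at x y.

Lemma closed_diff_onS a b c d a' b' c' d' : closed_diff_on a b c d ->
  a <= a' -> b' <= b -> c <= c' -> d' <= d -> closed_diff_on a' b' c' d'.
Proof.
move=> H aa bb cc dd x y /andP[ax xb] /andP[cy yd]; apply: H.
  by rewrite (le_trans aa ax) (le_trans xb bb).
by rewrite (le_trans cc cy) (le_trans yd dd).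
Qed.

Lemma closed_diff_on_contl a b c d y : closed_diff_on a b c d -> c <= y <= d ->
  cont_on (fun x => p x y) a b.
Proof. by move=> H cy x ax; apply: closed_diff_contl; exact: H. Qed.

Lemma closed_diff_on_contr a b c d x : closed_diff_on a b c d -> a <= x <= b ->
  cont_on (q x) c d.
Proof. by move=> H ax y cy; apply: closed_diff_contr; exact: H. Qed.

Lemma circulation_quarter a m b c k d : closed_diff_on a b c d ->
  a <= m <= b -> c <= k <= d ->
  circulation a b c d = circulation a m c k + circulation m b c k +
                        circulation a m k d + circulation m b k d.
Proof.
move=> H /andP[am mb] /andP[ck kd].
have ab := le_trans am mb; have cd := le_trans ck kd.
rewrite /circulation.
rewrite (@sint_split _ (fun x => p x c) a m b)//; last first.
  by apply: closed_diff_on_contl H _; rewrite lexx.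
rewrite (@sint_split _ (fun x => p x d) a m b)//; last first.
  by apply: closed_diff_on_contl H _; rewrite lexx andbT.
rewrite (@sint_split _ (q a) c k d)//; last first.
  by apply: closed_diff_on_contr H _; rewrite lexx.
rewrite (@sint_split _ (q b) c k d)//; last first.
  by apply: closed_diff_on_contr H _; rewrite lexx andbT.
by ring.
Qed.

(** Up to the errors, opposite horizontal sides differ by [- ga * (d - c)] and opposite vertical
    sides by [ga * (b - a)]. After integration the two contributions cancel; this is where the
    equality of the cross derivatives enters. Only the error remains, at most [2 * e] per unit of
    length. *)
Lemma circulation_local a b c d x y e : a <= x <= b -> c <= y <= d ->
  closed_diff_on a b c d ->
  (exists al be ga : R, forall x' y', a <= x' <= b -> c <= y' <= d ->
    `|p x' y' - p x y - (al * (x' - x) + ga * (y' - y))| <= e /\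
    `|q x' y' - q x y - (ga * (x' - x) + be * (y' - y))| <= e) ->
  `|circulation a b c d| <= 2 * e * (b - a) + 2 * e * (d - c).
Proof.
move=> /andP[ax xb] /andP[cy yd] H [al [be [ga He]]].
have ab := le_trans ax xb; have cd := le_trans cy yd.
have cc : c <= c <= d by rewrite lexx.
have dd : c <= d <= d by rewrite lexx andbT.
have aa : a <= a <= b by rewrite lexx.
have bb : a <= b <= b by rewrite lexx andbT.
have h1 : `|sint (fun x => p x c - p x d) a b - (- ga * (d - c)) * (b - a)|
    <= 2 * e * (b - a).
  apply: sint_near => // [t tab|t tab].
    by apply: cvgB; apply: closed_diff_contl; exact: H.
  have [+ _] := He t c tab cc; have [+ _] := He t d tab dd.
  by rewrite !ler_norml => /andP[? ?] /andP[? ?]; apply/andP; split; lra.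
have h2 : `|sint (fun y => q b y - q a y) c d - (ga * (b - a)) * (d - c)|
    <= 2 * e * (d - c).
  apply: sint_near => // [t tcd|t tcd].
    by apply: cvgB; apply: closed_diff_contr; exact: H.
  have [_ +] := He b t bb tcd; have [_ +] := He a t aa tcd.
  by rewrite !ler_norml => /andP[? ?] /andP[? ?]; apply/andP; split; lra.
have -> : circulation a b c d =
    (sint (fun x => p x c - p x d) a b - (- ga * (d - c)) * (b - a)) +
    (sint (fun y => q b y - q a y) c d - (ga * (b - a)) * (d - c)).
  rewrite /circulation !sintB; try (by apply: closed_diff_on_contl H _);
    try (by apply: closed_diff_on_contr H _).
  by ring.
by apply: (le_trans (ler_normD _ _)); exact: lerD.
Qed.

(* Goursat: the circulation of [p dx + q dy] is additive under subdivision and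
   is o(area) near each point, hence vanishes. *)
Lemma goursat a b c d : a < b -> c < d -> closed_diff_on a b c d ->
  circulation a b c d = 0.
Proof.
move=> ab cd H; apply/eqP; apply: contraT => J0.
(* The circulation per unit of area. At least one of the four quarters of a rectangle keeps a
   density of [eta] or more. *)
pose eta := `|circulation a b c d| / ((b - a) * (d - c)).
have ba0 : 0 < b - a by rewrite subr_gt0.
have dc0 : 0 < d - c by rewrite subr_gt0.
have eta0 : 0 < eta by rewrite divr_gt0 ?normr_gt0// mulr_gt0.
pose w n : R := (b - a) / 2 ^+ n; pose v n : R := (d - c) / 2 ^+ n.
have w0 n : 0 < w n by rewrite divr_gt0// exprn_gt0.
have v0 n : 0 < v n by rewrite divr_gt0// exprn_gt0.
have wS n : w n = 2 * w n.+1.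
  by rewrite /w exprS; field; rewrite expf_neq0.
have vS n : v n = 2 * v n.+1.
  by rewrite /v exprS; field; rewrite expf_neq0.
pose P n (x y : R) := [/\ a <= x, x + w n <= b, c <= y, y + v n <= d &
  eta * w n * v n <= `|circulation x (x + w n) y (y + v n)|].
(* The invariant [P] is a premise inside the relation, so that every triple has a successor, as
   dependent choice demands. *)
pose rel (s t : nat * R * R) := t.1.1 = s.1.1.+1 /\
  (P s.1.1 s.1.2 s.2 -> [/\ P t.1.1 t.1.2 t.2,
    s.1.2 <= t.1.2, t.1.2 + w t.1.1 <= s.1.2 + w s.1.1,
    s.2 <= t.2 & t.2 + v t.1.1 <= s.2 + v s.1.1]).
have step s : {t | rel s t}.
  apply/cid; case: s => [[n x] y]; rewrite /rel /=.
  have [[ax xb cy yd Hxy]|nP] := pselect (P n x y); last by exists (n.+1, x, y).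
  have w1 := w0 n.+1; have v1 := v0 n.+1; have wn := wS n; have vn := vS n.
  have Hx : closed_diff_on x (x + w n) y (y + v n).
    by apply: closed_diff_onS H _ _ _ _.
  have := @circulation_quarter x (x + w n.+1) (x + w n) y (y + v n.+1) (y + v n) Hx.
  have h1 : x <= x + w n.+1 <= x + w n by lra.
  have h2 : y <= y + v n.+1 <= y + v n by lra.
  move=> /(_ h1 h2) E.
  suff [x' [y' [hx hy Hx']]] : exists x' y', [/\ x' = x \/ x' = x + w n.+1,
      y' = y \/ y' = y + v n.+1 &
      eta * w n.+1 * v n.+1 <= `|circulation x' (x' + w n.+1) y' (y' + v n.+1)|].
    have [x1 x2] : x <= x' /\ x' + w n.+1 <= x + w n by case: hx => ->; split; lra.
    have [y1 y2] : y <= y' /\ y' + v n.+1 <= y + v n by case: hy => ->; split; lra.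
    by exists (n.+1, x', y'); split => // _; do !split => //=; lra.
  have xx : x + w n.+1 + w n.+1 = x + w n by lra.
  have yy : y + v n.+1 + v n.+1 = y + v n by lra.
  apply: contrapT => nex.
  have K x' y' : x' = x \/ x' = x + w n.+1 -> y' = y \/ y' = y + v n.+1 ->
      `|circulation x' (x' + w n.+1) y' (y' + v n.+1)| < eta * w n.+1 * v n.+1.
    by move=> hx hy; rewrite ltNge; apply/negP => ?; apply: nex; exists x', y'.
  have K1 := K x y (or_introl erefl) (or_introl erefl).
  have K2 := K _ y (or_intror erefl) (or_introl erefl).
  have K3 := K x _ (or_introl erefl) (or_intror erefl).
  have K4 := K _ _ (or_intror erefl) (or_intror erefl).
  rewrite xx in K2 K4; rewrite yy in K3 K4.
  move: Hxy; rewrite E => Hxy.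
  have := le_trans Hxy (ler_normD _ _).
  have := ler_normD (circulation x (x + w n.+1) y (y + v n.+1) +
           circulation (x + w n.+1) (x + w n) y (y + v n.+1))
    (circulation x (x + w n.+1) (y + v n.+1) (y + v n)).
  have := ler_normD (circulation x (x + w n.+1) y (y + v n.+1))
           (circulation (x + w n.+1) (x + w n) y (y + v n.+1)).
  have : eta * w n * v n = 4 * (eta * w n.+1 * v n.+1) by rewrite wn vn; ring.
  lra.
have [s [s0 srel]] := dependent_choice step (0%N, a, c).
have sn n : (s n).1.1 = n.
  by elim: n => [|n IH]; [rewrite s0 | rewrite (srel n).1 IH].
pose x n := (s n).1.2; pose y n := (s n).2.
have Pn n : P n (x n) (y n).
  elim: n => [|n IH].
    rewrite /x /y s0 /P /w /v /= expr0 !divr1 !lexx.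
    have -> : a + (b - a) = b by ring.
    have -> : c + (d - c) = d by ring.
    split=> //; rewrite -mulrA mulfVK// mulf_neq0//; exact: lt0r_neq0.
  by have [e h] := srel n; move: h; rewrite e sn => /(_ IH)[].
have mono n : [/\ x n <= x n.+1, x n.+1 + w n.+1 <= x n + w n,
    y n <= y n.+1 & y n.+1 + v n.+1 <= y n + v n].
  by have [e h] := srel n; move: h; rewrite e sn => /(_ (Pn n))[].
have nest m n : [/\ x m <= x n + w n & y m <= y n + v n].
  have up k j : [/\ x k <= x (k + j)%N, x (k + j)%N + w (k + j)%N <= x k + w k,
      y k <= y (k + j)%N & y (k + j)%N + v (k + j)%N <= y k + v k].
    elim: j => [|j [i1 i2 i3 i4]]; first by rewrite addn0 !lexx.
    have [j1 j2 j3 j4] := mono (k + j)%N; rewrite addnS.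
    by split; [exact: le_trans j1 | exact: le_trans i2 | exact: le_trans j3 |
      exact: le_trans i4].
  have [mn|/ltnW nm] := leqP m n.
    have [+ _ + _] := up m (n - m)%N; rewrite subnKC// => h1 h2.
    by have := w0 n; have := v0 n; split; lra.
  have [_ + _ +] := up n (m - n)%N; rewrite subnKC// => h1 h2.
  by have := w0 m; have := v0 m; split; lra.
pose xs := sup (range x); pose ys := sup (range y).
have xs1 n : x n <= xs.
  apply: ub_le_sup; last by exists n.
  by exists (x 0%N + w 0%N) => _ [m _ <-]; have [] := nest m 0%N.
have xs2 n : xs <= x n + w n.
  apply: ge_sup; first by exists (x 0%N), 0%N.
  by move=> _ [m _ <-]; have [] := nest m n.
have ys1 n : y n <= ys.
  apply: ub_le_sup; last by exists n.
  by exists (y 0%N + v 0%N) => _ [m _ <-]; have [] := nest m 0%N.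
have ys2 n : ys <= y n + v n.
  apply: ge_sup; first by exists (y 0%N), 0%N.
  by move=> _ [m _ <-]; have [] := nest m n.
have Hs : closed_diff_at xs ys.
  have [h1 h2 h3 h4 _] := Pn 0%N; apply: H; apply/andP; split.
  - exact: le_trans h1 (xs1 _).
  - exact: le_trans (xs2 _) h2.
  - exact: le_trans h3 (ys1 _).
  - exact: le_trans (ys2 _) h4.
have [al [be [ga Hd]]] := Hs.
pose L := b - a + (d - c).
have L0 : 0 < L by rewrite addr_gt0.
(* With this value the local bound [2 * e * (L / 2 ^+ n) ^+ 2] is exactly half of
   [eta * w n * v n]. *)
pose e := eta * (b - a) * (d - c) / (4 * L ^+ 2).
have e0 : 0 < e.
  by apply: divr_gt0; apply: mulr_gt0 => //; [exact: mulr_gt0 | exact: exprn_gt0].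
have [dl dl0 Hdl] := Hd e e0.
have [n hn] : exists n, L / 2 ^+ n < dl.
  exists (Num.bound (L / dl)); rewrite ltr_pdivrMr ?exprn_gt0//.
  rewrite mulrC -ltr_pdivrMr//; apply: upper_nthrootP; exact: leqnn.
have [h1 h2 h3 h4 h5] := Pn n.
have wv : w n + v n = L / 2 ^+ n by rewrite /w /v -mulrDl.
have := w0 n; have := v0 n => vn0 wn0.
have := @circulation_local (x n) (x n + w n) (y n) (y n + v n) xs ys
  (e * (L / 2 ^+ n)).
rewrite xs1 xs2 ys1 ys2 => /(_ isT isT).
have Hx : closed_diff_on (x n) (x n + w n) (y n) (y n + v n).
  by apply: closed_diff_onS H _ _ _ _.
move=> /(_ Hx) B.
have : eta * w n * v n <= 2 * (e * (L / 2 ^+ n)) * (L / 2 ^+ n).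
  have -> : 2 * (e * (L / 2 ^+ n)) * (L / 2 ^+ n) =
     2 * (e * (L / 2 ^+ n)) * (x n + w n - x n) +
     2 * (e * (L / 2 ^+ n)) * (y n + v n - y n) by rewrite -wv; ring.
  apply: le_trans h5 (B _); rewrite -wv.
  exists al, be, ga => x' y' /andP[? ?] /andP[? ?].
  have := xs1 n; have := xs2 n; have := ys1 n; have := ys2 n => ? ? ? ?.
  have hx : `|x' - xs| <= w n by rewrite ler_norml; lra.
  have hy : `|y' - ys| <= v n by rewrite ler_norml; lra.
  have := Hdl (x' - xs) (y' - ys); rewrite !(addrC _ (_ - _)) !subrK.
  have hxd : `|x' - xs| < dl by lra.
  have hyd : `|y' - ys| < dl by lra.
  by move=> /(_ hxd hyd)[B1 B2]; split;
    [apply: le_trans B1 _ | apply: le_trans B2 _]; rewrite ler_pM2l//; lra.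
apply: contraLR; rewrite -ltNge => _; rewrite /e /w /v.
have t0 : 0 < 2 ^+ n :> R by rewrite exprn_gt0.
set t := 2 ^+ n in t0 *.
have -> : 2 * (eta * (b - a) * (d - c) / (4 * L ^+ 2) * (L / t)) * (L / t) =
   eta * ((b - a) / t) * ((d - c) / t) / 2.
  by field; rewrite !lt0r_neq0.
have : 0 < eta * ((b - a) / t) * ((d - c) / t) by do 2 (apply: mulr_gt0; last exact: divr_gt0).
lra.
Qed.

End goursat.

(** * Real-valued modulus and the complex exponential *)

Section modulus.
Context {R : realType}.
Local Notation C := R[i].
Implicit Types (z w h : C).

(** The norm of [R[i]] takes its values in [R[i]]; this version lands in [R], where the order is
    total and [lra] and [nra] apply. *)
Definition cmod (z : C) : R := ComplexField.Normc.normc z.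

Lemma cmodE z : cmod z = Num.sqrt (complex.Re z ^+ 2 + complex.Im z ^+ 2).
Proof. by case: z. Qed.
Lemma cmod_ge0 z : 0 <= cmod z.
Proof. by rewrite cmodE sqrtr_ge0. Qed.
Lemma cmodM z w : cmod (z * w) = cmod z * cmod w.
Proof. exact: ComplexField.Normc.normcM. Qed.
Lemma cmodV z : cmod z^-1 = (cmod z)^-1.
Proof. exact: ComplexField.Normc.normcV. Qed.
Lemma cmodD z w : cmod (z + w) <= cmod z + cmod w.
Proof. exact: le_normcD. Qed.
Lemma cmodN z : cmod (- z) = cmod z.
Proof. exact: normcN. Qed.
Lemma cmodB z w : cmod (z - w) = cmod (w - z).
Proof. by rewrite -cmodN opprB. Qed.
Lemma cmod0 : cmod 0 = 0.
Proof. exact: ComplexField.Normc.normc0. Qed.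
Lemma cmod1 : cmod 1 = 1.
Proof. exact: ComplexField.Normc.normc1. Qed.
Lemma cmod_eq0 z : (cmod z == 0) = (z == 0).
Proof.
by apply/eqP/eqP => [/ComplexField.Normc.eq0_normc//|->]; exact: cmod0.
Qed.
Lemma cmod_gt0 z : (0 < cmod z) = (z != 0).
Proof. by rewrite lt_def cmod_ge0 cmod_eq0 andbT. Qed.
Lemma cmod_real (x : R) : cmod x%:C%C = `|x|.
Proof. by rewrite cmodE/= expr0n addr0 sqrtr_sqr. Qed.
Lemma cmod_sqr z : cmod z ^+ 2 = complex.Re z ^+ 2 + complex.Im z ^+ 2.
Proof. by rewrite cmodE sqr_sqrtr// addr_ge0// sqr_ge0. Qed.
Lemma normr_cmod z : `|z| = (cmod z)%:C%C.
Proof. by rewrite normc_def cmodE. Qed.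
Lemma Re_le_cmod z : `|complex.Re z| <= cmod z.
Proof. by rewrite cmodE -sqrtr_sqr ler_wsqrtr// lerDl sqr_ge0. Qed.
Lemma Im_le_cmod z : `|complex.Im z| <= cmod z.
Proof. by rewrite cmodE -sqrtr_sqr ler_wsqrtr// lerDr sqr_ge0. Qed.
Lemma cmod_le_ReIm z : cmod z <= `|complex.Re z| + `|complex.Im z|.
Proof.
rewrite -(@ler_pXn2r _ 2) ?nnegrE ?cmod_ge0// cmod_sqr sqrrD !real_normK ?num_real//.
by have := mulr_ge0 (normr_ge0 (complex.Re z)) (normr_ge0 (complex.Im z)); lra.
Qed.

Lemma ReD z w : complex.Re (z + w) = complex.Re z + complex.Re w.
Proof. by case: z w => ? ? []. Qed.
Lemma ImD z w : complex.Im (z + w) = complex.Im z + complex.Im w.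
Proof. by case: z w => ? ? []. Qed.
Lemma ReN z : complex.Re (- z) = - complex.Re z. Proof. by case: z. Qed.
Lemma ImN z : complex.Im (- z) = - complex.Im z. Proof. by case: z. Qed.
Lemma ReM z w : complex.Re (z * w) =
  complex.Re z * complex.Re w - complex.Im z * complex.Im w.
Proof. by case: z w => ? ? []. Qed.
Lemma ImM z w : complex.Im (z * w) =
  complex.Re z * complex.Im w + complex.Im z * complex.Re w.
Proof. by case: z w => ? ? []. Qed.

Definition cexp (z : C) : C :=
  Complex (expR (complex.Re z) * cos (complex.Im z))
          (expR (complex.Re z) * sin (complex.Im z)).

Lemma cexpD z w : cexp (z + w) = cexp z * cexp w.
Proof.
apply/eqP; rewrite eq_complex ReM ImM /= ReD ImD expRD cosD sinD.
by apply/andP; split; apply/eqP; ring.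
Qed.

Lemma cmod_cexp z : cmod (cexp z) = expR (complex.Re z).
Proof.
by rewrite cmodE/= !exprMn -mulrDr cos2Dsin2 mulr1 sqrtr_sqr ger0_norm// expR_ge0.
Qed.

Lemma norm_sin_le (x : R) : `|sin x| <= `|x|.
Proof.
wlog x0 : x / 0 <= x => [H|].
  have [/H//|/ltW x0] := leP 0 x.
  by rewrite -normrN -sinN -[leRHS]normrN; apply: H; rewrite oppr_ge0.
have [c _] := @MVT_segment R sin cos 0 x x0 (fun x _ => is_derive_sin x)
  (continuous_subspaceT (@continuous_sin R)).
rewrite sin0 !subr0 => ->; rewrite normrM ler_piMl//; exact: cos_max.
Qed.

Lemma norm_cosB1_le1 (x : R) : `|cos x - 1| <= `|x|.
Proof.
wlog x0 : x / 0 <= x => [H|].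
  have [/H//|/ltW x0] := leP 0 x.
  by rewrite -cosN -[leRHS]normrN; apply: H; rewrite oppr_ge0.
have [c _] := @MVT_segment R cos _ 0 x x0 (fun x _ => is_derive_cos x)
  (continuous_subspaceT (@continuous_cos R)).
rewrite cos0 !subr0 => ->; rewrite normrM ler_piMl// normrN; exact: sin_max.
Qed.

Lemma norm_cosB1_le2 (x : R) : `|cos x - 1| <= x ^+ 2.
Proof.
wlog x0 : x / 0 <= x => [H|].
  have [/H//|/ltW x0] := leP 0 x.
  by rewrite -cosN -sqrrN; apply: H; rewrite oppr_ge0.
have [c] := @MVT_segment R cos _ 0 x x0 (fun x _ => is_derive_cos x)
  (continuous_subspaceT (@continuous_cos R)).
rewrite in_itv/= => /andP[c0 cx]; rewrite cos0 !subr0 => ->.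
rewrite normrM normrN (ger0_norm x0) expr2 ler_wpM2r//.
by apply: (le_trans (norm_sin_le _)); rewrite ger0_norm.
Qed.

Lemma norm_sinB_le2 (x : R) : `|sin x - x| <= x ^+ 2.
Proof.
wlog x0 : x / 0 <= x => [H|].
  have [/H//|/ltW x0] := leP 0 x.
  have -> : sin x - x = - (sin (- x) - - x) by rewrite sinN; ring.
  by rewrite normrN -sqrrN; apply: H; rewrite oppr_ge0.
have [c] := @MVT_segment R (fun x => sin x - x) _ 0 x x0
  (fun x _ => is_deriveB (is_derive_sin x) (is_derive_id x 1))
  (continuous_subspaceT (fun x => @cvgB _ _ _ _ _ _ _ _ _ (@continuous_sin R x) (fun _ => id))).
rewrite in_itv/= => /andP[c0 cx]; rewrite sin0 !subr0 => ->.
rewrite normrM (ger0_norm x0) expr2 ler_wpM2r//.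
by apply: (le_trans (norm_cosB1_le1 _)); rewrite ger0_norm.
Qed.

(** Everything comes from 1 + x <= exp x, used at x and at - x: the second instance, multiplied by
    exp x, gives exp x - 1 <= x exp x. *)
Lemma expRB1_le (x : R) : `|expR x - 1| <= `|x| * expR `|x|.
Proof.
have h1 := expR_ge1Dx x; have h2 := expR_ge1Dx (- x).
have e0 := expR_gt0 x; have h3 := expRxMexpNx_1 x.
have h4 : expR x - 1 <= x * expR x by nra.
have e1 : 1 <= expR `|x| by rewrite -expR0 ler_expR.
have [x0|x0] := leP 0 x.
  by rewrite (ger0_norm x0) ger0_norm; lra.
rewrite ler0_norm; last by rewrite subr_le0 -[leRHS]expR0 ler_expR ltW.
apply: (@le_trans _ _ `|x|); first by rewrite ltr0_norm//; lra.
by rewrite ler_peMr.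
Qed.

Lemma expRB1B_le (x : R) : `|expR x - 1 - x| <= x ^+ 2 * expR `|x|.
Proof.
have h1 := expR_ge1Dx x; have h2 := expR_ge1Dx (- x).
have e0 := expR_gt0 x; have h3 := expRxMexpNx_1 x.
have h4 : expR x - 1 <= x * expR x by nra.
rewrite ger0_norm; last by lra.
apply: (@le_trans _ _ (`|x| * `|expR x - 1|)).
  by rewrite -normrM; apply: le_trans (ler_norm _); lra.
have := expRB1_le x; have := normr_ge0 x.
rewrite -[x ^+ 2]real_normK ?num_real//; nra.
Qed.

(** The constant 4 counts four real errors, each at most r^2 exp r with r = |h|: with h = a + ib,
    the real part splits into exp a - 1 - a and exp a (cos b - 1), the imaginary part into (exp a -
    1) sin b and sin b - b. *)
Lemma cexp_taylor h : cmod (cexp h - 1 - h) <= 4 * cmod h ^+ 2 * expR (cmod h).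
Proof.
apply: (le_trans (cmod_le_ReIm _)).
rewrite !(ReD, ImD, ReN, ImN)/=.
set a := complex.Re h; set b := complex.Im h; set r := cmod h.
have ar : `|a| <= r by exact: Re_le_cmod.
have br : `|b| <= r by exact: Im_le_cmod.
have a0 := normr_ge0 a; have b0 := normr_ge0 b.
have E0 := expR_gt0 r.
have E1 : 1 <= expR r by rewrite -expR0 ler_expR (le_trans a0).
have Ea : expR `|a| <= expR r by rewrite ler_expR.
have Eaa : expR a <= expR r by rewrite ler_expR (le_trans (ler_norm _)).
have Ea0 := expR_gt0 a.
have h1 : `|expR a - 1 - a| <= r ^+ 2 * expR r.
  apply: (le_trans (expRB1B_le a)); rewrite -[a ^+ 2]real_normK ?num_real//.
  by rewrite ler_pM ?sqr_ge0 ?expR_ge0// ler_pXn2r// nnegrE (le_trans a0).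
have h2 : `|expR a * (cos b - 1)| <= r ^+ 2 * expR r.
  rewrite normrM (ger0_norm (ltW Ea0)) mulrC ler_pM ?expR_ge0//.
  apply: (le_trans (norm_cosB1_le2 b)); rewrite -[b ^+ 2]real_normK ?num_real//.
  by rewrite ler_pXn2r// nnegrE (le_trans b0).
have h3 : `|(expR a - 1) * sin b| <= r ^+ 2 * expR r.
  rewrite normrM; have := expRB1_le a; have := norm_sin_le b => k1 k2.
  rewrite (_ : r ^+ 2 * expR r = (r * expR r) * r); last by ring.
  by apply: ler_pM => //; [apply: (le_trans k2); apply: ler_pM; rewrite ?expR_ge0 |
    exact: le_trans k1 br].
have h4 : `|sin b - b| <= r ^+ 2 * expR r.
  apply: (le_trans (norm_sinB_le2 b)); rewrite -[b ^+ 2]real_normK ?num_real//.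
  have k : `|b| ^+ 2 <= r ^+ 2 by rewrite ler_pXn2r// nnegrE (le_trans b0).
  have := sqr_ge0 r; nra.
have e1 : expR a * cos b - 1 - a = (expR a - 1 - a) + expR a * (cos b - 1) by ring.
have e2 : expR a * sin b - 0 - b = (expR a - 1) * sin b + (sin b - b) by ring.
rewrite e1 e2.
have := ler_normD (expR a - 1 - a) (expR a * (cos b - 1)).
have := ler_normD ((expR a - 1) * sin b) (sin b - b).
lra.
Qed.

End modulus.

(** * Complex differentiability and the mean value inequality *)

Section complex_derivative.
Context {R : realType}.
Local Notation C := R[i].
Implicit Types (f g : C -> C) (z w h D : C).

(** A form without division, which also makes sense for h = 0; in a composition the inner increment
    may well vanish. *)
Definition cderiv f z D := forall e : R, 0 < e -> exists2 d : R, 0 < d &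
  forall h, cmod h < d -> cmod (f (z + h) - f z - D * h) <= e * cmod h.

Lemma cderiv_lip f z D : cderiv f z D -> exists2 d : R, 0 < d &
  forall h, cmod h < d -> cmod (f (z + h) - f z) <= (1 + cmod D) * cmod h.
Proof.
move=> /(_ 1 ltr01)[d d0 H]; exists d => // h /H; rewrite mul1r => Hh.
have := cmodD (f (z + h) - f z - D * h) (D * h); rewrite subrK cmodM => k.
by rewrite mulrDl mul1r (le_trans k)// lerD2r.
Qed.

Lemma cderiv_cst c z : cderiv (fun=> c) z 0.
Proof.
move=> e e0; exists 1 => // h _.
by rewrite subrr mul0r subrr cmod0 mulr_ge0 ?cmod_ge0// ltW.
Qed.

Lemma cderiv_id z : cderiv id z 1.
Proof.
move=> e e0; exists 1 => // h _.
rewrite /= (_ : _ - _ = 0); last by ring.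
by rewrite cmod0 mulr_ge0 ?cmod_ge0// ltW.
Qed.

Lemma cderivD f g z D E : cderiv f z D -> cderiv g z E ->
  cderiv (fun w => f w + g w) z (D + E).
Proof.
move=> Hf Hg e e0; have e20 : 0 < e / 2 by rewrite divr_gt0.
have [d1 d10 H1] := Hf _ e20; have [d2 d20 H2] := Hg _ e20.
exists (Num.min d1 d2); first by rewrite lt_min d10.
move=> h; rewrite lt_min => /andP[/H1 k1 /H2 k2].
rewrite (_ : _ - _ = (f (z + h) - f z - D * h) + (g (z + h) - g z - E * h)).
  by apply: (le_trans (cmodD _ _)); lra.
by ring.
Qed.

Lemma cderivM f g z D E : cderiv f z D -> cderiv g z E ->
  cderiv (fun w => f w * g w) z (D * g z + f z * E).
Proof.
move=> Hf Hg e e0.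
have [d0 d00 L] := cderiv_lip Hf.
(* [K] collects the coefficients of the three error terms below, and the summand 1 makes it
   positive. The product of the two increments is of second order, which is why |h| < e / K is also
   imposed. *)
pose K := 1 + cmod (g z) + cmod (f z) + (1 + cmod D) * (1 + cmod E).
have gz0 := cmod_ge0 (g z); have fz0 := cmod_ge0 (f z).
have D0 := cmod_ge0 D; have E0 := cmod_ge0 E.
have P0 : 0 <= (1 + cmod D) * (1 + cmod E) by rewrite mulr_ge0// addr_ge0.
have K0 : 0 < K by rewrite /K; lra.
have eK : 0 < e / K by rewrite divr_gt0.
have [d1 d10 H1] := Hf _ eK; have [d2 d20 H2] := Hg _ eK.
have [d3 d30 L3] := cderiv_lip Hg.
exists (Num.min (Num.min d0 d1) (Num.min (Num.min d2 d3) (e / K))).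
  by rewrite !lt_min d00 d10 d20 d30.
move=> h; rewrite !lt_min -!andbA => /and5P[h0 h1 h2 h3 h4].
have l0 := L _ h0; have {}H1 := H1 _ h1; have {}H2 := H2 _ h2.
have l3 := L3 _ h3.
rewrite (_ : _ - _ = (f (z + h) - f z - D * h) * g z +
   f z * (g (z + h) - g z - E * h) + (f (z + h) - f z) * (g (z + h) - g z)).
  apply: (le_trans (cmodD _ _)); apply: (le_trans (lerD (cmodD _ _) (lexx _))).
  rewrite !cmodM.
  have ch := cmod_ge0 h.
  have k1 : cmod (f (z + h) - f z - D * h) * cmod (g z) <=
     (e / K * cmod h) * cmod (g z) by rewrite ler_wpM2r.
  have k2 : cmod (f z) * cmod (g (z + h) - g z - E * h) <=
     cmod (f z) * (e / K * cmod h) by rewrite ler_wpM2l.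
  have k3 : cmod (f (z + h) - f z) * cmod (g (z + h) - g z) <=
     ((1 + cmod D) * cmod h) * ((1 + cmod E) * cmod h).
    by rewrite ler_pM// cmod_ge0.
  have k4 : ((1 + cmod D) * cmod h) * ((1 + cmod E) * cmod h) <=
     (1 + cmod D) * (1 + cmod E) * (e / K * cmod h).
    rewrite (_ : _ * _ * _ = (1 + cmod D) * (1 + cmod E) * (cmod h * cmod h)).
      by rewrite ler_wpM2l// ler_wpM2r// ltW.
    by ring.
  have -> : e * cmod h = K * (e / K * cmod h) by field; rewrite gt_eqF.
  have k5 : 0 <= e / K * cmod h by rewrite mulr_ge0// ltW.
  move: k1 k2 k3 k4 k5; rewrite /K; set t := e / _ * _; lra.
by ring.
Qed.

Lemma cderiv_comp f g z D E : cderiv f z D -> cderiv g (f z) E ->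
  cderiv (fun w => g (f w)) z (E * D).
Proof.
move=> Hf Hg e e0; have [d0 d00 L] := cderiv_lip Hf.
have D0 := cmod_ge0 D; have E0 := cmod_ge0 E.
pose K := 2 + cmod D + cmod E.
have K0 : 0 < K by rewrite /K; lra.
have eK : 0 < e / K by rewrite divr_gt0.
have [d1 d10 H1] := Hf _ eK; have [d2 d20 H2] := Hg _ eK.
have D1 : 0 < 1 + cmod D by lra.
exists (Num.min (Num.min d0 d1) (d2 / (1 + cmod D))).
  by rewrite !lt_min d00 d10 divr_gt0.
move=> h; rewrite !lt_min -!andbA => /and3P[h0 h1 h2].
have l0 := L _ h0; have {}H1 := H1 _ h1.
have ch := cmod_ge0 h.
have h3 : cmod (f (z + h) - f z) < d2.
  by apply: (le_lt_trans l0); rewrite mulrC -ltr_pdivlMr.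
have := H2 _ h3; rewrite (addrC (f z)) subrK => {}H2.
rewrite (_ : _ - _ = (g (f (z + h)) - g (f z) - E * (f (z + h) - f z)) +
   E * (f (z + h) - f z - D * h)); last by ring.
apply: (le_trans (cmodD _ _)); rewrite cmodM.
have k1 : e / K * cmod (f (z + h) - f z) <= e / K * ((1 + cmod D) * cmod h).
  by rewrite ler_wpM2l// ltW.
have k2 : cmod E * cmod (f (z + h) - f z - D * h) <= cmod E * (e / K * cmod h).
  by rewrite ler_wpM2l.
have -> : e * cmod h = K * (e / K * cmod h) by field; rewrite gt_eqF.
have k5 : 0 <= e / K * cmod h by rewrite mulr_ge0// ltW.
have k6 : e / K * ((1 + cmod D) * cmod h) = (1 + cmod D) * (e / K * cmod h) by ring.
by move: H2 k1 k2 k5; rewrite k6 /K; set t := e / _ * _; lra.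
Qed.

Lemma cderiv_cexp z : cderiv cexp z (cexp z).
Proof.
move=> e e0; pose M := 4 * cmod (cexp z) * expR 1.
have M0 : 0 < M by rewrite !mulr_gt0 ?expR_gt0// cmod_cexp expR_gt0.
exists (Num.min 1 (e / M)); first by rewrite lt_min ltr01 divr_gt0.
move=> h; rewrite lt_min => /andP[h1 h2].
rewrite cexpD (_ : _ - _ = cexp z * (cexp h - 1 - h)); last by ring.
rewrite cmodM.
have T := cexp_taylor h; have ch := cmod_ge0 h.
have k1 : expR (cmod h) <= expR 1 by rewrite ler_expR ltW.
have k2 : 4 * cmod h ^+ 2 * expR (cmod h) <= 4 * cmod h ^+ 2 * expR 1.
  by rewrite ler_wpM2l// mulr_ge0// sqr_ge0.
have k3 : cmod (cexp z) * cmod (cexp h - 1 - h) <=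
    cmod (cexp z) * (4 * cmod h ^+ 2 * expR 1).
  by rewrite ler_wpM2l ?cmod_ge0//; exact: le_trans T k2.
apply: (le_trans k3).
rewrite (_ : cmod (cexp z) * _ = (cmod h * M) * cmod h); last by rewrite /M; ring.
by rewrite ler_wpM2r// -ler_pdivlMr// ltW.
Qed.

Lemma cderiv_inv z : z != 0 -> cderiv GRing.inv z (- z^-1 ^+ 2).
Proof.
move=> z0 e e0; have cz : 0 < cmod z by rewrite cmod_gt0.
exists (Num.min (cmod z / 2) (e * cmod z ^+ 3 / 2)).
  by rewrite lt_min !divr_gt0// mulr_gt0// exprn_gt0.
move=> h; rewrite lt_min => /andP[h1 h2].
have k0 : cmod z / 2 <= cmod (z + h).
  have := cmodD (z + h) (- h); rewrite addrK cmodN; lra.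
have czh : 0 < cmod (z + h) by lra.
have zh0 : z + h != 0 by rewrite -cmod_gt0.
rewrite (_ : _ - _ = h * h * (z^-1 ^+ 2 * (z + h)^-1)); last first.
  by field; rewrite zh0 z0.
have ch := cmod_ge0 h.
rewrite expr2 !cmodM !cmodV mulrAC ler_wpM2r// -!invfM.
rewrite ler_pdivrMr; last by rewrite !mulr_gt0.
apply: (le_trans (ltW h2)).
rewrite (_ : e * cmod z ^+ 3 / 2 = (e * cmod z ^+ 2) * (cmod z / 2)); last by field.
rewrite [leRHS](_ : _ = (e * cmod z ^+ 2) * cmod (z + h)); last by ring.
by rewrite ler_wpM2l// mulr_ge0 ?sqr_ge0// ltW.
Qed.

(** The form with these coefficients is the imaginary part of f dz, and its closedness is one of the
    Cauchy-Riemann equations. This part suffices: its integral along a vertical side is that of Re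
    f. *)
Lemma cderiv_closed_diff f (x y : R) D : cderiv f (Complex x y) D ->
  closed_diff_at (fun s t => complex.Im (f (Complex s t)))
                 (fun s t => complex.Re (f (Complex s t))) x y.
Proof.
move=> H; exists (complex.Im D), (- complex.Im D), (complex.Re D) => e e0.
have [d d0 Hd] := H e e0; exists (d / 2); first by rewrite divr_gt0.
move=> h k hd kd.
have hk : cmod (Complex h k) <= `|h| + `|k| by exact: cmod_le_ReIm.
have hk' : cmod (Complex h k) < d by lra.
have := Hd _ hk'.
have -> : Complex x y + Complex h k = Complex (x + h) (y + k) :> C by [].
move=> K; have {}K : cmod (f (Complex (x + h) (y + k)) - f (Complex x y) -
    D * Complex h k) <= e * (`|h| + `|k|).
  by apply: (le_trans K); rewrite ler_wpM2l// ltW.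
split; [apply: le_trans (le_trans (Im_le_cmod _) K)|
        apply: le_trans (le_trans (Re_le_cmod _) K)].
  by rewrite !(ImD, ImN) ImM/= (addrC (complex.Im D * h)).
by rewrite !(ReD, ReN) ReM/= mulNr.
Qed.

(* Cauchy's theorem for [w |-> f (z0 + exp w)], which has period [2 pi i],
   shows that the mean of [f] over a circle does not depend on the radius. *)
Lemma mean_value_le f z0 (r K : R) : 0 < r ->
  (forall w, cmod (w - z0) <= r -> exists D, cderiv f w D) ->
  (forall w, cmod (w - z0) = r -> complex.Re (f w) <= K) ->
  complex.Re (f z0) <= K.
Proof.
move=> r0 Hf HK; rewrite leNgt; apply/negP => Kf.
pose e := (complex.Re (f z0) - K) / 2.
have e0 : 0 < e by rewrite divr_gt0// subr_gt0.
have [D0 HD0] : exists D, cderiv f z0 D.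
  by apply: Hf; rewrite subrr cmod0 ltW.
have [d d0 L] := cderiv_lip HD0.
have D1 : 0 < 1 + cmod D0 by have := cmod_ge0 D0; lra.
(* One circle so small that Re f stays above Re f(z0) - e on it, by the Lipschitz bound at z0; no
   limit of vanishing radius has to be taken. *)
pose rho := Num.min (Num.min d r / 2) (e / (1 + cmod D0)).
have dr0 : 0 < Num.min d r by rewrite lt_min d0.
have rho0 : 0 < rho.
  by rewrite /rho lt_min; apply/andP; split; apply: divr_gt0.
have rhor : rho < r.
  rewrite /rho gt_min; apply/orP; left.
  have : Num.min d r <= r by rewrite ge_min lexx orbT.
  lra.
have rhod : rho < d.
  rewrite /rho gt_min; apply/orP; left.
  have : Num.min d r <= d by rewrite ge_min lexx.
  lra.
pose g w := f (z0 + cexp w).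
have Hg s t : s <= ln r -> exists D, cderiv g (Complex s t) D.
  move=> sr; have [|D HD] := Hf (z0 + cexp (Complex s t)).
    rewrite (addrC z0) addrK cmod_cexp/=.
    by rewrite -ler_expR lnK// in sr.
  exists (D * (0 + cexp (Complex s t))).
  by apply: (@cderiv_comp (fun w => z0 + cexp w)) HD;
    apply: cderivD; [exact: cderiv_cst | exact: cderiv_cexp].
have pi0 : 0 < pi *+ 2 :> R by rewrite pmulrn_lgt0// pi_gt0.
have lr : ln rho < ln r by rewrite ltr_ln.
have cd : closed_diff_on (fun s t => complex.Im (g (Complex s t)))
    (fun s t => complex.Re (g (Complex s t))) (ln rho) (ln r) 0 (pi *+ 2).
  move=> x y /andP[_ xr] _; have [D HD] := Hg x y xr.
  exact: cderiv_closed_diff HD.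
have c1 : sint (fun t => complex.Re (g (Complex (ln r) t))) 0 (pi *+ 2) <=
    K * (pi *+ 2 - 0).
  rewrite -(@sint_cst _ K 0) ?(ltW pi0)//; apply: sint_le.
  - by apply: closed_diff_on_contr cd _; rewrite lexx andbT ltW.
  - exact: cont_on_cst.
  - move=> t _; apply: HK.
    by rewrite (addrC z0) addrK cmod_cexp/= lnK.
have c2 : (complex.Re (f z0) - e) * (pi *+ 2 - 0) <=
    sint (fun t => complex.Re (g (Complex (ln rho) t))) 0 (pi *+ 2).
  rewrite -(@sint_cst _ (complex.Re (f z0) - e) 0) ?(ltW pi0)//; apply: sint_le.
  - exact: cont_on_cst.
  - by apply: closed_diff_on_contr cd _; rewrite lexx ltW.
  - move=> t _; have cr : cmod (cexp (Complex (ln rho) t)) = rho.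
      by rewrite cmod_cexp/= lnK.
    have := L (cexp (Complex (ln rho) t)); rewrite cr => /(_ rhod) k.
    have k2 : (1 + cmod D0) * rho <= e.
      by rewrite mulrC -ler_pdivlMr// /rho ge_min lexx orbT.
    have := le_trans (Re_le_cmod _) (le_trans k k2).
    by rewrite ReD ReN ler_norml => /andP[+ _]; rewrite lerBrDr addrC.
have := goursat lr pi0 cd; rewrite /circulation.
(* By periodicity the two horizontal sides carry the same integral and cancel, so the two vertical
   ones agree. *)
rewrite (_ : (fun x => complex.Im (g (Complex x (pi *+ 2)))) =
             (fun x => complex.Im (g (Complex x 0)))); last first.
  by apply/funext => x; rewrite /g /cexp/= cos2pi sin2pi cos0 sin0.
move=> E; have {}E : sint (fun t => complex.Re (g (Complex (ln rho) t))) 0 (pi *+ 2) =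
    sint (fun t => complex.Re (g (Complex (ln r) t))) 0 (pi *+ 2).
  move: E; move: (sint _ _ _) => u; move: (sint _ _ _) => v; move: (sint _ _ _) => w E.
  by move: E; rewrite (addrC u) addrK => /eqP; rewrite subr_eq0 => /eqP ->.
have c3 : (complex.Re (f z0) - e) * (pi *+ 2 - 0) <= K * (pi *+ 2 - 0).
  by apply: le_trans c1; rewrite -E; exact: c2.
clear E cd c1 c2.
apply/negP: c3; rewrite ler_pM2r ?subr0// -ltNge ltrBrDr -ltrBrDl.
by rewrite /e ltr_pdivrMr// ltr_pMr ?subr_gt0// ltr1n.
Qed.

End complex_derivative.

(** * Maximum modulus on a rectangle and the three lines lemma *)

Section three_lines.
Context {R : realType}.
Local Notation C := R[i].
Implicit Types (f g : C -> C) (z w h : C).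

Lemma cmod_dist z w : `|cmod z - cmod w| <= cmod (z - w).
Proof.
have h1 := cmodD (z - w) w; have h2 := cmodD (w - z) z.
by rewrite subrK in h1; rewrite subrK cmodB in h2; rewrite ler_norml; lra.
Qed.

Definition in_strip z := 0 <= complex.Re z <= 1.

Definition strip_continuous f := forall z, in_strip z -> forall e : R, 0 < e ->
  exists2 d : R, 0 < d & forall w, in_strip w -> cmod (w - z) < d ->
    cmod (f w - f z) <= e.

Lemma strip_continuousM f g : strip_continuous f -> strip_continuous g ->
  strip_continuous (fun z => f z * g z).
Proof.
move=> cf cg z sz e e0.
pose K := 1 + cmod (f z) + cmod (g z).
have fz0 := cmod_ge0 (f z); have gz0 := cmod_ge0 (g z).
have K0 : 0 < K by rewrite /K; lra.
pose e' := Num.min 1 (e / K).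
have e'0 : 0 < e' by rewrite lt_min ltr01 divr_gt0.
have [d1 d10 H1] := cf z sz _ e'0; have [d2 d20 H2] := cg z sz _ e'0.
exists (Num.min d1 d2); first by rewrite lt_min d10.
move=> w sw; rewrite lt_min => /andP[/(H1 _ sw) k1 /(H2 _ sw) k2].
rewrite (_ : _ - _ = (f w - f z) * (g w - g z) + (f w - f z) * g z +
    f z * (g w - g z)); last by ring.
apply: (le_trans (cmodD _ _)); apply: (le_trans (lerD (cmodD _ _) (lexx _))).
rewrite !cmodM.
have e1 : e' <= 1 by rewrite /e' ge_min lexx.
have eK : K * e' <= e by rewrite mulrC -ler_pdivlMr// /e' ge_min lexx orbT.
have a0 := cmod_ge0 (f w - f z); have b0 := cmod_ge0 (g w - g z).
have h1 : cmod (f w - f z) * cmod (g w - g z) <= e' * 1.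
  by apply: ler_pM => //; exact: le_trans k2 e1.
have h2 : cmod (f w - f z) * cmod (g z) <= e' * cmod (g z) by rewrite ler_wpM2r.
have h3 : cmod (f z) * cmod (g w - g z) <= cmod (f z) * e' by rewrite ler_wpM2l.
by apply: le_trans eK; rewrite /K; lra.
Qed.

Lemma cderiv_strip_continuous f :
  (forall z, in_strip z -> exists D, cderiv f z D) -> strip_continuous f.
Proof.
move=> H z /H[D HD] e e0; have [d d0 L] := cderiv_lip HD.
have D1 : 0 < 1 + cmod D by have := cmod_ge0 D; lra.
exists (Num.min d (e / (1 + cmod D))); first by rewrite lt_min d0 divr_gt0.
move=> w _; rewrite lt_min => /andP[/L]; rewrite (addrC z) subrK => k1 k2.
by apply: (le_trans k1); rewrite mulrC -ler_pdivlMr// ltW.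
Qed.

(** Adding a small multiple of |z|^2 to |f|^2 makes the function strictly subharmonic, so that it
    has no interior maximum at all. This replaces the open mapping theorem or a connectedness
    argument. *)
Lemma max_modulus_rectangle f (K M : R) : 0 < K -> strip_continuous f ->
  (forall z, 0 < complex.Re z < 1 -> exists D, cderiv f z D) ->
  (forall z, in_strip z -> `|complex.Im z| <= K ->
     [\/ complex.Re z = 0, complex.Re z = 1 | `|complex.Im z| = K] ->
     cmod (f z) <= M) ->
  forall z, in_strip z -> `|complex.Im z| <= K -> cmod (f z) <= M.
Proof.
move=> K0 cf df bf zs szs Kzs; rewrite leNgt; apply/negP => Mf.
have M0 : 0 <= M.
  have := @bf 0; rewrite /in_strip/= lexx ler01 normr0 ltW// => /(_ isT isT) k.
  by apply: le_trans (cmod_ge0 _) (k _); constructor 1.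
(* On the rectangle |z|^2 <= 1 + K^2, so the perturbation costs at most half of |f(zs)|^2 - M^2 and
   the maximum cannot lie on the boundary. *)
pose dl := (cmod (f zs) ^+ 2 - M ^+ 2) / (2 * (1 + K ^+ 2)).
have K2 : 0 < 1 + K ^+ 2 by rewrite ltr_pwDl// sqr_ge0.
have MM : M ^+ 2 < cmod (f zs) ^+ 2 by rewrite ltr_pXn2r ?nnegrE ?cmod_ge0.
have dl0 : 0 < dl by rewrite divr_gt0 ?subr_gt0// mulr_gt0.
have dlE : dl * (1 + K ^+ 2) = (cmod (f zs) ^+ 2 - M ^+ 2) / 2.
  by rewrite /dl; field; rewrite gt_eqF.
pose N (p : R * R) := cmod (f (Complex p.1 p.2)) ^+ 2 + dl * (p.1 ^+ 2 + p.2 ^+ 2).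
pose Q : set (R * R) := `[0, 1] `*` `[- K, K].
have QE x y : Q (x, y) <-> in_strip (Complex x y) /\ `|y| <= K.
  by rewrite /Q /in_strip /= !in_itv/= ler_norml.
have cQ : compact Q by apply: compact_setX; exact: segment_compact.
have Q0 : Q !=set0.
  by exists (complex.Re zs, complex.Im zs); apply/QE; case: (zs) szs Kzs.
have cN : {within Q, continuous N}.
  apply/subspace_continuousP => -[x y] Qxy.
  have h1 : p.1 @[p --> within Q (nbhs (x, y))] --> x.
    exact: cvg_trans (cvg_app _ (cvg_within _)) cvg_fst.
  have h2 : p.2 @[p --> within Q (nbhs (x, y))] --> y.
    exact: cvg_trans (cvg_app _ (cvg_within _)) cvg_snd.
  have h3 : cmod (f (Complex p.1 p.2)) @[p --> within Q (nbhs (x, y))] -->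
      cmod (f (Complex x y)).
    have [sxy _] := (QE x y).1 Qxy.
    apply/cvgrPdist_le => e e0; have [d d0 Hd] := cf _ sxy e e0.
    have d20 : 0 < d / 2 by rewrite divr_gt0.
    have /cvgrPdist_lt/(_ _ d20) k1 := h1; have /cvgrPdist_lt/(_ _ d20) k2 := h2.
    near=> p.
    have [spp _] : in_strip (Complex p.1 p.2) /\ `|p.2| <= K.
      apply/QE; rewrite -surjective_pairing; near: p; exact: withinT.
    apply: (le_trans (cmod_dist _ _)); rewrite cmodB; apply: Hd => //.
    apply: (le_lt_trans (cmod_le_ReIm _)) => /=.
    have : `|x - p.1| < d / 2 by near: p.
    have : `|y - p.2| < d / 2 by near: p.
    by rewrite distrC (distrC x); lra.
  rewrite /N; under eq_fun do rewrite !expr2.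
  apply: cvgD; first exact: (cvgM h3 h3).
  apply: cvgM; first exact: cvg_cst.
  by apply: cvgD; [exact: (cvgM h1 h1) | exact: (cvgM h2 h2)].
have [[x y] /set_mem Qxy Nmax] := compact_EVT_max Q0 cQ cN.
have {}Nmax u v : Q (u, v) -> N (u, v) <= N (x, y) by move=> /mem_set /Nmax.
have [sxy yK] := (QE _ _).1 Qxy.
have x01 : 0 <= x <= 1 by [].
have Nzs : cmod (f zs) ^+ 2 <= N (x, y).
  have := @Nmax (complex.Re zs) (complex.Im zs).
  have -> : N (complex.Re zs, complex.Im zs) = cmod (f zs) ^+ 2 +
     dl * (complex.Re zs ^+ 2 + complex.Im zs ^+ 2) by rewrite /N/=; case: (zs).
  have h : 0 <= dl * (complex.Re zs ^+ 2 + complex.Im zs ^+ 2).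
    by rewrite mulr_ge0 ?(ltW dl0)// addr_ge0 ?sqr_ge0.
  have q : Q (complex.Re zs, complex.Im zs) by apply/QE; case: (zs) szs Kzs.
  by move=> /(_ q); lra.
have nb : ~ [\/ x = 0, x = 1 | `|y| = K].
  move=> bd; have k := @bf (Complex x y) sxy yK bd.
  have k2 : cmod (f (Complex x y)) ^+ 2 <= M ^+ 2.
    by rewrite ler_pXn2r ?nnegrE ?cmod_ge0.
  have k3 : dl * (x ^+ 2 + y ^+ 2) <= dl * (1 + K ^+ 2).
    rewrite ler_pM2l//; apply: lerD; first by rewrite expr_le1//; case/andP: x01.
    by rewrite -[y ^+ 2]real_normK ?num_real// ler_pXn2r// nnegrE ltW.
  by move: Nzs; rewrite /N/=; lra.
have x0 : 0 < x.
  rewrite lt_def (andP x01).1 andbT; apply/eqP => e; apply: nb; exact: Or31.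
have x1 : x < 1.
  rewrite lt_def (andP x01).2 andbT; apply/eqP => e; apply: nb; exact: Or32.
have yK' : `|y| < K.
  rewrite lt_def yK andbT; apply/eqP => e; apply: nb; exact: Or33.
pose r := Num.min (Num.min x (1 - x)) (K - `|y|) / 2.
have r0 : 0 < r by rewrite divr_gt0// !lt_min x0 !subr_gt0 x1.
have [rx [r1 rK]] : r < x /\ r < 1 - x /\ r < K - `|y|.
  set m := Num.min (Num.min x (1 - x)) (K - `|y|).
  have m1 : m <= x by rewrite /m !ge_min lexx.
  have m2 : m <= 1 - x by rewrite /m !ge_min lexx orbT.
  have m3 : m <= K - `|y| by rewrite /m !ge_min lexx orbT.
  have m0 : 0 < m by rewrite /m !lt_min x0 !subr_gt0 x1.
  by rewrite /r -/m; lra.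
pose z1 := Complex x y; pose a := f z1.
have disc w : cmod (w - z1) <= r ->
    0 < complex.Re w < 1 /\ Q (complex.Re w, complex.Im w).
  move=> h; have := le_trans (Re_le_cmod _) h; have := le_trans (Im_le_cmod _) h.
  rewrite !(ReD, ReN, ImD, ImN)/= !ler_norml => /andP[? ?] /andP[? ?].
  have rw : 0 < complex.Re w < 1 by lra.
  split=> //; apply/QE; split.
    by rewrite /in_strip/= ltW ?ltW//; case/andP: rw.
  have := ler_normD (complex.Im w - y) y; rewrite subrK.
  have : `|complex.Im w - y| <= r by rewrite ler_norml; lra.
  lra.
(* A holomorphic function whose real part lies below [N] up to constants: 2 Re(conj(a) f) <= |a|^2 +
   |f|^2, and 2 Re(conj(z1) (w - z1)) = |w|^2 - |z1|^2 - r^2 on the circle. Maximality of [N] at z1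
   bounds Re g there by 2 |a|^2 - dl r^2, less than its value 2 |a|^2 at the centre. *)
pose g w := (2%:C%C * a^*%C) * f w + ((2 * dl)%:C%C * z1^*%C) * (w + (- z1)).
have := @mean_value_le R g z1 r (2 * cmod a ^+ 2 - dl * r ^+ 2) r0.
have [a1 [a2 aE]] : exists a1 a2, a = Complex a1 a2.
  by case: (a) => u v; exists u, v.
have gz1 : complex.Re (g z1) = 2 * cmod a ^+ 2.
  rewrite /g subrr mulr0 addr0 -/a aE cmod_sqr/=; ring.
have drr : 0 < dl * r ^+ 2 by rewrite mulr_gt0// exprn_gt0.
rewrite gz1 => H.
suff : 2 * cmod a ^+ 2 <= 2 * cmod a ^+ 2 - dl * r ^+ 2 by lra.
apply: H => [w /disc[/df [D HD] _]|w wr].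
  exists ((0 * f w + (2%:C%C * a^*%C) * D) +
         (0 * (w + (- z1)) + ((2 * dl)%:C%C * z1^*%C) * (1 + 0))).
  apply: cderivD; apply: cderivM; try exact: cderiv_cst.
    exact: HD.
  apply: cderivD; [exact: cderiv_id | exact: cderiv_cst].
have wr' : cmod (w - z1) <= r by rewrite wr.
have [_ /Nmax] := disc w wr'.
have := cmod_sqr (w - z1); rewrite wr /N !cmod_sqr.
rewrite (_ : Complex (complex.Re w) (complex.Im w) = w); last by case: (w).
rewrite /g /z1 -/z1 -/a aE; case: (f w) => b1 b2; case: (w) => u v /= -> k.
have := sqr_ge0 (a1 - b1); have := sqr_ge0 (a2 - b2); move: k.
rewrite !sqrrB; lra.
Unshelve. all: by end_near. Qed.

(* The factor [k / (k + z)] makes [f] small at infinity at a cost that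
   disappears as [k] grows. *)
Lemma three_lines f (B M t : R) : strip_continuous f ->
  (forall z, 0 < complex.Re z < 1 -> exists D, cderiv f z D) ->
  (forall z, in_strip z -> cmod (f z) <= B) ->
  (forall z, complex.Re z = 0 \/ complex.Re z = 1 -> cmod (f z) <= M) ->
  0 <= t <= 1 -> cmod (f t%:C%C) <= M.
Proof.
move=> cf df fB fM t01.
have M0 : 0 <= M by apply: le_trans (cmod_ge0 _) (fM 0 _); left.
have B0 : 0 <= B by apply: le_trans (cmod_ge0 _) (fB t%:C%C _).
(* The limit k to infinity is replaced by the single value (M + 1) / (|f| - M), for which the
   inequality reads M + 1 <= M. *)
suff key (k : R) : 0 < k -> cmod (f t%:C%C) * k <= M * (k + 1).
  rewrite leNgt; apply/negP => Mf.
  have d0 : 0 < cmod (f t%:C%C) - M by rewrite subr_gt0.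
  have k0 : 0 < (M + 1) / (cmod (f t%:C%C) - M) by rewrite divr_gt0// ltr_wpDl.
  have := key _ k0; rewrite mulrDr mulr1 -lerBlDl -mulrBl.
  by rewrite mulrC divfK ?gt_eqF//; lra.
move=> k0; pose u z := k%:C%C + z; pose g z := f z * (u z)^-1.
have uk z : in_strip z -> k <= cmod (u z).
  move=> /andP[z0 _]; apply: le_trans (Re_le_cmod _); rewrite ReD/=.
  by apply: le_trans (ler_norm _); lra.
have u0 z : in_strip z -> u z != 0.
  by move=> /uk h; rewrite -cmod_gt0 (lt_le_trans k0).
have du z : in_strip z -> exists D, cderiv (fun w => (u w)^-1) z D.
  move=> /u0 h; eexists; apply: (@cderiv_comp R u GRing.inv); last exact: cderiv_inv.
  by apply: cderivD; [exact: cderiv_cst | exact: cderiv_id].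
have cg : strip_continuous g.
  by apply: strip_continuousM => //; exact: cderiv_strip_continuous.
have dg z : 0 < complex.Re z < 1 -> exists D, cderiv g z D.
  move=> z01; have [D HD] := df z z01; have [|E HE] := du z.
    by case/andP: z01 => ? ?; rewrite /in_strip !ltW.
  by eexists; apply: cderivM; [exact: HD | exact: HE].
have gz z : in_strip z -> cmod (g z) * cmod (u z) = cmod (f z).
  by move=> sz; rewrite -cmodM /g mulfVK// u0.
have sM : 0 <= M / k by rewrite divr_ge0// ltW.
suff gt : cmod (g t%:C%C) <= M / k.
  rewrite -gz// -mulrA mulrC.
  have ut : cmod (u t%:C%C) <= k + 1.
    rewrite /u -rmorphD cmod_real ger0_norm; case/andP: t01; lra.
  have c0 := cmod_ge0 (g t%:C%C); have c1 := cmod_ge0 (u t%:C%C).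
  have h1 : cmod (g t%:C%C) * k <= M by rewrite -ler_pdivlMr.
  rewrite mulrC mulrA -mulrA (mulrC _ k) mulrA.
  by apply: ler_pM => //; rewrite mulr_ge0// ltW.
rewrite leNgt; apply/negP => gM.
pose e := cmod (g t%:C%C).
have e0 : 0 < e by exact: le_lt_trans sM gM.
(* A height beyond which |g| is below its value e at t, since B / K < e. *)
pose K := 1 + B / e.
have K0 : 0 < K by rewrite ltr_pwDl// divr_ge0// ltW.
have := @max_modulus_rectangle g K (Num.max (M / k) (B / K)) K0 cg dg.
have bd z : in_strip z -> `|complex.Im z| <= K ->
    [\/ complex.Re z = 0, complex.Re z = 1 | `|complex.Im z| = K] ->
    cmod (g z) <= Num.max (M / k) (B / K).
  move=> sz _; rewrite le_max.
  have cu := lt_le_trans k0 (uk _ sz).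
  have E : cmod (g z) = cmod (f z) / cmod (u z) by rewrite /g cmodM cmodV.
  have side : complex.Re z = 0 \/ complex.Re z = 1 -> cmod (g z) <= M / k.
    move=> /fM h; rewrite E; apply: ler_pM => //; rewrite ?invr_ge0 ?cmod_ge0//.
    by rewrite lef_pV2 ?posrE//; exact: uk.
  case=> [/or_introl/side ->//|/or_intror/side ->//|zK].
  have Ku : K <= cmod (u z).
    by apply: le_trans (Im_le_cmod _); rewrite /u ImD/= add0r zK.
  apply/orP; right; rewrite E; apply: ler_pM; rewrite ?invr_ge0 ?cmod_ge0 ?fB//.
  by rewrite lef_pV2 ?posrE.
move=> /(_ bd t%:C%C t01); rewrite normr0 => /(_ (ltW K0)).
rewrite le_max leNgt gM/= ler_pdivlMr// -/e /K mulrDr mulr1 mulrC divfK ?gt_eqF//.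
by lra.
Qed.

End three_lines.

(** * Functional calculus through the spectral decomposition *)

Section spectral_calculus.
Variables (K : numClosedFieldType) (n : nat).
Implicit Types (X U P Q : 'M[K]_n) (d e : 'rV[K]_n) (phi psi : K -> K).

(* Locked: unification would otherwise unfold [spectralmx]. *)
Fact scalc_key : unit. Proof. exact: tt. Qed.
Definition scalc phi X : 'M[K]_n := locked_with scalc_key
  (invmx (spectralmx X) *m diag_mx (map_mx phi (spectral_diag X)) *m
   spectralmx X).

Lemma scalcE phi X : scalc phi X =
  invmx (spectralmx X) *m diag_mx (map_mx phi (spectral_diag X)) *m
  spectralmx X.
Proof. by rewrite /scalc locked_withE. Qed.

Lemma eq_diag_conj P Q d e : d = e -> P *m diag_mx d *m Q = P *m diag_mx e *m Q.
Proof. by move->. Qed.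

Lemma diag_conjM P d e : P \in unitmx ->
  (invmx P *m diag_mx d *m P) *m (invmx P *m diag_mx e *m P) =
  invmx P *m diag_mx (\row_j (d 0 j * e 0 j)) *m P.
Proof.
by move=> Pu; rewrite !mulmxA mulmxK// -(mulmxA (invmx P)) mulmx_diag.
Qed.

Lemma scalcM phi psi X : scalc phi X *m scalc psi X =
  scalc (fun t => phi t * psi t) X.
Proof.
rewrite !scalcE diag_conjM ?spectral_unit//; apply: eq_diag_conj.
by apply/rowP => j; rewrite !mxE.
Qed.

Lemma scalcD phi psi X : scalc phi X + scalc psi X =
  scalc (fun t => phi t + psi t) X.
Proof.
rewrite !scalcE -mulmxDl -mulmxDr -raddfD; apply: eq_diag_conj.
by apply/rowP => j; rewrite !mxE.
Qed.

Lemma scalc_cst (c : K) X : scalc (fun=> c) X = c%:M.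
Proof.
rewrite scalcE (_ : map_mx _ _ = const_mx c); last first.
  by apply/rowP => j; rewrite !mxE.
by rewrite diag_const_mx mul_mx_scalar -scalemxAl mulVmx ?spectral_unit// scalemx1.
Qed.

Lemma scalcZ (c : K) phi X : c *: scalc phi X = scalc (fun t => c * phi t) X.
Proof. by rewrite -scalcM scalc_cst mul_scalar_mx. Qed.

Lemma eq_scalc phi psi X :
  (forall j, phi (spectral_diag X 0 j) = psi (spectral_diag X 0 j)) ->
  scalc phi X = scalc psi X.
Proof.
by move=> e; rewrite !scalcE; apply: eq_diag_conj; apply/rowP => j; rewrite !mxE.
Qed.

Lemma scalcV phi X : (forall j, phi (spectral_diag X 0 j) != 0) ->
  scalc phi X \in unitmx /\ scalc (fun t => (phi t)^-1) X = invmx (scalc phi X).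
Proof.
move=> h; have e : scalc phi X *m scalc (fun t => (phi t)^-1) X = 1%:M.
  by rewrite scalcM -(scalc_cst 1 X); apply: eq_scalc => j; rewrite mulfV.
have [u _] := mulmx1_unit e; split=> //.
by rewrite -[LHS]mul1mx -(mulVmx u) -mulmxA e mulmx1.
Qed.

Lemma scalc_coord m phi X (v : 'M[K]_(n, m)) j k :
  (spectralmx X *m (scalc phi X *m v)) j k =
  phi (spectral_diag X 0 j) * (spectralmx X *m v) j k.
Proof.
rewrite scalcE !mulmxA mulmxV ?spectral_unit// mul1mx -mulmxA.
by rewrite mul_diag_mx !mxE.
Qed.

(** Where the entry of [Z] at (i, j) is nonzero, the hypothesis forces d_i = e_j, hence equal values
    of [phi]; elsewhere both sides are 0. *)
Lemma diag_mx_intertwine (Z : 'M[K]_n) d e phi :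
  diag_mx d *m Z = Z *m diag_mx e ->
  diag_mx (map_mx phi d) *m Z = Z *m diag_mx (map_mx phi e).
Proof.
move=> /matrixP ZE; apply/matrixP => i j; move: (ZE i j).
rewrite !(mul_diag_mx, mul_mx_diag) !mxE => h.
have [->|z0] := eqVneq (Z i j) 0; first by rewrite mulr0 mul0r.
have {h}: d 0 i = e 0 j by apply: (mulIf z0); rewrite h mulrC.
by rewrite mulrC => ->.
Qed.

(* Uniqueness of the functional calculus: if [Z] intertwines two diagonal
   matrices, it intertwines their images by any function. *)
Lemma scalc_unique U X d phi : U \in unitmx -> X \is normalmx ->
  X = invmx U *m diag_mx d *m U ->
  scalc phi X = invmx U *m diag_mx (map_mx phi d) *m U.
Proof.
move=> Uu /orthomx_spectralP XE XU; rewrite scalcE.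
have Pu := spectral_unit X.
move: (spectralmx X) (spectral_diag X) XE Pu => P s XE Pu.
pose Z := P *m invmx U.
have ZE : diag_mx s *m Z = Z *m diag_mx d.
  rewrite /Z -[P *m invmx U *m _]mulmxA.
  rewrite (_ : invmx U *m diag_mx d = X *m invmx U); last first.
    by rewrite XU mulmxK.
  by rewrite mulmxA XE !mulmxA mulmxV// mul1mx.
have {}ZE := diag_mx_intertwine phi ZE.
rewrite -[LHS](mulmxKV Uu); congr (_ *m U).
by rewrite -!mulmxA -/Z ZE /Z !mulmxA mulVmx// mul1mx.
Qed.

Lemma scalc_normal phi X : scalc phi X \is normalmx.
Proof.
rewrite scalcE; apply/orthomx_spectral_subproof; eexists (_, _); last by [].
exact: spectral_unitarymx.
Qed.

(** The basis that [spectralmx] selects for [scalc phi X] may differ from the one for [X];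
    uniqueness makes the choice irrelevant. This is what lets a power of [absmx] be read off the
    Gram matrix. *)
Lemma scalc_comp phi psi X :
  scalc psi (scalc phi X) = scalc (fun t => psi (phi t)) X.
Proof.
rewrite (scalc_unique psi (spectral_unit X) (scalc_normal phi X) (scalcE phi X)).
by rewrite scalcE -map_mx_comp.
Qed.

Lemma hermsym_scalc X : X \is hermsymmx -> X = scalc id X.
Proof.
move=> Xh; have /orthomx_spectralP XE := hermitian_normalmx Xh.
by rewrite {1}XE scalcE map_mx_id.
Qed.

Lemma trmxC_mul m p q (A : 'M[K]_(m, p)) (D : 'M[K]_(p, q)) :
  (A *m D)^t* = D^t* *m A^t*.
Proof. by rewrite trmx_mul map_mxM. Qed.

Lemma gram_unitary m p q (P : 'M[K]_m) (v : 'M[K]_(m, p)) (w : 'M[K]_(m, q)) :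
  P \is unitarymx -> (P *m v)^t* *m (P *m w) = v^t* *m w.
Proof.
move=> Pu; rewrite trmxC_mul -mulmxA (mulmxA (P^t* ) P w).
by rewrite -(invmx_unitary Pu) mulVmx ?unitarymx_unit// mul1mx.
Qed.

Lemma gram_hermsym (B : 'M[K]_n) : B^t* *m B \is hermsymmx.
Proof. by apply/is_hermitianmxP; rewrite expr0 scale1r trmxC_mul trmxCK. Qed.

Lemma gram_coord (B : 'M[K]_n) (v : 'cV[K]_n) :
  ((B *m v)^t* *m (B *m v)) 0 0 =
  \sum_j spectral_diag (B^t* *m B) 0 j *
    ((spectralmx (B^t* *m B) *m v) j 0)^* * (spectralmx (B^t* *m B) *m v) j 0.
Proof.
set X := B^t* *m B; have Xh : X \is hermsymmx := gram_hermsym B.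
have -> : (B *m v)^t* *m (B *m v) = v^t* *m (scalc id X *m v).
  by rewrite -(hermsym_scalc Xh) trmxC_mul /X !mulmxA.
rewrite -(gram_unitary _ _ (spectral_unitarymx X)) mxE.
apply: eq_bigr => j _; rewrite scalc_coord !mxE; ring.
Qed.

End spectral_calculus.

(** * Symbols of a real variable, Euclidean norms and Gram matrices *)

Section functional_calculus.
Context {R : realType}.
Local Notation C := R[i].
Variable n : nat.
Implicit Types (X B : 'M[C]_n) (v : 'cV[C]_n) (phi psi : R -> C).

(** The spectrum of a Hermitian matrix is real but stored in [R[i]]. Taking real parts allows
    symbols on [R], in agreement with [powmx]. *)
Definition fcalc phi X : 'M[C]_n := scalc (fun z => phi (complex.Re z)) X.

Definition spec X (j : 'I_n) : R := complex.Re (spectral_diag X 0 j).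

Lemma fcalcE phi X : fcalc phi X = invmx (spectralmx X) *m
  diag_mx (map_mx (fun z => phi (complex.Re z)) (spectral_diag X)) *m
  spectralmx X.
Proof. exact: scalcE. Qed.

Lemma powmxE X a : powmx X a = fcalc (fun t => (t `^ a)%:C%C) X.
Proof. by rewrite fcalcE. Qed.

Lemma fcalc_coord phi X v j :
  (spectralmx X *m (fcalc phi X *m v)) j 0 =
  phi (spec X j) * (spectralmx X *m v) j 0.
Proof. exact: scalc_coord. Qed.

Lemma fcalcM phi psi X : fcalc phi X *m fcalc psi X =
  fcalc (fun t => phi t * psi t) X.
Proof. exact: scalcM. Qed.

Lemma fcalcD phi psi X : fcalc phi X + fcalc psi X =
  fcalc (fun t => phi t + psi t) X.
Proof. exact: scalcD. Qed.

Lemma fcalc_cst (c : C) X : fcalc (fun=> c) X = c%:M.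
Proof. exact: scalc_cst. Qed.

Lemma fcalcZ (c : C) phi X : c *: fcalc phi X = fcalc (fun t => c * phi t) X.
Proof. exact: scalcZ. Qed.

Lemma eq_fcalc phi psi X : (forall j, phi (spec X j) = psi (spec X j)) ->
  fcalc phi X = fcalc psi X.
Proof. by move=> e; exact: eq_scalc. Qed.

Lemma fcalc_unit phi X : (forall j, phi (spec X j) != 0) ->
  fcalc phi X \in unitmx.
Proof. by move=> h; exact: (scalcV h).1. Qed.

Lemma fcalcV phi X : (forall j, phi (spec X j) != 0) ->
  fcalc (fun t => (phi t)^-1) X = invmx (fcalc phi X).
Proof. by move=> h; exact: (scalcV h).2. Qed.

Lemma fcalc_comp phi psi X :
  fcalc psi (fcalc phi X) = fcalc (fun t => psi (complex.Re (phi t))) X.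
Proof. exact: scalc_comp. Qed.

Lemma enorm_sqr m (v : 'cV[C]_m) : enorm v ^+ 2 = \sum_i cmod (v i 0) ^+ 2.
Proof.
rewrite /enorm sqr_sqrtr; last by apply: sumr_ge0 => i _; rewrite addr_ge0 ?sqr_ge0.
by apply: eq_bigr => i _; rewrite cmod_sqr.
Qed.

Lemma enormE m (v : 'cV[C]_m) : enorm v = Num.sqrt (\sum_i cmod (v i 0) ^+ 2).
Proof. by rewrite -enorm_sqr sqrtr_sqr ger0_norm// sqrtr_ge0. Qed.

Lemma enorm_ge0 m (v : 'cV[C]_m) : 0 <= enorm v.
Proof. exact: sqrtr_ge0. Qed.

Lemma cmod_sqrC (z : C) : (cmod z ^+ 2)%:C%C = z^* * z.
Proof. by rewrite mulrC -normCK normr_cmod rmorphXn. Qed.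

Lemma enorm_sqrC m (v : 'cV[C]_m) :
  ((enorm v ^+ 2)%:C%C : C) = (v^t* *m v) 0 0.
Proof.
rewrite enorm_sqr rmorph_sum/= mxE; apply: eq_bigr => i _.
by rewrite cmod_sqrC !mxE.
Qed.

Lemma enorm_unitary m (P : 'M[C]_m) (v : 'cV[C]_m) : P \is unitarymx ->
  enorm (P *m v) = enorm v.
Proof.
move=> Pu; apply/eqP; rewrite -(@eqrXn2 _ 2) ?enorm_ge0//; apply/eqP.
by apply: (@complexI R); rewrite !enorm_sqrC gram_unitary.
Qed.

Lemma enorm_fcalc phi X v : enorm (fcalc phi X *m v) ^+ 2 =
  \sum_j (cmod (phi (spec X j)) * cmod ((spectralmx X *m v) j 0)) ^+ 2.
Proof.
rewrite -(enorm_unitary _ (spectral_unitarymx X)) enorm_sqr.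
by apply: eq_bigr => j _; rewrite fcalc_coord cmodM.
Qed.

Lemma enorm_spectral X v : enorm v ^+ 2 =
  \sum_j cmod ((spectralmx X *m v) j 0) ^+ 2.
Proof. by rewrite -enorm_sqr enorm_unitary// spectral_unitarymx. Qed.

Lemma hermsym_spectral_real X j : X \is hermsymmx ->
  spectral_diag X 0 j = (spec X j)%:C%C.
Proof.
by move=> /hermitian_spectral_diag_real/mxOverP/(_ 0 j)/RRe_real ->.
Qed.

Lemma hermsym_real_spec X : X \is hermsymmx ->
  X = fcalc (fun t => t%:C%C) X.
Proof.
move=> Xh; rewrite {1}(hermsym_scalc Xh); apply: eq_scalc => j.
exact: hermsym_spectral_real.
Qed.

Lemma enorm_gram B v : enorm (B *m v) ^+ 2 =
  \sum_j spec (B^t* *m B) j * cmod ((spectralmx (B^t* *m B) *m v) j 0) ^+ 2.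
Proof.
apply: (@complexI R); rewrite enorm_sqrC gram_coord rmorph_sum/=.
apply: eq_bigr => j _; rewrite -mulrA rmorphM/= cmod_sqrC.
by rewrite (hermsym_spectral_real _ (gram_hermsym B)).
Qed.

(** The test vector [v] is the j-th eigenvector of the Gram matrix, so |B v|^2 is exactly the j-th
    eigenvalue. *)
Lemma spec_gram_ge0 B j : 0 <= spec (B^t* *m B) j.
Proof.
set X := B^t* *m B; pose v := invmx (spectralmx X) *m delta_mx j (0 : 'I_1).
have Pv : spectralmx X *m v = delta_mx j 0.
  by rewrite /v mulmxA mulmxV ?spectral_unit// mul1mx.
have := enorm_gram B v; rewrite -/X Pv.
rewrite (bigD1 j)//= !mxE !eqxx cmod1 expr1n mulr1 big1; last first.
  by move=> i ij; rewrite !mxE (negPf ij) cmod0 expr0n mulr0.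
by rewrite addr0 => <-; exact: sqr_ge0.
Qed.

Lemma spec_gram_gt0 B j : B \in unitmx -> 0 < spec (B^t* *m B) j.
Proof.
move=> Bu; rewrite lt_def spec_gram_ge0 andbT; apply/eqP => e.
set X := B^t* *m B in e; pose v := invmx (spectralmx X) *m delta_mx j (0 : 'I_1).
have Pv : spectralmx X *m v = delta_mx j 0.
  by rewrite /v mulmxA mulmxV ?spectral_unit// mul1mx.
have := enorm_gram B v; rewrite -/X Pv.
rewrite big1 => [/eqP|i _]; last first.
  rewrite !mxE; have [->|_] := eqVneq i j; first by rewrite e mul0r.
  by rewrite cmod0 expr0n mulr0.
rewrite sqrf_eq0 => /eqP Bv; have {}Bv : B *m v = 0.
  apply/colP => i; rewrite [RHS]mxE; apply/eqP; rewrite -cmod_eq0.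
  have : \sum_i cmod ((B *m v) i 0) ^+ 2 = 0 by rewrite -enorm_sqr Bv expr0n.
  move/eqP; rewrite psumr_eq0; last by move=> ? _; exact: sqr_ge0.
  by move/allP => /(_ i (mem_index_enum _)); rewrite sqrf_eq0.
have : spectralmx X *m (invmx B *m (B *m v)) = 0 by rewrite Bv !mulmx0.
rewrite mulKmx// Pv => /matrixP/(_ j 0).
by rewrite !mxE !eqxx => /eqP; rewrite oner_eq0.
Qed.

Lemma powmx_absmx B (a : R) : powmx (absmx B) a =
  fcalc (fun t => ((t `^ 2^-1) `^ a)%:C%C) (B^t* *m B).
Proof. by rewrite /absmx !powmxE fcalc_comp. Qed.

End functional_calculus.

(** * Measurability of complex and matrix-valued functions *)

Section complex_measurable.
Context {d : measure_display} {T : measurableType d} {R : realType}.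
Local Notation C := R[i].

Definition cmeas (f : T -> C) : Prop :=
  measurable_fun [set: T] (fun x => complex.Re (f x)) /\
  measurable_fun [set: T] (fun x => complex.Im (f x)).

Lemma cmeas_cst c : cmeas (fun=> c).
Proof. by split; exact: measurable_cst. Qed.

Lemma cmeas_real (f : T -> R) : measurable_fun [set: T] f ->
  cmeas (fun x => (f x)%:C%C).
Proof. by move=> mf; split=> //; exact: measurable_cst. Qed.

Lemma cmeasD f g : cmeas f -> cmeas g -> cmeas (fun x => f x + g x).
Proof.
move=> [f1 f2] [g1 g2]; split.
  by under eq_fun do rewrite ReD; exact: measurable_funD.
by under eq_fun do rewrite ImD; exact: measurable_funD.
Qed.

Lemma cmeasM f g : cmeas f -> cmeas g -> cmeas (fun x => f x * g x).
Proof.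
move=> [f1 f2] [g1 g2]; split.
  under eq_fun do rewrite ReM.
  by apply: measurable_funB; exact: measurable_funM.
by under eq_fun do rewrite ImM; apply: measurable_funD; exact: measurable_funM.
Qed.

Lemma cmeas_sum (I : Type) (s : seq I) (P : pred I) (f : I -> T -> C) :
  (forall i, cmeas (f i)) -> cmeas (fun x => \sum_(i <- s | P i) f i x).
Proof.
move=> mf; elim: s => [|i s IH].
  by under eq_fun do rewrite big_nil; exact: cmeas_cst.
under eq_fun do rewrite big_cons; case: (P i) => //; exact: cmeasD.
Qed.

Lemma cmeas_prod (I : Type) (s : seq I) (P : pred I) (f : I -> T -> C) :
  (forall i, cmeas (f i)) -> cmeas (fun x => \prod_(i <- s | P i) f i x).
Proof.
move=> mf; elim: s => [|i s IH].
  by under eq_fun do rewrite big_nil; exact: cmeas_cst.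
under eq_fun do rewrite big_cons; case: (P i) => //; exact: cmeasM.
Qed.

Lemma cmeas_conj f : cmeas f -> cmeas (fun x => (f x)^*%C).
Proof.
move=> [f1 f2]; split.
  by rewrite (_ : (fun x => _) = fun x => complex.Re (f x))//;
    apply/funext => x; case: (f x).
rewrite (_ : (fun x => _) = fun x => - complex.Im (f x)).
  exact: (measurableT_comp (@oppr_measurable R setT) f2).
by apply/funext => x; case: (f x).
Qed.

Lemma cmeas_cmod f : cmeas f -> measurable_fun [set: T] (fun x => cmod (f x)).
Proof.
move=> [f1 f2]; under eq_fun do rewrite cmodE.
apply: (measurableT_comp (continuous_measurable_fun (@sqrt_continuous R))).
by apply: measurable_funD; exact: measurable_funX.
Qed.

Lemma cmeas_inv f : cmeas f -> cmeas (fun x => (f x)^-1).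
Proof.
(* The identity also holds at the zeros of f, where the inverse is 0 by convention and the conjugate
   vanishes. *)
move=> mf; rewrite (_ : (fun x => _) = fun x =>
    ((cmod (f x) ^+ 2) `^ (-1))%:C%C * (f x)^*%C); last first.
  apply/funext => x; rewrite powR_inv1 ?sqr_ge0//.
  rewrite invc_norm normr_cmod -rmorphXn fmorphV//.
apply: cmeasM; last exact: cmeas_conj.
apply: cmeas_real; apply: (measurableT_comp (@measurable_powR R (-1))).
by apply: measurable_funX; exact: cmeas_cmod.
Qed.

Lemma cmeas_cvg (f : (T -> C)^nat) g : (forall k, cmeas (f k)) ->
  (forall x, complex.Re (f k x) @[k --> \oo] --> complex.Re (g x) /\
             complex.Im (f k x) @[k --> \oo] --> complex.Im (g x)) -> cmeas g.
Proof.
move=> mf fg; split.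
  apply: (@measurable_fun_cvg _ _ _ _ (fun k x => complex.Re (f k x))) => [k|x _].
    by case: (mf k).
  by case: (fg x).
apply: (@measurable_fun_cvg _ _ _ _ (fun k x => complex.Im (f k x))) => [k|x _].
  by case: (mf k).
by case: (fg x).
Qed.

Lemma measurable_mxM m n p (A : T -> 'M[C]_(m, n)) (B : T -> 'M[C]_(n, p)) :
  measurable_fun_mx A -> measurable_fun_mx B ->
  measurable_fun_mx (fun x => A x *m B x).
Proof.
move=> mA mB i j; suff : cmeas (fun x => (A x *m B x) i j) by [].
under eq_fun do rewrite mxE.
by apply: cmeas_sum => k; apply: cmeasM; [exact: mA | exact: mB].
Qed.

Lemma measurable_mxD m n (A B : T -> 'M[C]_(m, n)) :
  measurable_fun_mx A -> measurable_fun_mx B ->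
  measurable_fun_mx (fun x => A x + B x).
Proof.
move=> mA mB i j; suff : cmeas (fun x => (A x + B x) i j) by [].
by under eq_fun do rewrite mxE; exact: cmeasD (mA i j) (mB i j).
Qed.

Lemma measurable_mxZ m n (c : T -> C) (A : T -> 'M[C]_(m, n)) :
  cmeas c -> measurable_fun_mx A -> measurable_fun_mx (fun x => c x *: A x).
Proof.
move=> mc mA i j; suff : cmeas (fun x => (c x *: A x) i j) by [].
by under eq_fun do rewrite mxE; exact: cmeasM mc (mA i j).
Qed.

Lemma measurable_mx_cst m n (A : 'M[C]_(m, n)) :
  measurable_fun_mx (fun _ : T => A).
Proof. by move=> i j; exact: cmeas_cst. Qed.

Lemma measurable_trmxC m n (A : T -> 'M[C]_(m, n)) :
  measurable_fun_mx A -> measurable_fun_mx (fun x => (A x)^t* ).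
Proof.
move=> mA i j; suff : cmeas (fun x => ((A x)^t* ) i j) by [].
by under eq_fun do rewrite !mxE; exact: cmeas_conj (mA j i).
Qed.

Lemma cmeas_det n (A : T -> 'M[C]_n) : measurable_fun_mx A ->
  cmeas (fun x => \det (A x)).
Proof.
move=> mA; rewrite /determinant; apply: cmeas_sum => s.
apply: cmeasM; first exact: cmeas_cst.
by apply: cmeas_prod => i; exact: mA.
Qed.

Lemma measurable_adjmx n (A : T -> 'M[C]_n) : measurable_fun_mx A ->
  measurable_fun_mx (fun x => \adj (A x)).
Proof.
move=> mA i j; suff : cmeas (fun x => (\adj (A x)) i j) by [].
under eq_fun do rewrite mxE /cofactor.
apply: cmeasM; first exact: cmeas_cst.
apply: cmeas_det => k l; suff : cmeas (fun x => row' j (col' i (A x)) k l) by [].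
by under eq_fun do rewrite !mxE; exact: mA.
Qed.

Lemma measurable_invmx n (A : T -> 'M[C]_n) : measurable_fun_mx A ->
  (forall x, A x \in unitmx) -> measurable_fun_mx (fun x => invmx (A x)).
Proof.
move=> mA uA; rewrite /invmx; under eq_fun do rewrite uA.
by apply: measurable_mxZ; [exact/cmeas_inv/cmeas_det | exact: measurable_adjmx].
Qed.

Lemma measurable_enorm n (f : T -> 'cV[C]_n) : measurable_fun_mx f ->
  measurable_fun [set: T] (fun x => enorm (f x)).
Proof.
move=> mf; under eq_fun do rewrite enormE.
apply: (measurableT_comp (continuous_measurable_fun (@sqrt_continuous R))).
apply: measurable_sum => i; apply: measurable_funX; apply: cmeas_cmod.
exact: mf.
Qed.

Lemma eq_measurable_mx m n (A B : T -> 'M[C]_(m, n)) :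
  (forall x, A x = B x) -> measurable_fun_mx A -> measurable_fun_mx B.
Proof. by move=> /funext ->. Qed.

Section measurable_calculus.
Variables (n : nat) (X : T -> 'M[C]_n).
Hypothesis mX : measurable_fun_mx X.
Hypothesis hX : forall x, X x \is hermsymmx.
Hypothesis X0 : forall x j, 0 < spec (X x) j.

(** Measurability is asked of the whole matrix and never of its spectral factors. The symbol may
    itself vary with the point. *)
Definition mcalc (phi : T -> R -> C) :=
  measurable_fun_mx (fun x => fcalc (phi x) (X x)).

Lemma eq_mcalc phi psi : (forall x t, 0 < t -> phi x t = psi x t) ->
  mcalc phi -> mcalc psi.
Proof.
move=> e; apply: eq_measurable_mx => x.
by apply: eq_fcalc => j; exact/e/X0.
Qed.

Lemma mcalcM phi psi : mcalc phi -> mcalc psi ->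
  mcalc (fun x t => phi x t * psi x t).
Proof.
move=> m1 m2; apply: eq_measurable_mx (measurable_mxM m1 m2) => x.
exact: fcalcM.
Qed.

Lemma mcalcD phi psi : mcalc phi -> mcalc psi ->
  mcalc (fun x t => phi x t + psi x t).
Proof.
move=> m1 m2; apply: eq_measurable_mx (measurable_mxD m1 m2) => x.
exact: fcalcD.
Qed.

Lemma mcalc_cst (c : T -> C) : cmeas c -> mcalc (fun x _ => c x).
Proof.
move=> mc; apply: eq_measurable_mx (measurable_mxZ mc (measurable_mx_cst 1%:M)) => x.
by rewrite fcalc_cst scalemx1.
Qed.

Lemma mcalc_id : mcalc (fun _ t => t%:C%C).
Proof. by apply: eq_measurable_mx mX => x; exact: hermsym_real_spec. Qed.

Lemma mcalcX phi k : mcalc phi -> mcalc (fun x t => phi x t ^+ k).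
Proof.
move=> m; elim: k => [|k IH].
  by apply: (eq_mcalc _ (mcalc_cst (cmeas_cst 1))) => x t _; rewrite expr0.
by apply: (eq_mcalc _ (mcalcM m IH)) => x t _; rewrite exprS.
Qed.

Lemma mcalcV phi : (forall x t, 0 < t -> phi x t != 0) -> mcalc phi ->
  mcalc (fun x t => (phi x t)^-1).
Proof.
move=> p0 m; rewrite /mcalc.
have h x j : phi x (spec (X x) j) != 0 by exact/p0/X0.
apply: (@eq_measurable_mx _ _ (fun x => invmx (fcalc (phi x) (X x)))) => [x|].
  by rewrite -fcalcV.
apply: measurable_invmx => // x.
exact: fcalc_unit.
Qed.

Lemma mcalc_sum (I : Type) (s : seq I) (phi : I -> T -> R -> C) :
  (forall i, mcalc (phi i)) -> mcalc (fun x t => \sum_(i <- s) phi i x t).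
Proof.
move=> mf; elim: s => [|i s IH].
  by apply: (eq_mcalc _ (mcalc_cst (cmeas_cst 0))) => x t _; rewrite big_nil.
by apply: (eq_mcalc _ (mcalcD (mf i) IH)) => x t _; rewrite big_cons.
Qed.

Definition ccvg (u : C^nat) (l : C) :=
  complex.Re (u k) @[k --> \oo] --> complex.Re l /\
  complex.Im (u k) @[k --> \oo] --> complex.Im l.

Lemma ccvgD u v a b : ccvg u a -> ccvg v b -> ccvg (fun k => u k + v k) (a + b).
Proof.
move=> [u1 u2] [v1 v2]; split.
  by rewrite ReD; under eq_fun do rewrite ReD; exact: cvgD.
by rewrite ImD; under eq_fun do rewrite ImD; exact: cvgD.
Qed.

Lemma ccvgM u v a b : ccvg u a -> ccvg v b -> ccvg (fun k => u k * v k) (a * b).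
Proof.
move=> [u1 u2] [v1 v2]; split.
  rewrite ReM; under eq_fun do rewrite ReM.
  by apply: cvgB; [exact: (cvgM u1 v1) | exact: (cvgM u2 v2)].
rewrite ImM; under eq_fun do rewrite ImM.
by apply: cvgD; [exact: (cvgM u1 v2) | exact: (cvgM u2 v1)].
Qed.

Lemma ccvg_cst a : ccvg (fun=> a) a.
Proof. by split; exact: cvg_cst. Qed.

Lemma ccvg_sum (I : Type) (s : seq I) (u : I -> C^nat) (a : I -> C) :
  (forall i, ccvg (u i) (a i)) ->
  ccvg (fun k => \sum_(i <- s) u i k) (\sum_(i <- s) a i).
Proof.
move=> h; elim: s => [|i s IH].
  by under eq_fun do rewrite big_nil; rewrite big_nil; exact: ccvg_cst.
by under eq_fun do rewrite big_cons; rewrite big_cons; exact: ccvgD.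
Qed.

(** At a fixed point each entry is a finite sum over the spectrum with coefficients that do not
    depend on k, so convergence of the symbols at positive arguments is enough. The spectral factors
    occur only at that fixed point. *)
Lemma mcalc_cvg (phi : (T -> R -> C)^nat) psi : (forall k, mcalc (phi k)) ->
  (forall x t, 0 < t -> ccvg (fun k => phi k x t) (psi x t)) -> mcalc psi.
Proof.
move=> m h i j; suff : cmeas (fun x => fcalc (psi x) (X x) i j) by [].
have E f x : fcalc f (X x) i j = \sum_l invmx (spectralmx (X x)) i l *
    f (spec (X x) l) * spectralmx (X x) l j.
  rewrite fcalcE mxE; apply: eq_bigr => l _.
  by rewrite mul_mx_diag !mxE.
apply: (@cmeas_cvg (fun k x => fcalc (phi k x) (X x) i j)) => [k|x]; first exact: m.
suff : ccvg (fun k => fcalc (phi k x) (X x) i j) (fcalc (psi x) (X x) i j) by [].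
under eq_fun do rewrite E; rewrite E.
apply: ccvg_sum => l; apply: ccvgM; last exact: ccvg_cst.
by apply: ccvgM; [exact: ccvg_cst | exact: h].
Qed.

End measurable_calculus.
End complex_measurable.

(** * From rational to continuous symbols *)

Section continuous_calculus.
Context {d : measure_display} {T : measurableType d} {R : realType}.
Local Notation C := R[i].
Variables (n : nat) (X : T -> 'M[C]_n).
Hypothesis mX : measurable_fun_mx X.
Hypothesis hX : forall x, X x \is hermsymmx.
Hypothesis X0 : forall x j, 0 < spec (X x) j.

Lemma ccvg_real (u : R^nat) (l : R) : u @ \oo --> l ->
  ccvg (fun k => (u k)%:C%C) l%:C%C.
Proof. by move=> ul; split=> //; exact: cvg_cst. Qed.

(** Rational symbols without poles on the positive half-line that converge to a step at a; the value
    1/2 at the jump is repaired afterwards. *)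
Lemma cvg_ratio_powers (a t : R) : 0 < a -> 0 < t ->
  t ^+ k / (a ^+ k + t ^+ k) @[k --> \oo] -->
    ((if t < a then 0 else if t == a then 2^-1 else 1) : R).
Proof.
move=> a0 t0; have c1 (q : R) : 0 < q < 1 ->
    1 / (1 + q ^+ k) @[k --> \oo] --> (1 : R).
  move=> /andP[q0 q1]; rewrite -[X in _ --> X](divr1 1).
  apply: cvgM; first exact: cvg_cst.
  apply: cvgV => //; rewrite -[X in _ --> X]addr0.
  by apply: cvgD; [exact: cvg_cst | apply: cvg_expr; rewrite ger0_norm ?ltW].
have ak k : 0 < a ^+ k by rewrite exprn_gt0.
have tk k : 0 < t ^+ k by rewrite exprn_gt0.
case: ltgtP => [ta|at'|->].
- rewrite (_ : (fun k => _) = fun k => (t / a) ^+ k * (1 / (1 + (t / a) ^+ k))).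
    have q01 : 0 < t / a < 1 by rewrite divr_gt0//= ltr_pdivrMr// mul1r.
    rewrite -[X in _ --> X](mul0r 1); apply: cvgM; last exact: c1.
    by apply: cvg_expr; rewrite ger0_norm ?ltW//; case/andP: q01.
  apply/funext => k; rewrite expr_div_n; field.
  by rewrite !gt_eqF ?addr_gt0.
- rewrite (_ : (fun k => _) = fun k => 1 / (1 + (a / t) ^+ k)).
    by apply: c1; rewrite divr_gt0//= ltr_pdivrMr// mul1r.
  by apply/funext => k; rewrite expr_div_n; field; rewrite !gt_eqF ?addr_gt0.
- rewrite (_ : (fun k => _) = fun=> 2^-1); first exact: cvg_cst.
  by apply/funext => k; field; rewrite !gt_eqF ?addr_gt0.
Qed.

Lemma mcalc_indicator (a : R) : 0 < a ->
  mcalc X (fun _ t => ((a < t)%R%:R : R)%:C%C).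
Proof.
move=> a0.
pose g t : R := if t < a then 0 else if t == a then 2^-1 else 1.
have mg : mcalc X (fun _ t => (g t)%:C%C).
  apply: (@mcalc_cvg _ _ _ _ _ X0 (fun k _ t => (t ^+ k / (a ^+ k + t ^+ k))%:C%C)).
    move=> k; apply: (@eq_mcalc _ _ _ _ _ X0 (fun _ t =>
      t%:C%C ^+ k * ((a ^+ k)%:C%C + t%:C%C ^+ k)^-1)).
      by move=> _ t t0; rewrite rmorphM/= fmorphV rmorphD/= !rmorphXn.
    apply: mcalcM; first exact: (mcalcX X0 _ (mcalc_id mX hX)).
    apply: (mcalcV X0).
      move=> _ t t0; rewrite -rmorphXn -rmorphD/= fmorph_eq0 gt_eqF//.
      by rewrite addr_gt0// exprn_gt0.
    apply: mcalcD; last exact: (mcalcX X0 _ (mcalc_id mX hX)).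
    exact: (mcalc_cst X (cmeas_cst _)).
  move=> _ t t0; apply: ccvg_real; exact: cvg_ratio_powers.
(* The polynomial 2 g^2 - g fixes 0 and 1 and sends 1/2 to 0, which yields the indicator of t >
   a. *)
apply: (@eq_mcalc _ _ _ _ _ X0 (fun x t =>
  (2%:C%C * ((g t)%:C%C * (g t)%:C%C) + (-1) * (g t)%:C%C))).
  move=> _ t t0; rewrite mulN1r -!rmorphM -rmorphB/=; congr (_%:C%C).
  by rewrite /g; case: ltgtP => _ /=; field.
apply: mcalcD; apply: mcalcM; [exact: (mcalc_cst X (cmeas_cst _)) | exact: mcalcM |
  exact: (mcalc_cst X (cmeas_cst _)) | exact: mg].
Qed.

(** The shift j + 1 keeps every node positive, because symbols are only controlled on the open
    half-line. Mesh and lower end are 1 / (k + 1), and (k + 1)^2 intervals reach beyond k + 1. *)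
Definition grid k j : R := j.+1%:R / k.+1%:R.

Definition step_approx k (phi : R -> C) t : C :=
  \sum_(j < k.+1 ^ 2) phi (grid k j) *
    (((grid k j < t)%R%:R : R)%:C%C - ((grid k j.+1 < t)%R%:R : R)%:C%C).

Lemma grid_le k i j : (i <= j)%N -> grid k i <= grid k j.
Proof. by move=> ij; rewrite /grid ler_pM2r// ler_nat. Qed.

Lemma step_approxE k phi t : k.+1%:R^-1 < t -> t <= k.+1%:R ->
  exists s, [/\ 0 < s, `|t - s| <= k.+1%:R^-1 & step_approx k phi t = phi s].
Proof.
move=> kt tk; have k0 : 0 < k.+1%:R :> R by [].
have ex : exists m, t <= grid k m.
  exists (k.+1 ^ 2)%N; rewrite /grid ler_pdivlMr// -[leRHS]natr1 natrX.
  have : t * k.+1%:R <= k.+1%:R * k.+1%:R by rewrite ler_pM2r.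
  by rewrite expr2; lra.
case: (ex_minnP ex) => -[|j] tj minj.
  by move: tj; rewrite /grid div1r leNgt kt.
have jt : grid k j < t by rewrite ltNge; apply/negP => /minj; rewrite ltnn.
have jN : (j < k.+1 ^ 2)%N.
  apply: minj; rewrite /grid ler_pdivlMr// -[leRHS]natr1 natrX.
  have : t * k.+1%:R <= k.+1%:R * k.+1%:R by rewrite ler_pM2r.
  by rewrite expr2; lra.
have gS : grid k j.+1 = grid k j + k.+1%:R^-1.
  by rewrite /grid -[j.+2%:R]natr1 mulrDl div1r.
exists (grid k j); split.
- by rewrite divr_gt0.
- by have tj' := tj; rewrite /= gS in tj'; rewrite ger0_norm ?subr_ge0 ?(ltW jt)// lerBlDl.
- rewrite /step_approx (bigD1 (Ordinal jN))//= jt ltNge tj/= subr0 mulr1.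
  rewrite big1 ?addr0// => i; rewrite -val_eqE/= neq_ltn => /orP[ij|ji].
    have h := le_lt_trans (grid_le k ij) jt.
    by rewrite h (le_lt_trans (grid_le k (leqnSn i)) h) subrr mulr0.
  have h := le_trans tj (grid_le k ji).
  by rewrite !ltNge h (le_trans h (grid_le k (leqnSn i)))/= subrr mulr0.
Qed.

(** Nodes of the grid do not depend on the point, so each step approximation needs only
    measurability of [phi] at fixed arguments; continuity in t then gives the limit. *)
Lemma mcalc_continuous (phi : T -> R -> C) :
  (forall t, 0 < t -> cmeas (phi^~ t)) ->
  (forall x t, 0 < t -> {for t, continuous (fun t => complex.Re (phi x t))}) ->
  (forall x t, 0 < t -> {for t, continuous (fun t => complex.Im (phi x t))}) ->
  mcalc X phi.
Proof.
move=> mphi cR cI; apply: (@mcalc_cvg _ _ _ _ _ X0 (fun k x t => step_approx k (phi x) t)).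
  move=> k; apply: (mcalc_sum X0) => i; apply: mcalcM.
    by apply: mcalc_cst; apply: mphi; rewrite divr_gt0.
  apply: mcalcD; first by apply: mcalc_indicator; rewrite divr_gt0.
  apply: (@eq_mcalc _ _ _ _ _ X0 (fun _ t => -1 * ((grid k i.+1 < t)%R%:R : R)%:C%C)).
    by move=> _ t _; rewrite mulN1r.
  apply: mcalcM; first exact: (mcalc_cst X (cmeas_cst _)).
  by apply: mcalc_indicator; rewrite divr_gt0.
move=> x t t0.
have near_eq : \forall k \near \oo, exists s,
    [/\ 0 < s, `|t - s| <= k.+1%:R^-1 & step_approx k (phi x) t = phi x s].
  near=> k; apply: step_approxE.
    near: k; exact: near_infty_natSinv_lt (PosNum t0).
  apply: (@le_trans _ _ k%:R); last by rewrite ler_nat.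
  by near: k; exact: nbhs_infty_ger.
have key (f : R -> R) (F : C -> R) : (forall s, f s = F (phi x s)) ->
    {for t, continuous f} -> F (step_approx k (phi x) t) @[k --> \oo] --> F (phi x t).
  move=> fF cf; apply/cvgrPdist_le => e e0.
  have /cvgrPdist_le/(_ e e0)/nbhs_ballP[dl/= dl0 H] := cf.
  near=> k.
  have [s [s0 ts ->]] : exists s,
    [/\ 0 < s, `|t - s| <= k.+1%:R^-1 & step_approx k (phi x) t = phi x s].
    by near: k.
  rewrite -!fF; apply: H; rewrite /ball/=; apply: (le_lt_trans ts).
  near: k; exact: near_infty_natSinv_lt (PosNum dl0).
by split; [apply: (key _ _ (fun=> erefl)); exact: cR |
  apply: (key _ _ (fun=> erefl)); exact: cI].
Unshelve. all: by end_near. Qed.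

End continuous_calculus.

Opaque enorm.

(** * Classes, representatives and weighted norms *)

Section L0_functions.
Context {d : measure_display} {T : measurableType d} {R : realType}.
Local Notation C := R[i].
Variables (mu : {measure set T -> \bar R}) (n : nat).
Implicit Types (g : T -> 'cV[C]_n) (W : T -> 'M[C]_n) (F : L0 mu n).

(** A total map with the default value 0 on functions that are not measurable, so that elements of
    L^0 can be written without carrying a proof. *)
Definition toL0 g : L0 mu n :=
  match pselect (measurable_fun_mx g) with
  | left m => \pi_(L0 mu n) (MVFun (asboolT m))
  | right _ => 0
  end.

Lemma toL0_pi g (m : measurable_fun_mx g) :
  toL0 g = \pi_(L0 mu n) (MVFun (asboolT m)).
Proof.
rewrite /toL0; case: pselect => // m'; congr (\pi_(L0 mu n) _).
by congr MVFun; exact: Prop_irrelevance.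
Qed.

Definition ofL0 F : T -> 'cV[C]_n := (repr F : mvfunType T R n).

Lemma measurable_ofL0 F : measurable_fun_mx (ofL0 F).
Proof. by rewrite /ofL0; case: (repr F) => g /= /asboolP. Qed.

Lemma toL0_ofL0 F : toL0 (ofL0 F) = F.
Proof.
rewrite (toL0_pi (measurable_ofL0 F)) -[RHS]reprK; congr (\pi_(L0 mu n) _).
exact: val_inj.
Qed.

Lemma ofL0_toL0 g : measurable_fun_mx g -> ofL0 (toL0 g) = g %[ae mu].
Proof. by move=> m; rewrite /ofL0 (toL0_pi m); exact: L0_reprP. Qed.

Lemma toL0D g1 g2 : measurable_fun_mx g1 -> measurable_fun_mx g2 ->
  toL0 (fun x => g1 x + g2 x) = toL0 g1 + toL0 g2.
Proof.
move=> m1 m2; rewrite (toL0_pi m1) (toL0_pi m2) -L0_piD.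
rewrite (toL0_pi (measurable_mxD m1 m2)); congr (\pi_(L0 mu n) _).
exact: val_inj.
Qed.

Lemma toL0Z (a : C) g : measurable_fun_mx g ->
  toL0 (fun x => a *: g x) = a *: toL0 g.
Proof.
move=> m; rewrite (toL0_pi m) -L0_piZ.
rewrite (toL0_pi (measurable_mxZ (cmeas_cst a) m)); congr (\pi_(L0 mu n) _).
exact: val_inj.
Qed.

Definition pint (p : R) W g : \bar R :=
  (\int[mu]_x ((enorm (W x *m g x)) `^ p)%:E)%E.

Definition mnorm (p : R) (v : T -> 'cV[C]_n) : \bar R :=
  ((\int[mu]_x ((enorm (v x)) `^ p)%:E) `^ p^-1)%E.

Lemma eq_mnorm p v w : (forall x, enorm (v x) = enorm (w x)) ->
  mnorm p v = mnorm p w.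
Proof.
move=> E.
exact: (congr1 (fun h : T -> R =>
  ((\int[mu]_x ((h x) `^ p)%:E) `^ p^-1)%E) (funext E)).
Qed.

Lemma pint_ge0 p W g : (0 <= pint p W g)%E.
Proof. by apply: integral_ge0 => x _; rewrite lee_fin powR_ge0. Qed.

Lemma Lp_normE p W F : Lp_norm mu p W F = (pint p W (ofL0 F) `^ p^-1)%E.
Proof.
rewrite /Lp_norm unlock.
have E x : (`|(enorm (W x *m ofL0 F x))%:E| `^ p)%E =
    ((enorm (W x *m ofL0 F x)) `^ p)%:E.
  by rewrite abse_EFin ger0_norm ?enorm_ge0// poweR_EFin.
exact: (congr1 (fun h : T -> \bar R => ((\int[mu]_x h x) `^ p^-1)%E) (funext E)).
Qed.

Lemma measurable_enorm_powR p W g : measurable_fun_mx W -> measurable_fun_mx g ->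
  measurable_fun [set: T] (fun x => (enorm (W x *m g x)) `^ p).
Proof.
move=> mW mg; apply: (measurableT_comp (@measurable_powR R p)).
by apply: measurable_enorm; exact: measurable_mxM.
Qed.

Lemma eq_pint_ae p W g1 g2 : measurable_fun_mx W -> measurable_fun_mx g1 ->
  measurable_fun_mx g2 -> g1 = g2 %[ae mu] -> pint p W g1 = pint p W g2.
Proof.
move=> mW m1 m2 e; apply: ae_eq_integral => //;
  try (by apply/measurable_EFinP; exact: measurable_enorm_powR).
by apply: filterS e => x /= e Dx; rewrite e.
Qed.

Lemma Lp_norm_toL0 p W g : measurable_fun_mx W -> measurable_fun_mx g ->
  Lp_norm mu p W (toL0 g) = (pint p W g `^ p^-1)%E.
Proof.
move=> mW mg; rewrite Lp_normE.
by rewrite (eq_pint_ae p mW (measurable_ofL0 _) mg (ofL0_toL0 mg)).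
Qed.

End L0_functions.

Section sum_norm.
Context {R : realType} {V : lmodType R[i]}.
Variables N0 N1 : V -> \bar R.

Lemma sum_norm_le y z : (sum_norm N0 N1 (y + z) <= N0 y + N1 z)%E.
Proof. by apply: ereal_inf_lbound; exists (y, z). Qed.

Hypothesis N00 : forall x, (0 <= N0 x)%E.
Hypothesis N10 : forall x, (0 <= N1 x)%E.

Lemma sum_norm_ge0 x : (0 <= sum_norm N0 N1 x)%E.
Proof. by apply: le_ereal_inf_tmp => _ [y _ <-]; exact: adde_ge0. Qed.

End sum_norm.

Lemma le_powR (R : realType) (p x y : R) : 0 <= p -> 0 <= x -> x <= y ->
  x `^ p <= y `^ p.
Proof.
move=> p0 x0 xy; apply: (ge0_ler_powR p0) => //; rewrite nnegrE//.
exact: le_trans xy.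
Qed.

(* Kept folded, so that [done] does not try to unify boolean goals with it. *)
Definition invertible_field T (R : realType) n (W : T -> 'M[R[i]]_n) : Prop :=
  forall x, W x \in unitmx.

(** * Spectral coordinates for a pair of weights *)

Section weights.
Context {d : measure_display} {T : measurableType d} {R : realType}.
Local Notation C := R[i].
Variables (n : nat) (W0 W1 : T -> 'M[C]_n).
Hypothesis mW0 : measurable_fun_mx W0.
Hypothesis mW1 : measurable_fun_mx W1.
Hypothesis uW0 : invertible_field W0.
Hypothesis uW1 : invertible_field W1.

Definition ratio x : 'M[C]_n := W1 x *m invmx (W0 x).
Definition gram x : 'M[C]_n := (ratio x)^t* *m ratio x.

Lemma ratioK x (v : 'cV[C]_n) : ratio x *m (W0 x *m v) = W1 x *m v.
Proof. by rewrite /ratio mulmxA mulmxKV// (uW0 x). Qed.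

Lemma measurable_gram : measurable_fun_mx gram.
Proof.
have mr : measurable_fun_mx ratio.
  by apply: measurable_mxM => //; exact: (measurable_invmx mW0 uW0).
by apply: measurable_mxM => //; exact: measurable_trmxC.
Qed.

Lemma gram_herm x : gram x \is hermsymmx.
Proof. exact: gram_hermsym. Qed.

Lemma gram_gt0 x j : 0 < spec (gram x) j.
Proof.
by apply: spec_gram_gt0; rewrite unitmx_mul unitmx_inv (uW1 x) (uW0 x).
Qed.

Definition ccont (phi : R -> C) : Prop :=
  continuous (fun t => complex.Re (phi t)) /\
  continuous (fun t => complex.Im (phi t)).

Lemma ccont_comp_cmeas phi (c : T -> R) : ccont phi ->
  measurable_fun [set: T] c -> cmeas (fun x => phi (c x)).
Proof.
move=> [c1 c2] mc.
split; first exact: (measurableT_comp (continuous_measurable_fun c1) mc).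
exact: (measurableT_comp (continuous_measurable_fun c2) mc).
Qed.

(** The one shape of symbol needed below. As t is the square of l_j, the argument c - ln t / 2 is
    the logarithm of exp(c) / l_j, and b = theta / 2 produces l_j^theta. *)
Lemma mcalc_log (a c : T -> R) (b : R) phi : measurable_fun [set: T] a ->
  measurable_fun [set: T] c -> ccont phi ->
  mcalc gram (fun x t => (expR (a x + b * ln t))%:C%C * phi (c x - ln t / 2)).
Proof.
move=> ma mc cphi; have X0 := gram_gt0.
have mX := measurable_gram; have hX := gram_herm.
apply: mcalcM; apply: (mcalc_continuous mX hX X0).
- move=> t _; apply: cmeas_real.
  have m : measurable_fun [set: T] (fun x => a x + b * ln t).
    by apply: measurable_funD => //; exact: measurable_cst.
  exact: (measurableT_comp (@measurable_expR R) m).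
- move=> x t t0 /=; apply: continuous_comp; last exact: continuous_expR.
  apply: cvgD; first exact: cvg_cst.
  by apply: cvgM; [exact: cvg_cst | exact: continuous_ln].
- by move=> x t t0; exact: cvg_cst.
- move=> t _; apply: ccont_comp_cmeas => //.
  by apply: measurable_funB => //; exact: measurable_cst.
- move=> x t t0; apply: (@continuous_comp _ _ _ (fun t => c x - ln t / 2)
    (fun t => complex.Re (phi t))); last by case: cphi => h _; exact: h.
  apply: cvgB; first exact: cvg_cst.
  by apply: cvgM; [exact: continuous_ln | exact: cvg_cst].
- move=> x t t0; apply: (@continuous_comp _ _ _ (fun t => c x - ln t / 2)
    (fun t => complex.Im (phi t))); last by case: cphi => _ h; exact: h.
  apply: cvgB; first exact: cvg_cst.
  by apply: cvgM; [exact: continuous_ln | exact: cvg_cst].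
Qed.

(** This is 2 ln l_j, whence the factors 1/2 everywhere; [coord x (g x) j] is the coordinate u_j. *)
Definition lsp x j : R := ln (spec (gram x) j).

Definition coord x (v : 'cV[C]_n) j : C := (spectralmx (gram x) *m (W0 x *m v)) j 0.

Lemma enorm_W0 x v : enorm (W0 x *m v) ^+ 2 = \sum_j cmod (coord x v j) ^+ 2.
Proof. exact: enorm_spectral. Qed.

Lemma enorm_W1 x v : enorm (W1 x *m v) ^+ 2 =
  \sum_j (expR (lsp x j / 2) * cmod (coord x v j)) ^+ 2.
Proof.
rewrite -ratioK enorm_gram; apply: eq_bigr => j _; rewrite exprMn; congr (_ * _).
rewrite -expRM_natr mulfVK// /lsp lnK//; exact: gram_gt0.
Qed.

Variable theta : R.

Definition interp_weight x : 'M[C]_n := powmx (absmx (ratio x)) theta *m W0 x.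

Lemma powR_exp2 (t : R) : 0 < t ->
  (t `^ 2^-1) `^ theta = expR (theta / 2 * ln t).
Proof.
by move=> t0; rewrite -powRrM /powR gt_eqF// mulrC (mulrC _ theta) mulrC.
Qed.

Lemma interp_weightE x : interp_weight x =
  fcalc (fun t => (expR (theta / 2 * ln t))%:C%C) (gram x) *m W0 x.
Proof.
have e : fcalc (fun t => ((t `^ 2^-1) `^ theta)%:C%C) (gram x) =
    fcalc (fun t => (expR (theta / 2 * ln t))%:C%C) (gram x).
  by apply: eq_fcalc => j; rewrite powR_exp2 ?gram_gt0.
by rewrite /interp_weight powmx_absmx -/(gram x) e.
Qed.

Lemma enorm_interp_weight x v : enorm (interp_weight x *m v) ^+ 2 =
  \sum_j (expR (theta / 2 * lsp x j) * cmod (coord x v j)) ^+ 2.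
Proof.
rewrite interp_weightE -mulmxA enorm_fcalc; apply: eq_bigr => j _.
by rewrite cmod_real ger0_norm// expR_ge0.
Qed.

Lemma measurable_interp_weight : measurable_fun_mx interp_weight.
Proof.
have cphi : ccont (fun=> 1) by split; exact: cst_continuous.
have m := mcalc_log (theta / 2) (@measurable_cst _ _ T R setT 0)
  (@measurable_cst _ _ T R setT 0) cphi.
apply: eq_measurable_mx (measurable_mxM m mW0) => x.
have e : fcalc (fun t => (expR (0 + theta / 2 * ln t))%:C%C * 1) (gram x) =
    fcalc (fun t => (expR (theta / 2 * ln t))%:C%C) (gram x).
  by apply: eq_fcalc => j; rewrite mulr1 add0r.
by rewrite interp_weightE -e.
Qed.

Variables (g : T -> 'cV[C]_n) (tau gam : R).
Hypothesis mg : measurable_fun_mx g.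
Hypothesis tau0 : 0 < tau.

(** These are h, ln(h / tau) and ln rho_j. Where h = 0 the logarithm takes a default value, which
    does no harm: all coordinates of [g], hence the fields built from it, vanish there. *)
Definition wsize x : R := enorm (interp_weight x *m g x).
Definition lwsize x : R := ln (wsize x / tau).
Definition lrho x j : R := gam * lwsize x - lsp x j / 2.

Lemma measurable_wsize : measurable_fun [set: T] wsize.
Proof.
by apply: measurable_enorm; apply: measurable_mxM => //;
  exact: measurable_interp_weight.
Qed.

Lemma wsize_ge0 x : 0 <= wsize x. Proof. exact: enorm_ge0. Qed.

Lemma measurable_lsize : measurable_fun [set: T] lwsize.
Proof.
have m : measurable_fun [set: T] (fun x => wsize x / tau).
  by apply: measurable_funM; [exact: measurable_wsize | exact: measurable_cst].
exact: (measurableT_comp (@measurable_ln R) m).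
Qed.

Lemma wsize_sqr x : wsize x ^+ 2 =
  \sum_j (expR (theta / 2 * lsp x j) * cmod (coord x (g x) j)) ^+ 2.
Proof. exact: enorm_interp_weight. Qed.

(* In the spectral coordinates of [gram x], this is the vector whose entries
   are those of [g], multiplied by a power of [wsize x / tau], by
   [lambda ^ theta], and by [phi] at the logarithm of [rho]. *)
Definition gfield (a : R) phi x : 'cV[C]_n :=
  fcalc (fun t => (expR (a * lwsize x + theta / 2 * ln t))%:C%C *
                  phi (gam * lwsize x - ln t / 2)) (gram x) *m (W0 x *m g x).

Lemma gfield_lin a (c : C) phi psi x :
  gfield a (fun s => c * phi s + psi s) x =
  c *: gfield a phi x + gfield a psi x.
Proof.
rewrite /gfield; set v := W0 x *m g x; set Z := gram x.
set e := fun t => (expR (a * lwsize x + theta / 2 * ln t))%:C%C.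
set l := fun t => gam * lwsize x - ln t / 2.
have -> : fcalc (fun t => e t * (c * phi (l t) + psi (l t))) Z =
    c *: fcalc (fun t => e t * phi (l t)) Z + fcalc (fun t => e t * psi (l t)) Z.
  by rewrite fcalcZ fcalcD; apply: eq_fcalc => j; ring.
by rewrite mulmxDl scalemxAl.
Qed.

Lemma gfield_coord a phi x j : (spectralmx (gram x) *m gfield a phi x) j 0 =
  (expR (a * lwsize x + theta / 2 * lsp x j))%:C%C * phi (lrho x j) *
  coord x (g x) j.
Proof. by rewrite fcalc_coord. Qed.

Lemma enorm_gfield a phi x : enorm (gfield a phi x) ^+ 2 =
  \sum_j (expR (a * lwsize x + theta / 2 * lsp x j) * cmod (phi (lrho x j)) *
          cmod (coord x (g x) j)) ^+ 2.
Proof.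
rewrite enorm_fcalc; apply: eq_bigr => j _.
by rewrite cmodM cmod_real ger0_norm// expR_ge0.
Qed.

Lemma measurable_gfield a phi : ccont phi -> measurable_fun_mx (gfield a phi).
Proof.
move=> cphi; apply: measurable_mxM; last exact: measurable_mxM.
have ml := measurable_lsize.
apply: (mcalc_log (theta / 2) _ _ cphi);
  by apply: measurable_funM => //; exact: measurable_cst.
Qed.

Lemma gfield_le a phi x K : 0 <= K -> (forall j, cmod (phi (lrho x j)) <= K) ->
  enorm (gfield a phi x) <= K * (expR (a * lwsize x) * wsize x).
Proof.
move=> K0 phiK; have e0 := expR_ge0 (a * lwsize x).
rewrite -(@ler_pXn2r _ 2) ?nnegrE ?enorm_ge0 ?mulr_ge0 ?wsize_ge0//.
rewrite enorm_gfield !exprMn wsize_sqr mulrA mulr_sumr; apply: ler_sum => j _.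
rewrite expRD -!exprMn ler_pXn2r// ?nnegrE; try by
  rewrite ?mulr_ge0 ?expR_ge0 ?cmod_ge0.
rewrite (_ : _ * _ * _ * _ = cmod (phi (lrho x j)) * (expR (a * lwsize x) *
  (expR (theta / 2 * lsp x j) * cmod (coord x (g x) j)))); last by ring.
by rewrite -[leRHS]mulrA ler_wpM2r ?mulr_ge0 ?expR_ge0 ?cmod_ge0.
Qed.

(** An equality wherever the size is positive. At a zero of the size with a = -1 the right side is
    [tau], because 0 to the power 0 is 1. *)
Lemma wsize_powR_le a x : expR (a * lwsize x) * wsize x <=
  tau * (wsize x / tau) `^ (a + 1).
Proof.
have [->|s0] := eqVneq (wsize x) 0; first by rewrite mulr0 mulr_ge0 ?powR_ge0 ?ltW.
have sp : 0 < wsize x by rewrite lt_def s0 wsize_ge0.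
have st : 0 < wsize x / tau by rewrite divr_gt0.
rewrite /powR gt_eqF// mulrDl mul1r expRD (lnK _) ?posrE// -/(lwsize x).
by rewrite mulrCA (mulrCA tau) divff ?gt_eqF// mulr1.
Qed.

Lemma gfield_powR_le a phi x K p : 0 <= K -> 0 < p ->
  (forall j, cmod (phi (lrho x j)) <= K) ->
  enorm (gfield a phi x) `^ p <=
  (K * tau) `^ p * (wsize x / tau) `^ ((a + 1) * p).
Proof.
move=> K0 p0 h; have h1 := gfield_le a K0 h.
have st : 0 <= wsize x / tau by rewrite divr_ge0 ?wsize_ge0// ltW.
have h2 : enorm (gfield a phi x) <= (K * tau) * (wsize x / tau) `^ (a + 1).
  by apply: (le_trans h1); rewrite -mulrA ler_wpM2l// wsize_powR_le.
rewrite powRrM -powRM ?powR_ge0 ?mulr_ge0 ?(ltW tau0)//.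
exact: (le_powR (ltW p0) (enorm_ge0 _) h2).
Qed.

(** Passing from [W0] to [W1] multiplies the j-th coordinate by l_j = c / rho_j, that is, by (h /
    tau)^gam exp(- s). A norm with [W1] therefore becomes a norm of the same kind of field, with [a]
    and the symbol changed. *)
Lemma enorm_W1_gfield a phi x :
  enorm (W1 x *m (invmx (W0 x) *m gfield a phi x)) =
  enorm (gfield (a + gam) (fun s => (expR (- s))%:C%C * phi s) x).
Proof.
apply/eqP; rewrite -(@eqrXn2 _ 2) ?enorm_ge0//; apply/eqP.
rewrite enorm_W1 enorm_gfield; apply: eq_bigr => j _; congr (_ ^+ 2).
rewrite /coord mulKVmx ?(uW0 x)// gfield_coord !cmodM !cmod_real !ger0_norm ?expR_ge0//.
rewrite !mulrA; congr (_ * _ * _); rewrite -!expRD; congr expR.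
by rewrite /lrho; field.
Qed.

Lemma measurable_pull a phi : ccont phi ->
  measurable_fun_mx (fun x => invmx (W0 x) *m gfield a phi x).
Proof.
move=> cphi; apply: measurable_mxM; last exact: measurable_gfield.
exact: (measurable_invmx mW0 uW0).
Qed.

End weights.

Opaque gfield.

(** * Integral norms of the fields in terms of their symbols *)

Section field_norms.
Context {d : measure_display} {T : measurableType d} {R : realType}.
Local Notation C := R[i].
Variables (mu : {measure set T -> \bar R}) (n : nat) (W0 W1 : T -> 'M[C]_n).
Hypothesis mW0 : measurable_fun_mx W0.
Hypothesis mW1 : measurable_fun_mx W1.
Hypothesis uW0 : invertible_field W0.
Hypothesis uW1 : invertible_field W1.
Variables (theta ptheta tau gam : R) (g : T -> 'cV[C]_n).
Hypothesis mg : measurable_fun_mx g.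
Hypothesis tau0 : 0 < tau.
Hypothesis ptheta0 : 0 < ptheta.

Local Notation sz := (wsize W0 W1 theta g).
Local Notation G := (gfield W0 W1 theta g tau gam).

Hypothesis size_int :
  (\int[mu]_x (((sz x / tau) `^ ptheta)%:E) <= 1)%E.

(** The exponent is the one for which the p-th power of the field is a bounded multiple of (h /
    tau)^ptheta, whose integral is at most 1. *)
Definition fnorm (p : R) phi : \bar R :=
  mnorm mu p (G (ptheta / p - 1) phi).

Lemma measurable_wsize_powR :
  measurable_fun [set: T] (fun x => (sz x / tau) `^ ptheta).
Proof.
have m : measurable_fun [set: T] (fun x => sz x / tau).
  by apply: measurable_funM; [exact: measurable_wsize | exact: measurable_cst].
exact: (measurableT_comp (@measurable_powR R ptheta) m).
Qed.

Lemma measurable_gfield_powR a p phi : ccont phi ->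
  measurable_fun [set: T] (fun x => (enorm (G a phi x)) `^ p).
Proof.
move=> c; have m : measurable_fun [set: T] (fun x => enorm (G a phi x)).
  by apply: measurable_enorm; exact: measurable_gfield.
exact: (measurableT_comp (@measurable_powR R p) m).
Qed.

Lemma gfield_powR_dom p phi K x : 0 < p -> 0 <= K ->
  (forall s, cmod (phi s) <= K) ->
  enorm (G (ptheta / p - 1) phi x) `^ p <=
  (K * tau) `^ p * (sz x / tau) `^ ptheta.
Proof.
move=> p0 K0 h; have -> : ptheta = (ptheta / p - 1 + 1) * p.
  by rewrite subrK divfK// gt_eqF.
have -> : (ptheta / p - 1 + 1) * p / p - 1 = ptheta / p - 1.
  by field; rewrite gt_eqF.
exact: gfield_powR_le.
Qed.

Lemma poweR_powRV (y p : R) : 0 <= y -> 0 < p -> ((y `^ p)%:E `^ p^-1)%E = y%:E.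
Proof. by move=> y0 p0; rewrite poweR_EFin -powRrM mulfV ?gt_eqF// powRr1. Qed.

Lemma le_poweR (x y : \bar R) (r : R) : 0 <= r -> (0 <= x)%E -> (x <= y)%E ->
  (x `^ r <= y `^ r)%E.
Proof.
move=> r0 x0 xy; apply: gt0_ler_poweR => //; rewrite in_itv/= leey andbT//.
exact: le_trans xy.
Qed.

Lemma fnorm_le p phi K : 0 < p -> ccont phi -> 0 <= K ->
  (forall s, cmod (phi s) <= K) -> (fnorm p phi <= (K * tau)%:E)%E.
Proof.
move=> p0 cphi K0 h; have Kt : 0 <= K * tau by rewrite mulr_ge0// ltW.
rewrite -(poweR_powRV Kt p0) /fnorm /mnorm; apply: le_poweR.
- by rewrite invr_ge0 ltW.
- by apply: integral_ge0 => x _; rewrite lee_fin powR_ge0.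
apply: (@le_trans _ _ (\int[mu]_x (((K * tau) `^ p)%:E * ((sz x / tau) `^ ptheta)%:E))%E).
  apply: ge0_le_integral => //.
  - by move=> x _; rewrite lee_fin powR_ge0.
  - by apply/measurable_EFinP; exact: measurable_gfield_powR.
  - by apply/measurable_EFinP; apply: measurable_funM;
      [exact: measurable_cst | exact: measurable_wsize_powR].
  - by move=> x _; rewrite -EFinM lee_fin; exact: gfield_powR_dom.
rewrite ge0_integralZl_EFin//; last 3 first.
- by move=> x _; rewrite lee_fin powR_ge0.
- by apply/measurable_EFinP; exact: measurable_wsize_powR.
- exact: powR_ge0.
by rewrite -[leRHS]mule1; apply: lee_wpmul2l => //; rewrite lee_fin powR_ge0.
Qed.

Lemma fnorm_dominated p (phi : nat -> R -> C) K : 0 < p ->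
  (forall k, ccont (phi k)) -> 0 <= K -> (forall k s, cmod (phi k s) <= K) ->
  (forall s, cmod (phi k s) @[k --> \oo] --> (0 : R)) ->
  forall e : R, 0 < e -> \forall k \near \oo, (fnorm p (phi k) <= e%:E)%E.
Proof.
move=> p0 cphi K0 h phi0 e e0.
pose F k x := ((enorm (G (ptheta / p - 1) (phi k) x)) `^ p)%:E.
pose D x := ((K * tau) `^ p * (sz x / tau) `^ ptheta)%:E.
have mF k : measurable_fun [set: T] (F k).
  by apply/measurable_EFinP; exact: measurable_gfield_powR.
have mD : measurable_fun [set: T] D.
  by apply/measurable_EFinP; apply: measurable_funM;
    [exact: measurable_cst | exact: measurable_wsize_powR].
have D0 x : 0 <= (K * tau) `^ p * (sz x / tau) `^ ptheta.
  by rewrite mulr_ge0// powR_ge0.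
have iD : mu.-integrable [set: T] D.
  apply/integrableP; split=> //; rewrite /D.
  under eq_integral do rewrite gee0_abs ?lee_fin ?D0// EFinM.
  rewrite ge0_integralZl_EFin//; last 3 first.
  - by move=> x _; rewrite lee_fin powR_ge0.
  - by apply/measurable_EFinP; exact: measurable_wsize_powR.
  - exact: powR_ge0.
  rewrite lte_mul_pinfty ?lee_fin ?powR_ge0//.
  by rewrite (le_lt_trans size_int)// ltry.
have FD k x : [set: T] x -> (`|F k x| <= D x)%E.
  by move=> _; rewrite gee0_abs ?lee_fin ?powR_ge0//; exact: gfield_powR_dom.
have Flim x : [set: T] x -> F ^~ x @ \oo --> (cst 0%E : T -> \bar R) x.
  move=> _; apply: cvg_EFin; first by near=> k.
  suff H : enorm (G (ptheta / p - 1) (phi k) x) @[k --> \oo] --> (0 : R).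
    apply/cvgrPdist_le => eps eps0.
    have ep0 : 0 < eps `^ p^-1 by rewrite powR_gt0.
    have /cvgrPdist_le/(_ _ ep0) := H; apply: filterS => k /=.
    rewrite !sub0r !normrN !ger0_norm ?enorm_ge0 ?powR_ge0// => le.
    have -> : eps = (eps `^ p^-1) `^ p.
      by rewrite -powRrM mulVf ?gt_eqF// powRr1// ltW.
    exact: (le_powR (ltW p0) (enorm_ge0 _) le).
  pose c j := expR ((ptheta / p - 1) * lwsize W0 W1 theta g tau x +
     theta / 2 * lsp W0 W1 x j) * cmod (coord W0 W1 x (g x) j).
  have E k : enorm (G (ptheta / p - 1) (phi k) x) =
      Num.sqrt (\sum_j (cmod (phi k (lrho W0 W1 theta g tau gam x j)) * c j) ^+ 2).
    rewrite -[LHS]ger0_norm ?enorm_ge0// -sqrtr_sqr enorm_gfield; congr Num.sqrt.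
    by apply: eq_bigr => j _; congr (_ ^+ 2); rewrite /c; ring.
  have Hs : (\sum_j (cmod (phi k (lrho W0 W1 theta g tau gam x j)) * c j) ^+ 2)
      @[k --> \oo] --> \sum_(j < n) (0 : R).
    apply: cvg_big => [|j _]; first exact: add_continuous.
    have q : cmod (phi k (lrho W0 W1 theta g tau gam x j)) * c j @[k --> \oo]
        --> (0 : R).
      rewrite -(mul0r (c j)); apply: cvgM; [exact: phi0 | exact: cvg_cst].
    rewrite -(mul0r (0 : R)); exact: (cvgM q q).
  have := @continuous_cvg _ _ _ _ _ _ (@Num.sqrt R) _ (@sqrt_continuous R _) Hs.
  rewrite big1// sqrtr0; set u := _ \o _.
  have -> : u = (fun k => enorm (G (ptheta / p - 1) (phi k) x)) by exact/esym/funext.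
  by apply.
have fin x : [set: T] x -> D x \is a fin_num by [].
have := dominated_cvg measurableT mF Flim fin iD FD.
rewrite integral0 => /fine_cvgP[_ /cvgrPdist_le].
have ep0 : 0 < e `^ p by rewrite powR_gt0.
move=> /(_ _ ep0); apply: filterS => k /=; rewrite sub0r normrN => le.
rewrite /fnorm /mnorm -(poweR_powRV (ltW e0) p0); apply: le_poweR.
- by rewrite invr_ge0 ltW.
- by apply: integral_ge0 => x _; rewrite lee_fin powR_ge0.
have finF : (\int[mu]_x F k x)%E \is a fin_num.
  rewrite ge0_fin_numE; last by apply: integral_ge0 => x _; rewrite lee_fin powR_ge0.
  have /integrableP[_] := iD; apply: le_lt_trans.
  apply: ge0_le_integral => //.
  - by move=> x _; rewrite lee_fin powR_ge0.
  - exact: measurableT_comp.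
  - move=> x Dx; rewrite [leRHS]gee0_abs ?lee_fin ?D0//.
    by have := FD k x Dx; rewrite gee0_abs ?lee_fin ?powR_ge0.
rewrite -(fineK finF) lee_fin; apply: le_trans le; exact: ler_norm.
Unshelve. all: by end_near. Qed.

(** Dominated convergence speaks of sequences; a failure of the estimate for every radius 1 / (k +
    1) yields a sequence that contradicts it. *)
Lemma fnorm_continuous p (A : set C) (phi : C -> R -> C) z K : 0 < p ->
  (forall w, A w -> ccont (phi w)) -> 0 <= K ->
  (forall w s, A w -> cmod (phi w s) <= K) ->
  (forall s (e : R), 0 < e -> exists2 d : R, 0 < d &
     forall w, A w -> cmod (w - z) < d -> cmod (phi w s) <= e) ->
  forall e : R, 0 < e -> exists2 d : R, 0 < d &
    forall w, A w -> cmod (w - z) < d -> (fnorm p (phi w) <= e%:E)%E.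
Proof.
move=> p0 cphi K0 h phi0 e e0; apply: contrapT => H.
have H' k : exists w, [/\ A w, cmod (w - z) < k.+1%:R^-1 &
    (e%:E < fnorm p (phi w))%E].
  apply: contrapT => H'; apply: H; exists k.+1%:R^-1; first by rewrite invr_gt0.
  move=> w Aw wz; rewrite leNgt; apply/negP => lt; apply: H'.
  by exists w.
have [w Hw] := choice H'.
have near0 s : cmod (phi (w k) s) @[k --> \oo] --> (0 : R).
  apply/cvgrPdist_le => eps eps0; have [dl dl0 Hd] := phi0 s eps eps0.
  near=> k; rewrite sub0r normrN ger0_norm ?cmod_ge0//.
  have [Aw wz _] := Hw k; apply: Hd => //; apply: (lt_trans wz).
  by near: k; exact: near_infty_natSinv_lt (PosNum dl0).
have := @fnorm_dominated p (fun k => phi (w k)) K p0 _ K0 _ near0 e e0.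
have h1 k : ccont (phi (w k)) by apply: cphi; case: (Hw k).
have h2 k s : cmod (phi (w k) s) <= K by apply: h; case: (Hw k).
move=> /(_ h1 h2)[N _ /(_ N (leqnn N))]; apply/negP; rewrite -ltNge.
by case: (Hw N).
Unshelve. all: by end_near. Qed.

End field_norms.

(** * Convergence to zero in terms of real radii *)

Section filters.
Context {R : realType}.
Local Notation C := R[i].

Lemma ecvg0 (T : Type) (F : set_system T) {FF : Filter F} (u : T -> \bar R) :
  (forall x, (0 <= u x)%E) ->
  (forall e : R, 0 < e -> \forall x \near F, (u x <= e%:E)%E) ->
  u @ F --> 0%E.
Proof.
move=> u0 H; apply/fine_cvgP; split.
  apply: filterS (H 1 ltr01) => x ux.
  by rewrite ge0_fin_numE// (le_lt_trans ux)// ltry.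
apply/cvgrPdist_le => e e0; apply: filterS (H e e0) => x ux.
rewrite /= sub0r normrN ger0_norm ?fine_ge0//.
by rewrite -lee_fin fineK// ge0_fin_numE// (le_lt_trans ux)// ltry.
Qed.

Lemma ecvg0_inv (T : Type) (F : set_system T) {FF : Filter F} (u : T -> \bar R) :
  (forall x, (0 <= u x)%E) -> u @ F --> 0%E ->
  forall e : R, 0 < e -> \forall x \near F, (u x <= e%:E)%E.
Proof.
move=> u0 /fine_cvgP[fin /cvgrPdist_le H] e e0.
apply: filterS2 fin (H e e0) => x ux; rewrite /= sub0r normrN => le.
by rewrite -(fineK ux) lee_fin (le_trans (ler_norm _)).
Qed.

(** Balls of [R[i]^o] have radii in [R[i]]; a positive radius is real, so its real part can replace
    it. *)
Lemma nbhs_cmod (z : R[i]^o) (P : set R[i]^o) :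
  nbhs z P <-> exists2 d : R, 0 < d & forall w, cmod (w - z) < d -> P w.
Proof.
split=> [/nbhs_ballP[e /= e0 H]|[d d0 H]].
  exists (complex.Re e); first by move: e0; rewrite ltcE => /andP[].
  move=> w wz; apply: H; rewrite /ball/= distrC normr_cmod.
  move: e0; case: e wz => a b /= wz; rewrite ltcE/= => /andP[/eqP -> _].
  by rewrite ltcE/= eqxx.
apply/nbhs_ballP; exists d%:C%C => /=; first by rewrite ltcR.
by move=> w; rewrite /ball/= distrC normr_cmod ltcR => /H.
Qed.

Lemma ecvg0_within (A : set R[i]^o) (z : R[i]^o) (u : R[i]^o -> \bar R) :
  (forall w, (0 <= u w)%E) ->
  (forall e : R, 0 < e -> exists2 d : R, 0 < d &
     forall w, A w -> cmod (w - z) < d -> (u w <= e%:E)%E) ->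
  u w @[w --> within A (nbhs z)] --> 0%E.
Proof.
move=> u0 H; apply: ecvg0 => // e e0; have [d d0 Hd] := H e e0.
suff : nbhs z (fun w => A w -> (u w <= e%:E)%E) by [].
apply: (proj2 (nbhs_cmod z _)); exists d => // w wz Aw; exact: Hd.
Qed.

Lemma ecvg0_within_inv (A : set R[i]^o) (z : R[i]^o) (u : R[i]^o -> \bar R) :
  (forall w, (0 <= u w)%E) ->
  u w @[w --> within A (nbhs z)] --> 0%E ->
  (forall e : R, 0 < e -> exists2 d : R, 0 < d &
     forall w, A w -> cmod (w - z) < d -> (u w <= e%:E)%E).
Proof.
move=> u0 H e e0.
have FF : Filter (within A (nbhs z)) by exact: within_filter.
have h : nbhs z (fun w => A w -> (u w <= e%:E)%E).
  exact: (@ecvg0_inv _ _ FF u u0 H e e0).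
have [d d0 Hd] := proj1 (nbhs_cmod z _) h.
by exists d => // w Aw wz; exact: Hd.
Qed.

End filters.

(** * Exponential symbols on the strip *)

Section multiplier.
Context {R : realType}.
Local Notation C := R[i].
Implicit Types (z h : C) (s : R).

Lemma ccont_cst c : ccont (fun _ : R => c : C).
Proof. by split=> x; exact: cvg_cst. Qed.

Lemma ccont_real (f : R -> R) : continuous f -> ccont (fun s => (f s)%:C%C).
Proof. by move=> cf; split=> // x; exact: cvg_cst. Qed.

Lemma ccontD (f g : R -> C) : ccont f -> ccont g -> ccont (fun s => f s + g s).
Proof.
move=> [f1 f2] [g1 g2]; split=> x.
  rewrite (_ : (fun t => _) = (fun t => complex.Re (f t) + complex.Re (g t))).
    by apply: cvgD; [exact: f1 | exact: g1].
  by apply/funext => t; rewrite ReD.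
rewrite (_ : (fun t => _) = (fun t => complex.Im (f t) + complex.Im (g t))).
  by apply: cvgD; [exact: f2 | exact: g2].
by apply/funext => t; rewrite ImD.
Qed.

Lemma ccontM (f g : R -> C) : ccont f -> ccont g -> ccont (fun s => f s * g s).
Proof.
move=> [f1 f2] [g1 g2]; split=> x.
  rewrite (_ : (fun t => _) = (fun t => complex.Re (f t) * complex.Re (g t) -
    complex.Im (f t) * complex.Im (g t))).
    by apply: cvgB; apply: cvgM; [exact: f1 | exact: g1 | exact: f2 | exact: g2].
  by apply/funext => t; rewrite ReM.
rewrite (_ : (fun t => _) = (fun t => complex.Re (f t) * complex.Im (g t) +
    complex.Im (f t) * complex.Re (g t))).
  by apply: cvgD; apply: cvgM; [exact: f1 | exact: g2 | exact: f2 | exact: g1].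
by apply/funext => t; rewrite ImM.
Qed.

Lemma ccontN (f : R -> C) : ccont f -> ccont (fun s => - f s).
Proof.
move=> cf; have := ccontM (ccont_cst (-1)) cf.
by under eq_fun do rewrite mulN1r.
Qed.

Lemma ccont_cexp z : ccont (fun s => cexp (z * s%:C%C)).
Proof.
have lin (a : R) : continuous (fun s => a * s).
  by move=> x; apply: cvgM; [exact: cvg_cst | exact: cvg_id].
have E s : complex.Re (z * s%:C%C) = complex.Re z * s.
  by rewrite ReM/= mulr0 subr0.
have E' s : complex.Im (z * s%:C%C) = complex.Im z * s.
  by rewrite ImM/= mulr0 add0r.
split=> x.
  rewrite (_ : (fun t => _) = fun s => expR (complex.Re z * s) * cos (complex.Im z * s)).
    apply: cvgM; apply: continuous_comp; [exact: lin | exact: continuous_expR |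
      exact: lin | exact: continuous_cos].
  by apply/funext => s; rewrite /= E E'.
rewrite (_ : (fun t => _) = fun s => expR (complex.Re z * s) * sin (complex.Im z * s)).
  apply: cvgM; apply: continuous_comp; [exact: lin | exact: continuous_expR |
    exact: lin | exact: continuous_sin].
by apply/funext => s; rewrite /= E E'.
Qed.

Lemma cmod_cexp_real z s : cmod (cexp (z * s%:C%C)) = expR (complex.Re z * s).
Proof. by rewrite cmod_cexp ReM/= mulr0 subr0. Qed.

Lemma expR_strip (a s : R) : 0 <= a <= 1 -> expR (a * s) <= 1 + expR s.
Proof.
move=> /andP[a0 a1]; have e0 := expR_gt0 s.
have [s0|s0] := leP 0 s.
  by apply: (@le_trans _ _ (expR s)); [rewrite ler_expR ler_piMl | rewrite lerDr].
apply: (@le_trans _ _ 1); last by rewrite lerDl ltW.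
by rewrite -expR0 ler_expR mulr_ge0_le0// ltW.
Qed.

(** At distance [eta] from both boundary lines a factor exp(eta |s|) is gained over the weight 1 +
    exp s. It absorbs the powers of s that differentiation in z produces. *)
Lemma expR_strip_norm (a eta s : R) : eta <= a <= 1 - eta ->
  expR (a * s) * expR (eta * `|s|) <= 1 + expR s.
Proof.
move=> /andP[a0 a1]; have e0 := expR_gt0 s; rewrite -expRD.
have [s0|s0] := leP 0 s.
  rewrite ger0_norm// -mulrDl.
  by apply: (@le_trans _ _ (expR s)); [rewrite ler_expR; nra | rewrite lerDr].
rewrite ltr0_norm//.
apply: (@le_trans _ _ 1); last by rewrite lerDl ltW.
by rewrite -expR0 ler_expR; nra.
Qed.

Lemma sqr_le_expR (eta s : R) : 0 < eta ->
  s ^+ 2 <= 16 / eta ^+ 2 * expR (eta / 2 * `|s|).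
Proof.
move=> eta0; rewrite -[s ^+ 2]real_normK ?num_real//.
have h := expR_ge1Dx (eta / 4 * `|s|).
have h0 : 0 <= eta / 4 * `|s| by rewrite mulr_ge0// divr_ge0// ltW.
have -> : expR (eta / 2 * `|s|) = expR (eta / 4 * `|s|) ^+ 2.
  by rewrite -expRM_natr; congr expR; field.
have h2 : (eta / 4 * `|s|) ^+ 2 <= expR (eta / 4 * `|s|) ^+ 2.
  rewrite ler_pXn2r// ?nnegrE ?expR_ge0//; lra.
have -> : `|s| ^+ 2 = 16 / eta ^+ 2 * (eta / 4 * `|s|) ^+ 2.
  by field; rewrite gt_eqF.
by rewrite ler_wpM2l// divr_ge0// sqr_ge0.
Qed.

Lemma norm_le_expR (eta s : R) : 0 < eta ->
  `|s| <= eta^-1 * expR (eta * `|s|).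
Proof.
move=> eta0; rewrite mulrC ler_pdivlMr//.
by have := expR_ge1Dx (eta * `|s|); lra.
Qed.

(** Half of the gain exp(eta |s|) pays for s^2, at the price 16 / eta^2, and the other half for
    exp(|h| |s|). With the 4 of [cexp_taylor] this makes 64. *)
Lemma cexp_diff2 z h s eta : 0 < eta -> eta <= complex.Re z <= 1 - eta ->
  cmod h <= eta / 2 ->
  cmod (cexp ((z + h) * s%:C%C) - cexp (z * s%:C%C) -
        h * (s%:C%C * cexp (z * s%:C%C))) <=
  64 / eta ^+ 2 * cmod h ^+ 2 * (1 + expR s).
Proof.
move=> eta0 ze he.
rewrite mulrDl cexpD (_ : _ - _ = cexp (z * s%:C%C) *
  (cexp (h * s%:C%C) - 1 - h * s%:C%C)); last by ring.
rewrite cmodM cmod_cexp_real.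
have T := cexp_taylor (h * s%:C%C).
rewrite cmodM cmod_real in T.
have h0 := cmod_ge0 h; have s0 := normr_ge0 s.
have e1 : expR (cmod h * `|s|) <= expR (eta / 2 * `|s|).
  by rewrite ler_expR ler_wpM2r.
have e2 := sqr_le_expR s eta0; rewrite -[s ^+ 2]real_normK ?num_real// in e2.
have E1 := expR_gt0 (eta / 2 * `|s|).
have T2 : cmod (cexp (h * s%:C%C) - 1 - h * s%:C%C) <=
    64 / eta ^+ 2 * cmod h ^+ 2 * expR (eta * `|s|).
  apply: (le_trans T).
  have -> : expR (eta * `|s|) = expR (eta / 2 * `|s|) * expR (eta / 2 * `|s|).
    by rewrite -expRD; congr expR; field.
  have -> : 4 * (cmod h * `|s|) ^+ 2 * expR (cmod h * `|s|) =
    4 * cmod h ^+ 2 * (`|s| ^+ 2 * expR (cmod h * `|s|)) by ring.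
  have -> : 64 / eta ^+ 2 * cmod h ^+ 2 * (expR (eta / 2 * `|s|) * expR (eta / 2 * `|s|))
     = 4 * cmod h ^+ 2 * ((16 / eta ^+ 2 * expR (eta / 2 * `|s|)) * expR (eta / 2 * `|s|)).
    by field; rewrite gt_eqF.
  rewrite ler_wpM2l ?mulr_ge0 ?sqr_ge0//.
  by apply: ler_pM; rewrite ?sqr_ge0 ?expR_ge0.
have E0 := expR_gt0 (complex.Re z * s).
apply: (@le_trans _ _ (expR (complex.Re z * s) *
    (64 / eta ^+ 2 * cmod h ^+ 2 * expR (eta * `|s|)))).
  by rewrite ler_wpM2l// ltW.
rewrite mulrCA ler_wpM2l ?expR_strip_norm//.
by rewrite mulr_ge0 ?sqr_ge0// divr_ge0// sqr_ge0.
Qed.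

Lemma cexp_deriv_le z s eta : 0 < eta -> eta <= complex.Re z <= 1 - eta ->
  cmod (s%:C%C * cexp (z * s%:C%C)) <= eta^-1 * (1 + expR s).
Proof.
move=> eta0 ze; rewrite cmodM cmod_real cmod_cexp_real.
have h1 := norm_le_expR s eta0; have h2 := expR_strip_norm s ze.
have E0 := expR_gt0 (complex.Re z * s).
apply: (@le_trans _ _ ((eta^-1 * expR (eta * `|s|)) * expR (complex.Re z * s))).
  by rewrite ler_wpM2r// ltW.
by rewrite -mulrA ler_wpM2l ?invr_ge0 ?(ltW eta0)// mulrC.
Qed.

End multiplier.

(** * The damped power m(z) rho^z as a symbol *)

Section damped_powers.
Context {R : realType}.
Local Notation C := R[i].
Variables (theta k : R).
Hypothesis theta01 : 0 < theta < 1.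
Hypothesis k1 : 1 < k.
Implicit Types (z h : C) (s : R).

Definition pole z : C := k%:C%C + (z - theta%:C%C).
Definition damping z : C := k%:C%C / pole z.
Definition psi z s : C := damping z * cexp (z * s%:C%C).
Definition dpsi z s : C := - (k%:C%C / pole z ^+ 2) * cexp (z * s%:C%C) +
  damping z * (s%:C%C * cexp (z * s%:C%C)).

Let kap0 : 0 < k - 1. Proof. by rewrite subr_gt0. Qed.
Let k0 : 0 < k. Proof. exact: lt_trans k1. Qed.

(** The zero of this function is theta - k, to the left of the strip since theta < 1 < k; the
    distance k - 1 is the source of the constant k / (k - 1). *)
Lemma pole_ge z : 0 <= complex.Re z -> k - 1 <= cmod (pole z).
Proof.
move=> z0; apply: le_trans (Re_le_cmod _); apply: le_trans (ler_norm _).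
by rewrite !(ReD, ReN)/=; case/andP: theta01; lra.
Qed.

Lemma pole_neq0 z : 0 <= complex.Re z -> pole z != 0.
Proof. by move=> /pole_ge h; rewrite -cmod_gt0 (lt_le_trans kap0). Qed.

Lemma damping_le z : 0 <= complex.Re z -> cmod (damping z) <= k / (k - 1).
Proof.
move=> z0; rewrite cmodM cmodV cmod_real (gtr0_norm k0) ler_wpM2l ?(ltW k0)//.
by rewrite lef_pV2 ?posrE ?pole_ge// (lt_le_trans kap0) ?pole_ge.
Qed.

Lemma damping_decay z : 0 <= complex.Re z -> complex.Im z != 0 ->
  cmod (damping z) <= k / `|complex.Im z|.
Proof.
move=> z0 z1; rewrite cmodM cmodV cmod_real (gtr0_norm k0) ler_wpM2l ?(ltW k0)//.
rewrite lef_pV2 ?posrE ?normr_gt0// ?(lt_le_trans kap0) ?pole_ge//.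
by apply: le_trans (Im_le_cmod _); rewrite !(ImD, ImN)/= subr0 add0r.
Qed.

Lemma damping_theta : damping theta%:C%C = 1.
Proof.
by rewrite /damping /pole subrr addr0 divff// -cmod_gt0 cmod_real normr_gt0 gt_eqF.
Qed.

Lemma ccont_psi z : ccont (psi z).
Proof. by apply: ccontM; [exact: ccont_cst | exact: ccont_cexp]. Qed.

Lemma ccont_dpsi z : ccont (dpsi z).
Proof.
apply: ccontD; first by apply: ccontM; [exact: ccont_cst | exact: ccont_cexp].
apply: ccontM; first exact: ccont_cst.
by apply: ccontM; [apply: ccont_real => x; exact: cvg_id | exact: ccont_cexp].
Qed.

Lemma cmod_psi z s : cmod (psi z s) = cmod (damping z) * expR (complex.Re z * s).
Proof. by rewrite cmodM cmod_cexp_real. Qed.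

Lemma psi_le z s : 0 <= complex.Re z <= 1 ->
  cmod (psi z s) <= k / (k - 1) * (1 + expR s).
Proof.
move=> sz; rewrite cmod_psi; apply: ler_pM; rewrite ?cmod_ge0 ?expR_ge0//.
  by apply: damping_le; case/andP: sz.
exact: expR_strip.
Qed.

Lemma psi_continuous z s : 0 <= complex.Re z -> forall e : R, 0 < e ->
  exists2 d : R, 0 < d & forall w, cmod (w - z) < d ->
    cmod (psi w s - psi z s) <= e.
Proof.
move=> z0 e e0.
have [D HD] : exists D, cderiv (fun w => psi w s) z D.
  eexists; apply: cderivM.
    apply: cderivM; first exact: cderiv_cst.
    apply: (@cderiv_comp R pole GRing.inv); last exact/cderiv_inv/pole_neq0.
    apply: cderivD; first exact: cderiv_cst.
    by apply: cderivD; [exact: cderiv_id | exact: cderiv_cst].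
  apply: (@cderiv_comp R (fun w => w * s%:C%C) cexp); last exact: cderiv_cexp.
  by apply: cderivM; [exact: cderiv_id | exact: cderiv_cst].
have [d d0 L] := cderiv_lip HD.
have D1 : 0 < 1 + cmod D by have := cmod_ge0 D; lra.
exists (Num.min d (e / (1 + cmod D))); first by rewrite lt_min d0 divr_gt0.
move=> w; rewrite lt_min => /andP[/L]; rewrite (addrC z) subrK => h1 h2.
by apply: (le_trans h1); rewrite mulrC -ler_pdivlMr// ltW.
Qed.

(** The weight 1 + exp s is what turns this scalar remainder into a bound of the difference quotient
    in the sum norm, uniformly over Omega. *)
Lemma psi_diff2 z : 0 < complex.Re z < 1 -> exists2 A : R, 0 <= A &
  exists2 d : R, 0 < d & forall h s, cmod h < d ->
    cmod (psi (z + h) s - psi z s - h * dpsi z s) <=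
    A * cmod h ^+ 2 * (1 + expR s).
Proof.
move=> /andP[z0 z1].
pose eta := Num.min (complex.Re z) (1 - complex.Re z).
have eta0 : 0 < eta by rewrite lt_min z0 subr_gt0.
have etaz : eta <= complex.Re z <= 1 - eta.
  have h1 : eta <= complex.Re z by rewrite /eta ge_min lexx.
  have h2 : eta <= 1 - complex.Re z by rewrite /eta ge_min lexx orbT.
  by apply/andP; split; lra.
pose ka := k - 1; have ka0 : 0 < ka by exact: kap0.
pose A1 := k / ka * (64 / eta ^+ 2); pose A2 := k / ka ^+ 2 * eta^-1.
pose A3 := k / ka ^+ 3.
have A10 : 0 <= A1 by rewrite mulr_ge0 ?divr_ge0 ?sqr_ge0 ?(ltW k0) ?(ltW ka0).
have A20 : 0 <= A2 by rewrite mulr_ge0 ?invr_ge0 ?divr_ge0 ?sqr_ge0 ?(ltW k0) ?(ltW eta0).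
have A30 : 0 <= A3 by rewrite divr_ge0 ?exprn_ge0 ?(ltW k0) ?(ltW ka0).
exists (A1 + A2 + A3); first by rewrite !addr_ge0.
exists (eta / 2); first by rewrite divr_gt0.
move=> h s hd.
have uz : ka <= cmod (pole z) by apply: pole_ge; exact: ltW.
have uzh : ka <= cmod (pole (z + h)).
  apply: pole_ge; rewrite ReD; case/andP: etaz => e1 _.
  have := le_lt_trans (Re_le_cmod h) hd; rewrite ltr_norml => /andP[+ _]; lra.
have cu : 0 < cmod (pole z) by exact: lt_le_trans ka0 uz.
have cuh : 0 < cmod (pole (z + h)) by exact: lt_le_trans ka0 uzh.
have u0 : pole z != 0 by rewrite -cmod_gt0.
have uh0 : pole (z + h) != 0 by rewrite -cmod_gt0.
have uhE : pole (z + h) = pole z + h by rewrite /pole; ring.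
set c := cexp (z * s%:C%C); set c' := cexp ((z + h) * s%:C%C).
pose E2 := c' - c - h * (s%:C%C * c).
(* Remainder of the exponential times the damping at z + h, then the first-order change of the
   damping times the derivative of the exponential, then the second-order remainder of the
   damping. *)
have -> : psi (z + h) s - psi z s - h * dpsi z s =
   k%:C%C / pole (z + h) * E2 +
   (- (k%:C%C / (pole z * pole (z + h))) * h) * (h * (s%:C%C * c)) +
   (k%:C%C / (pole z ^+ 2 * pole (z + h)) * (h * h)) * c.
  rewrite /psi /dpsi /damping -/c -/c' /E2; rewrite uhE in uh0 *.
  by field; rewrite u0 uh0.
have s1 : 0 <= 1 + expR s by rewrite addr_ge0 ?expR_ge0.
have ch := cmod_ge0 h.
have B1 : cmod (k%:C%C / pole (z + h) * E2) <= A1 * cmod h ^+ 2 * (1 + expR s).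
  rewrite cmodM [leRHS](_ : _ = (k / ka) * (64 / eta ^+ 2 * cmod h ^+ 2 * (1 + expR s)));
    last by rewrite /A1; ring.
  apply: ler_pM; rewrite ?cmod_ge0//.
    rewrite cmodM cmodV cmod_real (gtr0_norm k0) ler_wpM2l ?(ltW k0)//.
    by rewrite lef_pV2 ?posrE.
  by apply: cexp_diff2 => //; exact: ltW.
have ku : k / (cmod (pole z) * cmod (pole (z + h))) <= k / ka ^+ 2.
  rewrite ler_wpM2l ?(ltW k0)// lef_pV2 ?posrE ?mulr_gt0 ?exprn_gt0//.
  by rewrite expr2 ler_pM// ltW.
have B2 : cmod ((- (k%:C%C / (pole z * pole (z + h))) * h) * (h * (s%:C%C * c))) <=
    A2 * cmod h ^+ 2 * (1 + expR s).
  rewrite cmodM [leRHS](_ : _ = (k / ka ^+ 2 * cmod h) *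
    (cmod h * (eta^-1 * (1 + expR s)))); last by rewrite /A2; ring.
  apply: ler_pM; rewrite ?cmod_ge0//.
    by rewrite cmodM cmodN cmodM cmodV cmod_real (gtr0_norm k0) cmodM ler_wpM2r.
  by rewrite cmodM ler_wpM2l//; exact: cexp_deriv_le.
have B3 : cmod ((k%:C%C / (pole z ^+ 2 * pole (z + h)) * (h * h)) * c) <=
    A3 * cmod h ^+ 2 * (1 + expR s).
  rewrite cmodM; apply: ler_pM; rewrite ?cmod_ge0//.
    rewrite cmodM [X in _ * X <= _]cmodM -expr2 ler_wpM2r ?sqr_ge0//.
    rewrite cmodM cmodV cmod_real (gtr0_norm k0) ler_wpM2l ?(ltW k0)//.
    rewrite !cmodM lef_pV2 ?posrE ?mulr_gt0 ?exprn_gt0//.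
    rewrite exprSr expr2; apply: ler_pM => //; rewrite ?mulr_ge0 ?(ltW ka0)//.
    by rewrite ler_pM// ltW.
  rewrite /c cmod_cexp_real; apply: expR_strip; rewrite !ltW//.
apply: (le_trans (cmodD _ _)); apply: (le_trans (lerD (cmodD _ _) (lexx _))).
by rewrite 2![(_ + _) * cmod h ^+ 2]mulrDl 2![(_ + _) * (1 + expR s)]mulrDl !lerD.
Qed.

Lemma dpsi_le z : 0 < complex.Re z < 1 -> exists2 A : R, 0 <= A &
  forall s, cmod (dpsi z s) <= A * (1 + expR s).
Proof.
move=> /andP[z0 z1].
pose eta := Num.min (complex.Re z) (1 - complex.Re z).
have eta0 : 0 < eta by rewrite lt_min z0 subr_gt0.
have etaz : eta <= complex.Re z <= 1 - eta.
  have h1 : eta <= complex.Re z by rewrite /eta ge_min lexx.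
  have h2 : eta <= 1 - complex.Re z by rewrite /eta ge_min lexx orbT.
  by apply/andP; split; lra.
exists (cmod (k%:C%C / pole z ^+ 2) + cmod (damping z) * eta^-1).
  by rewrite addr_ge0 ?mulr_ge0 ?cmod_ge0 ?invr_ge0// ltW.
move=> s; apply: (le_trans (cmodD _ _)); rewrite mulrDl; apply: lerD.
  rewrite [leLHS]cmodM cmodN ler_wpM2l ?cmod_ge0// cmod_cexp_real.
  by apply: expR_strip; rewrite !ltW.
by rewrite [leLHS]cmodM -mulrA ler_wpM2l ?cmod_ge0//; exact: cexp_deriv_le.
Qed.

End damped_powers.

(** * Upper bound: an admissible function through f *)

Section calderon_function.
Context {d : measure_display} {T : measurableType d} {R : realType}.
Local Notation C := R[i].
Variables (mu : {measure set T -> \bar R}) (n : nat) (W0 W1 : T -> 'M[C]_n).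
Hypothesis mW0 : measurable_fun_mx W0.
Hypothesis mW1 : measurable_fun_mx W1.
Hypothesis uW0 : invertible_field W0.
Hypothesis uW1 : invertible_field W1.
Variables (p0 p1 theta ptheta tau : R) (f : L0 mu n).
Hypothesis p00 : 0 < p0.
Hypothesis p10 : 0 < p1.
Hypothesis theta01 : 0 < theta < 1.
Hypothesis ptheta0 : 0 < ptheta.
Hypothesis hptheta : ptheta^-1 = (1 - theta) / p0 + theta / p1.
Hypothesis tau0 : 0 < tau.

Local Notation g := (ofL0 f).
Local Notation gam := (ptheta / p1 - ptheta / p0).
Local Notation G := (gfield W0 W1 theta g tau gam).
Local Notation fn := (fnorm mu W0 W1 theta ptheta tau gam g).
Local Notation N0 := (Lp_norm mu p0 W0).
Local Notation N1 := (Lp_norm mu p1 W1).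

Hypothesis wsize_int :
  (\int[mu]_x (((wsize W0 W1 theta g x / tau) `^ ptheta)%:E) <= 1)%E.

Let mg : measurable_fun_mx g. Proof. exact: measurable_ofL0. Qed.

(** A linear map from symbols to L^0. As [calderon_fun z] is its value at [psi theta k z], all
    properties of the function in z are inherited from the symbol. *)
Definition Vof (phi : R -> C) : L0 mu n :=
  toL0 mu (fun x => invmx (W0 x) *m G (ptheta / p0 - 1) phi x).

Let mV (phi : R -> C) : ccont phi ->
  measurable_fun_mx (fun x => invmx (W0 x) *m G (ptheta / p0 - 1) phi x).
Proof. by move=> c; exact: measurable_pull. Qed.

Lemma Vof_lin (a : C) phi psi : ccont phi -> ccont psi ->
  Vof (fun s => a * phi s + psi s) = a *: Vof phi + Vof psi.
Proof.
move=> c1 c2; rewrite /Vof.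
have mZ := measurable_mxZ (cmeas_cst a) (mV c1).
have := toL0D mu mZ (mV c2); rewrite (toL0Z mu a (mV c1)) => <-.
congr (toL0 mu _); apply/funext => x.
by rewrite gfield_lin mulmxDr -scalemxAr.
Qed.

Lemma VofB phi psi : ccont phi -> ccont psi ->
  Vof (fun s => phi s - psi s) = Vof phi - Vof psi.
Proof.
move=> c1 c2; have E := Vof_lin (-1) c2 c1.
have -> : (fun s => phi s - psi s) = (fun s => -1 * psi s + phi s).
  by apply/funext => s; rewrite mulN1r addrC.
by rewrite E scaleN1r addrC.
Qed.

Lemma VofZ (a : C) phi : ccont phi -> Vof (fun s => a * phi s) = a *: Vof phi.
Proof.
move=> c; have := Vof_lin (a - 1) c c.
have -> : (fun s => (a - 1) * phi s + phi s) = (fun s => a * phi s).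
  by apply/funext => s; rewrite mulrBl mul1r subrK.
by move=> ->; rewrite scalerBl scale1r subrK.
Qed.

Lemma N0_Vof phi : ccont phi -> N0 (Vof phi) = fn p0 phi.
Proof.
move=> c; rewrite /Vof (Lp_norm_toL0 mu p0 mW0 (mV c)).
apply: (@eq_mnorm _ _ _ mu _ p0 (fun x => W0 x *m (invmx (W0 x) *m
  G (ptheta / p0 - 1) phi x)) (G (ptheta / p0 - 1) phi)) => x.
by rewrite (mulKVmx (uW0 x)).
Qed.

Lemma N1_Vof phi : ccont phi ->
  N1 (Vof phi) = fn p1 (fun s => (expR (- s))%:C%C * phi s).
Proof.
move=> c; rewrite /Vof (Lp_norm_toL0 mu p1 mW1 (mV c)).
have e : ptheta / p0 - 1 + gam = ptheta / p1 - 1 by ring.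
apply: (@eq_mnorm _ _ _ mu _ p1 (fun x => W1 x *m (invmx (W0 x) *m
  G (ptheta / p0 - 1) phi x)) (G (ptheta / p1 - 1) (fun s => (expR (- s))%:C%C * phi s))) => x.
by rewrite -e enorm_W1_gfield.
Qed.

Definition damp (phi : R -> C) s : C := ((1 + expR s)^-1)%:C%C * phi s.

Let e1 s : 0 < 1 + expR s :> R. Proof. by rewrite addr_gt0 ?expR_gt0. Qed.

Lemma ccont_damp phi : ccont phi -> ccont (damp phi).
Proof.
move=> c; apply: ccontM => //; apply: ccont_real => s.
apply: cvgV; first by rewrite gt_eqF.
by apply: cvgD; [exact: cvg_cst | exact: continuous_expR].
Qed.

Lemma damp_le phi K s : cmod (phi s) <= K * (1 + expR s) -> cmod (damp phi s) <= K.
Proof.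
move=> h; rewrite /damp cmodM cmod_real gtr0_norm ?invr_gt0// mulrC.
by rewrite ler_pdivrMr.
Qed.

(** The splitting phi = damp phi + exp(s) damp phi is adapted to the couple: the first summand is
    measured with [W0], the second with [W1], where the factor exp(- s) removes exp(s). *)
Lemma sum_norm_Vof phi : ccont phi ->
  (sum_norm N0 N1 (Vof phi) <= fn p0 (damp phi) + fn p1 (damp phi))%E.
Proof.
move=> c; have cd := ccont_damp c.
have ce : ccont (fun s => (expR s)%:C%C * damp phi s).
  by apply: ccontM => //; apply: ccont_real; exact: continuous_expR.
have e : (fun s => 1 * damp phi s + (expR s)%:C%C * damp phi s) = phi.
  apply/funext => s.
  rewrite -mulrDl -(rmorph1 (real_complex R)) -rmorphD/=.
  by rewrite /damp mulrA -rmorphM mulfV ?mul1r// gt_eqF.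
have := Vof_lin 1 cd ce; rewrite e (scale1r (Vof (damp phi))) => ->.
have := sum_norm_le N0 N1 (Vof (damp phi))
  (Vof (fun s => (expR s)%:C%C * damp phi s)).
rewrite (N0_Vof cd) (N1_Vof ce).
have -> : (fun s => (expR (- s))%:C%C * ((expR s)%:C%C * damp phi s)) = damp phi.
  by apply/funext => s; rewrite mulrA -rmorphM -expRD addNr expR0 mul1r.
exact: id.
Qed.

Lemma sum_norm_Vof_le phi K : ccont phi -> 0 <= K ->
  (forall s, cmod (phi s) <= K * (1 + expR s)) ->
  (sum_norm N0 N1 (Vof phi) <= (2 * K * tau)%:E)%E.
Proof.
move=> c K0 h; apply: (le_trans (sum_norm_Vof c)).
rewrite (_ : 2 * K * tau = K * tau + K * tau); last by ring.
rewrite EFinD; apply: leeD; apply: fnorm_le => //; try exact: ccont_damp;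
  by move=> s; exact: damp_le.
Qed.

Variable k : R.
Hypothesis k1 : 1 < k.

Definition calderon_fun (z : R[i]^o) : L0 mu n := Vof (psi theta k z).

Let K := k / (k - 1).
Let K0 : 0 < K. Proof. by rewrite divr_gt0 ?subr_gt0// (lt_trans _ k1). Qed.

Let sn_ge0 (x : L0 mu n) : (0 <= sum_norm N0 N1 x)%E.
Proof. by apply: sum_norm_ge0 => y; exact: Lnorm_ge0. Qed.

Lemma calderon_fun_bounded z : strip z ->
  (sum_norm N0 N1 (calderon_fun z) <= (2 * K * tau)%:E)%E.
Proof.
move=> sz; apply: sum_norm_Vof_le; [exact: ccont_psi | exact: ltW |].
by move=> s; exact: psi_le.
Qed.

(** One continuity estimate for all uses: wt = 1 / (1 + exp s) for the sum norm on the strip, and wt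
    = 1 or exp(- s) for the two boundary lines. *)
Let small_diff (p : R) (A : set C) (wt : R -> C) z : 0 < p ->
  ccont wt -> (forall w, A w -> 0 <= complex.Re w) -> A z ->
  (forall w s, A w -> cmod (wt s * psi theta k w s) <= K) ->
  forall e : R, 0 < e -> exists2 dl : R, 0 < dl & forall w, A w ->
    cmod (w - z) < dl ->
    (fn p (fun s => (wt s * (psi theta k w s - psi theta k z s))%R) <= e%:E)%E.
Proof.
move=> pp cw A0 Az Ab.
apply: (@fnorm_continuous _ _ _ _ _ _ _ mW0 mW1 uW0 uW1 _ _ _ _ _ mg tau0
  wsize_int p A (fun w s => wt s * (psi theta k w s - psi theta k z s)) z (2 * K)).
- exact: pp.
- move=> w Aw; apply: ccontM => //.
  by apply: ccontD; [exact: ccont_psi | apply: ccontN; exact: ccont_psi].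
- by rewrite mulr_ge0// ltW.
- move=> w s Aw; rewrite mulrBr; apply: (le_trans (cmodD _ _)); rewrite cmodN.
  by have := Ab w s Aw; have := Ab z s Az; lra.
- move=> s e e0; have w0 : 0 < 1 + cmod (wt s) by have := cmod_ge0 (wt s); lra.
  have ew0 : 0 < e / (1 + cmod (wt s)) by rewrite divr_gt0.
  have [dl dl0 H] := psi_continuous theta01 k1 s (A0 z Az) ew0.
  exists dl => // w Aw /H; rewrite ler_pdivlMr// cmodM => h.
  by have := cmod_ge0 (psi theta k w s - psi theta k z s); nra.
Qed.

Lemma calderon_fun_continuous z : strip z ->
  sum_norm N0 N1 (calderon_fun w - calderon_fun z)
    @[w --> within strip (nbhs z)] --> 0%E.
Proof.
move=> sz; apply: ecvg0_within => // e e0.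
pose wt s : C := ((1 + expR s)^-1)%:C%C.
have cw : ccont wt.
  have := ccont_damp (ccont_cst 1); rewrite /damp.
  by under eq_fun do rewrite mulr1.
have A0 w : @strip R w -> 0 <= complex.Re w by case/andP.
have Ab w s : @strip R w -> cmod (wt s * psi theta k w s) <= K.
  by move=> sw; apply: damp_le; exact: psi_le.
have e20 : 0 < e / 2 by rewrite divr_gt0.
have [d1 d10 H1] := small_diff p00 cw A0 sz Ab e20.
have [d2 d20 H2] := small_diff p10 cw A0 sz Ab e20.
exists (Num.min d1 d2); first by rewrite lt_min d10.
move=> w sw; rewrite lt_min => /andP[w1 w2].
rewrite /calderon_fun -VofB; [|exact: ccont_psi|exact: ccont_psi].
apply: (le_trans (sum_norm_Vof _)).
  by apply: ccontD; [exact: ccont_psi | apply: ccontN; exact: ccont_psi].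
by rewrite [e]splitr EFinD; apply: leeD; [exact: H1 | exact: H2].
Qed.

Lemma calderon_fun_derivable z : open_strip z ->
  exists2 D : L0 mu n, (sum_norm N0 N1 D < +oo)%E &
    sum_norm N0 N1 (h^-1 *: (calderon_fun (z + h) - calderon_fun z) - D)
      @[h --> (0 : R[i]^o)^'] --> 0%E.
Proof.
move=> oz; exists (Vof (dpsi theta k z)).
  have [A A0 HA] := dpsi_le theta k oz.
  by apply: le_lt_trans (sum_norm_Vof_le (ccont_dpsi _ _ _) A0 HA) _; rewrite ltry.
have [A A0 [dl dl0 H]] := psi_diff2 theta01 k1 oz.
apply: ecvg0_within => // e e0.
have B0 : 0 < 2 * A * tau + 1 by rewrite ltr_wpDl// !mulr_ge0// ltW.
exists (Num.min dl (e / (2 * A * tau + 1))); first by rewrite lt_min dl0 divr_gt0.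
move=> h /= h0; rewrite subr0 lt_min => /andP[hd he].
have cpsi w : ccont (psi theta k w) by exact: ccont_psi.
have cB : ccont (fun s => psi theta k (z + h) s - psi theta k z s).
  by apply: ccontD; [exact: cpsi | apply: ccontN; exact: cpsi].
have cq : ccont (fun s => h^-1 * (psi theta k (z + h) s - psi theta k z s)).
  by apply: ccontM => //; exact: ccont_cst.
have cd : ccont (dpsi theta k z) by exact: ccont_dpsi.
have := VofB cq cd; rewrite (VofZ _ cB) (VofB (cpsi _) (cpsi _)) => <-.
apply: (@le_trans _ _ (2 * (A * cmod h) * tau)%:E).
  apply: sum_norm_Vof_le.
  - by apply: ccontD => //; exact: ccontN.
  - by rewrite mulr_ge0// cmod_ge0.
  - move=> s; have ch : 0 < cmod h by rewrite cmod_gt0.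
    rewrite -(ler_pM2l ch) -cmodM mulrBr mulrA divff// mul1r.
    by apply: (le_trans (H h s hd)); rewrite expr2; lra.
rewrite lee_fin; move: he; rewrite ltr_pdivlMr//.
have := cmod_ge0 h; nra.
Qed.

Section boundary.
Variables (N : L0 mu n -> \bar R) (p b : R) (wt : R -> C).
Hypothesis N_ge0 : forall x, (0 <= N x)%E.
Hypothesis NV : forall phi, ccont phi -> N (Vof phi) = fn p (fun s => wt s * phi s).
Hypothesis pp : 0 < p.
Hypothesis b0 : 0 <= b.
Hypothesis cwt : ccont wt.
Hypothesis wtb : forall s, cmod (wt s) * expR (b * s) = 1.

Let cpsi w : ccont (psi theta k w). Proof. exact: ccont_psi. Qed.

(** By [wtb] the weight cancels the modulus of rho^z on Re z = b, so only the damping is left. Both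
    lines are treated at once, with b = 0, wt = 1 and with b = 1, wt = exp(- s). *)
Lemma boundary_norm t (K' : R) : 0 <= K' -> cmod (damping theta k (Complex b t)) <= K' ->
  (N (calderon_fun (Complex b t)) <= (K' * tau)%:E)%E.
Proof.
move=> K'0 h; rewrite /calderon_fun NV//.
apply: (fnorm_le mW0 mW1 uW0 uW1 _ mg tau0 wsize_int pp _ K'0).
  exact: (ccontM cwt (cpsi _)).
by move=> s; rewrite cmodM cmod_psi mulrCA wtb mulr1.
Qed.

Lemma boundary_norm_le t : (N (calderon_fun (Complex b t)) <= (K * tau)%:E)%E.
Proof. by apply: boundary_norm; [exact: ltW | exact: damping_le]. Qed.

Lemma boundary_decay e : 0 < e -> exists A : R, forall t, A <= `|t| ->
  (N (calderon_fun (Complex b t)) <= e%:E)%E.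
Proof.
move=> e0; have k0 : 0 < k by exact: lt_trans k1.
have kt0 : 0 < k * tau / e by rewrite divr_gt0// mulr_gt0.
exists (k * tau / e) => t kt; have t0 : 0 < `|t| by exact: lt_le_trans kt0 kt.
have h : cmod (damping theta k (Complex b t)) <= k / `|t|.
  by apply: damping_decay => //=; rewrite -normr_gt0.
apply: (le_trans (boundary_norm _ h)); first by rewrite divr_ge0 ?(ltW k0) ?(ltW t0).
rewrite lee_fin mulrAC ler_pdivrMr//; move: kt; rewrite ler_pdivrMr//; lra.
Qed.

Lemma boundary_ok : boundary_line_ok N (fun t => calderon_fun (Complex b t)).
Proof.
split.
- by move=> t; apply: (le_lt_trans (boundary_norm_le t)); rewrite ltry.
- move=> t; apply: ecvg0 => // e e0.
  pose A (w : C) := complex.Re w = b.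
  have Ab w s : A w -> cmod (wt s * psi theta k w s) <= K.
    move=> Aw; rewrite cmodM cmod_psi Aw mulrCA wtb mulr1.
    by apply: damping_le => //; rewrite Aw.
  have A0 w : A w -> 0 <= complex.Re w by move=> ->.
  have At : A (Complex b t) by [].
  have [dl dl0 H] := small_diff pp cwt A0 At Ab e0.
  apply/nbhs_ballP; exists dl => //= s; rewrite /ball/= => ts.
  rewrite /calderon_fun -VofB// NV; last first.
    by apply: ccontD => //; exact: ccontN.
  apply: (H (Complex b s)) => //.
  rewrite (_ : Complex b s - Complex b t = Complex 0 (s - t)).
    by apply: (le_lt_trans (cmod_le_ReIm _)); rewrite /= normr0 add0r distrC.
  by apply/eqP; rewrite eq_complex/= subrr !eqxx.
- apply: ecvg0 => // e e0; have [A HA] := boundary_decay e0.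
  near=> t; apply: HA; apply: (@le_trans _ _ t); last exact: ler_norm.
  by near: t; apply: nbhs_pinfty_ge; exact: num_real.
- apply: ecvg0 => // e e0; have [A HA] := boundary_decay e0.
  near=> t; apply: HA; rewrite -normrN; apply: (@le_trans _ _ (- t)); last exact: ler_norm.
  by rewrite lerNr; near: t; apply: nbhs_ninfty_le; exact: num_real.
Unshelve. all: by end_near. Qed.

End boundary.

(** The powers of l_j cancel, and the exponent of h / tau is ptheta / p0 - 1 + theta gam, which is 0
    by the relation that defines [ptheta]. *)
Lemma calderon_fun_theta : calderon_fun theta%:C%C = f.
Proof.
rewrite /calderon_fun /Vof -[RHS]toL0_ofL0; congr (toL0 mu _); apply/funext => x.
rewrite -[RHS](mulKmx (uW0 x)); congr (_ *m _).
apply: (can_inj (mulKmx (spectral_unit (gram W0 W1 x)))); apply/colP => j.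
rewrite gfield_coord /psi (damping_theta theta k1) mul1r -/(coord W0 W1 x (g x) j).
rewrite -[RHS]mul1r; congr (_ * _); apply/eqP; rewrite eq_complex.
rewrite !(ReM, ImM)/= !(mul0r, mulr0, subr0, addr0, add0r) sin0 cos0.
rewrite !(mul0r, mulr0, subr0, addr0, add0r, mulr1) -expRD eqxx andbT.
apply/eqP; rewrite -[RHS](@expR0 R); congr expR; rewrite /lrho.
have pp : ptheta * ((1 - theta) / p0 + theta / p1) = 1.
  by rewrite -hptheta mulfV// gt_eqF.
rewrite [LHS](_ : _ = (ptheta * ((1 - theta) / p0 + theta / p1) - 1) *
    lwsize W0 W1 theta g tau x); last by field; rewrite !gt_eqF.
by rewrite pp subrr mul0r.
Qed.

Theorem calderon_fun_ok : calderon_F N0 N1 calderon_fun /\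
  (calderon_F_norm N0 N1 calderon_fun <= (K * tau)%:E)%E.
Proof.
have NV0 phi : ccont phi -> N0 (Vof phi) = fn p0 (fun s => 1 * phi s).
  move=> c; have [chi chiE] : exists chi, chi = (fun s => 1 * phi s) by eexists.
  rewrite -chiE; have -> : chi = phi.
    by rewrite chiE; apply/funext => s; rewrite mul1r.
  exact: N0_Vof.
have wtb0 s : cmod (1 : C) * expR (0 * s) = 1 by rewrite mul0r expR0 cmod1 mulr1.
have wtb1 s : cmod ((expR (- s))%:C%C : C) * expR (1 * s) = 1.
  by rewrite cmod_real ger0_norm ?expR_ge0// -expRD mul1r addNr expR0.
have N00 (x : L0 mu n) : (0 <= N0 x)%E by exact: Lnorm_ge0.
have N10 (x : L0 mu n) : (0 <= N1 x)%E by exact: Lnorm_ge0.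
have cw1 : ccont (fun s : R => (expR (- s))%:C%C).
  apply: ccont_real => s; apply: continuous_comp; last exact: continuous_expR.
  exact: cvgN.
split; last first.
  rewrite /calderon_F_norm ge_max; apply/andP; split; apply: ge_ereal_sup => _ [t _ <-].
    exact: (boundary_norm_le NV0 p00 (lexx 0) (ccont_cst 1) wtb0).
  exact: (boundary_norm_le N1_Vof p10 ler01 cw1 wtb1).
split.
- by exists (2 * K * tau) => z; exact: calderon_fun_bounded.
- exact: calderon_fun_continuous.
- exact: calderon_fun_derivable.
- exact: (boundary_ok N00 NV0 p00 (lexx 0) (ccont_cst 1) wtb0).
- exact: (boundary_ok N10 N1_Vof p10 ler01 cw1 wtb1).
Qed.

End calderon_function.

(** * Integrals of complex functions *)

Section complex_integral.
Context {d : measure_display} {T : measurableType d} {R : realType}.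
Local Notation C := R[i].
Variable mu : {measure set T -> \bar R}.
Implicit Types (u v : T -> C).

Definition cintegrable u : Prop :=
  mu.-integrable [set: T] (EFin \o (fun x => complex.Re (u x))) /\
  mu.-integrable [set: T] (EFin \o (fun x => complex.Im (u x))).

Definition cint u : C :=
  Complex (\int[mu]_x complex.Re (u x)) (\int[mu]_x complex.Im (u x)).

Lemma cintegrable_meas u : cintegrable u -> cmeas u.
Proof.
by move=> [/measurable_int/measurable_EFinP ? /measurable_int/measurable_EFinP].
Qed.

Lemma cintegrable_dom u (h : T -> R) : cmeas u ->
  measurable_fun [set: T] h -> (forall x, cmod (u x) <= h x) ->
  (\int[mu]_x (h x)%:E < +oo)%E -> cintegrable u.
Proof.
move=> [m1 m2] mh uh ih.
have h0 x : 0 <= h x by exact: le_trans (cmod_ge0 _) (uh x).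
have ihh : mu.-integrable [set: T] (EFin \o h).
  apply/integrableP; split; first exact/measurable_EFinP.
  by under eq_integral do rewrite /= ger0_norm//.
split; apply: le_integrable ihh => //; try exact/measurable_EFinP.
- move=> x _ /=; rewrite lee_fin (ger0_norm (h0 x)).
  exact: le_trans (Re_le_cmod _) (uh x).
- move=> x _ /=; rewrite lee_fin (ger0_norm (h0 x)).
  exact: le_trans (Im_le_cmod _) (uh x).
Qed.

Lemma cintegrableD u v : cintegrable u -> cintegrable v ->
  cintegrable (fun x => u x + v x).
Proof.
move=> [u1 u2] [v1 v2]; split.
- have := integrableD measurableT u1 v1.
  by congr (mu.-integrable setT _); apply/funext => x /=; rewrite ReD.
- have := integrableD measurableT u2 v2.
  by congr (mu.-integrable setT _); apply/funext => x /=; rewrite ImD.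
Qed.

Lemma cintD u v : cintegrable u -> cintegrable v ->
  cint (fun x => u x + v x) = cint u + cint v.
Proof.
move=> [u1 u2] [v1 v2]; apply/eqP; rewrite eq_complex/=; apply/andP; split; apply/eqP.
- by rewrite -RintegralD//; apply: eq_Rintegral => x _; rewrite ReD.
- by rewrite -RintegralD//; apply: eq_Rintegral => x _; rewrite ImD.
Qed.

Lemma integrable_comb (f g : T -> R) (a b : R) :
  mu.-integrable [set: T] (EFin \o f) -> mu.-integrable [set: T] (EFin \o g) ->
  mu.-integrable [set: T] (EFin \o (fun x => a * f x + b * g x)) /\
  \int[mu]_x (a * f x + b * g x) = a * \int[mu]_x f x + b * \int[mu]_x g x.
Proof.
move=> fi gi; have fa := integrableZl measurableT a fi.
have gb := integrableZl measurableT b gi; split.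
  have := integrableD measurableT fa gb.
  by congr (mu.-integrable setT _); apply/funext => x /=; rewrite EFinD !EFinM.
by rewrite RintegralD// !RintegralZl.
Qed.

Lemma cintZ a u : cintegrable u ->
  cintegrable (fun x => a * u x) /\ cint (fun x => a * u x) = a * cint u.
Proof.
move=> [u1 u2].
have [i1 e1] := integrable_comb (complex.Re a) (- complex.Im a) u1 u2.
have [i2 e2] := integrable_comb (complex.Re a) (complex.Im a) u2 u1.
split; first split.
- by move: i1; congr (mu.-integrable setT _); apply/funext => x /=;
    rewrite ReM mulNr.
- by move: i2; congr (mu.-integrable setT _); apply/funext => x /=; rewrite ImM.
- apply/eqP; rewrite eq_complex ReM ImM/=; apply/andP; split; apply/eqP.
  + by rewrite -mulNr -e1; apply: eq_Rintegral => x _; rewrite ReM mulNr.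
  + by rewrite -e2; apply: eq_Rintegral => x _; rewrite ImM.
Qed.

(* Rotating the integrand makes its integral real and nonnegative. *)
Lemma cmod_cint_le u : cintegrable u ->
  ((cmod (cint u))%:E <= \int[mu]_x (cmod (u x))%:E)%E.
Proof.
move=> iu; have mu' := cintegrable_meas iu.
have mc : measurable_fun [set: T] (fun x => cmod (u x)) by exact: cmeas_cmod.
have [->|c0] := eqVneq (cint u) 0.
  by rewrite cmod0; apply: integral_ge0 => x _; rewrite lee_fin cmod_ge0.
pose c := (cint u)^*%C / (cmod (cint u))%:C%C.
have n0 : 0 < cmod (cint u) by rewrite cmod_gt0.
have c1 : cmod c = 1.
  rewrite /c cmodM cmodV cmod_real gtr0_norm//.
  by rewrite [X in X / _](_ : _ = cmod (cint u)) ?mulfV ?gt_eqF//;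
    case: (cint u) => a b; rewrite !cmodE/= sqrrN.
have ce : c * cint u = (cmod (cint u))%:C%C.
  rewrite /c mulrAC [X in X / _](_ : _ = (cmod (cint u))%:C%C * (cmod (cint u))%:C%C).
    by rewrite mulfK// fmorph_eq0 gt_eqF.
  by rewrite mulrC -sqr_normc normr_cmod expr2.
have [[i1 _] e1] := cintZ c iu.
have -> : cmod (cint u) = \int[mu]_x complex.Re (c * u x).
  by rewrite -[LHS]/(complex.Re (cmod (cint u))%:C%C) -ce -e1.
rewrite /Rintegral fineK; last exact: integrable_fin_num.
apply: (@le_trans _ _ (\int[mu]_x `|(complex.Re (c * u x))%:E|)%E).
  apply: (le_trans (lee_abs _)); apply: le_abse_integral => //.
  exact: (measurable_int mu i1).
apply: ge0_le_integral => //.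
- by apply: measurableT_comp => //; exact: (measurable_int mu i1).
- exact/measurable_EFinP.
- move=> x _; rewrite lee_fin; apply: (le_trans (Re_le_cmod _)).
  by rewrite cmodM c1 mul1r.
Qed.

Lemma cint_ae u v : cmeas u -> cmeas v -> u = v %[ae mu] ->
  cintegrable u -> cintegrable v /\ cint u = cint v.
Proof.
move=> [mu1 mu2] [mv1 mv2] uv [i1 i2].
have e (P : C -> R) : measurable_fun [set: T] (fun x => P (u x)) ->
    measurable_fun [set: T] (fun x => P (v x)) ->
    mu.-integrable [set: T] (EFin \o (fun x => P (u x))) ->
    mu.-integrable [set: T] (EFin \o (fun x => P (v x))) /\
    \int[mu]_x P (u x) = \int[mu]_x P (v x).
  move=> m1 m2 i; have ae : ae_eq mu [set: T] (EFin \o (fun x => P (u x)))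
      (EFin \o (fun x => P (v x))).
    by apply: filterS uv => x /= /(_ I) -> _.
  split; last first.
    rewrite /Rintegral; congr fine.
    by apply: ae_eq_integral => //; exact/measurable_EFinP.
  move/integrableP : i => [_ i]; apply/integrableP; split; first exact/measurable_EFinP.
  rewrite (ae_eq_integral (abse \o (EFin \o (fun x => P (u x)))))//.
  - by apply: measurableT_comp => //; exact/measurable_EFinP.
  - by apply: measurableT_comp => //; exact/measurable_EFinP.
  - by apply: filterS uv => x /= /(_ I) -> _.
have [v1 e1] := e (@complex.Re R) mu1 mv1 i1.
have [v2 e2] := e (@complex.Im R) mu2 mv2 i2.
by split=> //; rewrite /cint e1 e2.
Qed.

End complex_integral.

(** * The Cauchy-Schwarz inequality for finite sums *)

Section cauchy_schwarz.
Context {R : realType}.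

(** Nonnegativity of the squares (s a_j - t b_j)^2 with s = sqrt B and t = sqrt A gives, after
    summation, sqrt(A B) S <= A B. Division needs A B > 0; otherwise one family vanishes. *)
Lemma cauchy_schwarz_sum n (a b : 'I_n -> R) :
  (forall j, 0 <= a j) -> (forall j, 0 <= b j) ->
  \sum_j a j * b j <= Num.sqrt (\sum_j a j ^+ 2) * Num.sqrt (\sum_j b j ^+ 2).
Proof.
move=> a0 b0; set A := \sum_j a j ^+ 2; set B := \sum_j b j ^+ 2.
have A0 : 0 <= A by apply: sumr_ge0 => j _; exact: sqr_ge0.
have B0 : 0 <= B by apply: sumr_ge0 => j _; exact: sqr_ge0.
have key (s t : R) : \sum_j 2 * (s * t) * (a j * b j) <= s ^+ 2 * A + t ^+ 2 * B.
  rewrite /A /B !mulr_sumr -big_split/=; apply: ler_sum => j _.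
  by have := sqr_ge0 (s * a j - t * b j); nra.
have := key (Num.sqrt B) (Num.sqrt A); rewrite -mulr_sumr !sqr_sqrtr//.
set S := \sum_j _; set p := Num.sqrt B; set q := Num.sqrt A => h.
have pq0 : 0 <= q * p by rewrite mulr_ge0 ?sqrtr_ge0.
have AB : B * A = (q * p) ^+ 2.
  by rewrite exprMn /p /q !sqr_sqrtr// mulrC.
have [qp|qp] := ltrP 0 (q * p).
  rewrite -(ler_pM2l qp); move: h; rewrite [A * B]mulrC AB; lra.
have {qp}qp : q * p = 0 by apply/eqP; rewrite eq_le qp.
rewrite qp; have : B * A == 0 by rewrite AB qp expr0n.
have z (c e : 'I_n -> R) : \sum_j c j ^+ 2 == 0 -> \sum_j c j * e j = 0.
  rewrite psumr_eq0; last by move=> ? _; exact: sqr_ge0.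
  move=> /allP h0; rewrite big1// => j _.
  have := h0 j (mem_index_enum _); rewrite sqrf_eq0 => /eqP ->.
  by rewrite mul0r.
rewrite mulf_eq0 => /orP[/(z b a) e|/(z a b) e]; rewrite /S.
  by under eq_bigr do rewrite mulrC; rewrite e.
by rewrite e.
Qed.

Lemma cmod_sum_le n (a b : 'I_n -> R[i]) :
  cmod (\sum_j a j * b j) <=
  Num.sqrt (\sum_j cmod (a j) ^+ 2) * Num.sqrt (\sum_j cmod (b j) ^+ 2).
Proof.
apply: (@le_trans _ _ (\sum_j cmod (a j) * cmod (b j))).
  elim/big_ind2 : _ => [|x1 x2 y1 y2 h1 h2|j _]; first by rewrite cmod0.
    by apply: (le_trans (cmodD _ _)); exact: lerD.
  by rewrite cmodM.
by apply: cauchy_schwarz_sum => j; exact: cmod_ge0.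
Qed.

End cauchy_schwarz.

Lemma num_conjE (R : realType) (z : R[i]) : z^* = z^*%C.
Proof. by []. Qed.

(** * The dual field: pointwise bounds and Hoelder *)

Section pairing.
Context {d : measure_display} {T : measurableType d} {R : realType}.
Local Notation C := R[i].
Variables (mu : {measure set T -> \bar R}) (n : nat) (W0 W1 : T -> 'M[C]_n).
Hypothesis mW0 : measurable_fun_mx W0.
Hypothesis mW1 : measurable_fun_mx W1.
Hypothesis uW0 : invertible_field W0.
Hypothesis uW1 : invertible_field W1.
Variables (p0 p1 theta ptheta tau : R) (g : T -> 'cV[C]_n).
Hypothesis p01 : 1 <= p0.
Hypothesis p11 : 1 <= p1.
Hypothesis ptheta0 : 0 < ptheta.
Hypothesis tau0 : 0 < tau.
Hypothesis mg : measurable_fun_mx g.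

Local Notation gam := (ptheta / p1 - ptheta / p0).
Local Notation G := (gfield W0 W1 theta g tau gam).
Local Notation N0 := (@Lp_norm _ _ _ mu n p0 W0).
Local Notation N1 := (@Lp_norm _ _ _ mu n p1 W1).
Local Notation sz := (wsize W0 W1 theta g).
Local Notation lr := (lrho W0 W1 theta g tau gam).

Variables (E : set T) (Lam : R).
Hypothesis mE : measurable E.
Hypothesis E_lrho : forall x j, E x -> `|lr x j| <= Lam.
Hypothesis E_int : (\int[mu]_x (\1_E x * (sz x / tau) `^ ptheta)%:E = 1)%E.

Let p00 : 0 < p0. Proof. exact: lt_le_trans p01. Qed.
Let p10 : 0 < p1. Proof. exact: lt_le_trans p11. Qed.

(** Chosen so that dual_exp + 1 = ptheta (1 - 1 / p0), which puts the dual field into the space with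
    the exponent conjugate to p0. *)
Definition dual_exp : R := ptheta - ptheta / p0 - 1.

(** The symbol is conjugated inside the field, so that the adjoint undoes it and the pairing is
    linear in [phi]; a symbol holomorphic in z then gives a holomorphic pairing. *)
Definition pairing_at (phi : R -> C) (v : T -> 'cV[C]_n) x : C :=
  (\1_E x)%:C%C *
  ((G dual_exp (fun s => (phi s)^*%C) x)^t* *m (W0 x *m v x)) 0 0.

Lemma pairing_atE phi v x : pairing_at phi v x = (\1_E x)%:C%C *
  \sum_j ((expR (dual_exp * lwsize W0 W1 theta g tau x + theta / 2 * lsp W0 W1 x j))%:C%C *
    phi (lr x j) * (coord W0 W1 x (g x) j)^*%C) * coord W0 W1 x (v x) j.
Proof.
rewrite /pairing_at -(gram_unitary _ _ (spectral_unitarymx (gram W0 W1 x))) mxE.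
congr (_ * _); apply: eq_bigr => j _; congr (_ * _).
rewrite 2!mxE gfield_coord; move: (coord _ _ _ _ _) (phi _) => a b.
rewrite !num_conjE; case: a b => [a1 a2] [b1 b2]; rewrite /= /conjc.
by apply/eqP; rewrite eq_complex/=; apply/andP; split; apply/eqP; ring.
Qed.

Lemma ccont_conj (phi : R -> C) : ccont phi -> ccont (fun s => (phi s)^*%C).
Proof.
move=> [c1 c2]; split=> x.
  rewrite (_ : (fun t => _) = (fun t => complex.Re (phi t))); first exact: c1.
  by apply/funext => t; case: (phi t).
rewrite (_ : (fun t => _) = (fun t => - complex.Im (phi t))).
  by apply: cvgN; exact: c2.
by apply/funext => t; case: (phi t).
Qed.

Lemma cmeas_pair phi v : ccont phi -> measurable_fun_mx v -> cmeas (pairing_at phi v).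
Proof.
move=> c mv; apply: cmeasM.
  by apply: cmeas_real; exact: measurable_indic.
have mG := measurable_gfield mW0 mW1 uW0 uW1 theta tau gam mg dual_exp (ccont_conj c).
exact: (measurable_mxM (measurable_trmxC mG) (measurable_mxM mW0 mv) 0 0).
Qed.

Lemma pairDr phi v w x : pairing_at phi (fun x => v x + w x) x = pairing_at phi v x + pairing_at phi w x.
Proof. by rewrite /pairing_at mulmxDr mulmxDr mxE mulrDr. Qed.

Lemma pairZr phi a v x : pairing_at phi (fun x => a *: v x) x = a * pairing_at phi v x.
Proof. by rewrite /pairing_at -!scalemxAr mxE mulrCA. Qed.

Lemma pair_linl phi psi a v x : pairing_at (fun s => a * phi s + psi s) v x =
  a * pairing_at phi v x + pairing_at psi v x.
Proof.
rewrite !pairing_atE mulrCA -mulrDr; congr (_ * _).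
rewrite mulr_sumr -big_split/=; apply: eq_bigr => j _; ring.
Qed.

(** By [E_int], for p > 1 this function has norm 1 in the space with the exponent conjugate to p. *)
Definition wgt (p : R) x : R := \1_E x * (sz x / tau) `^ (ptheta * (1 - p^-1)).

Lemma wgt_ge0 p x : 0 <= wgt p x.
Proof. by rewrite mulr_ge0 ?powR_ge0// indicE; case: (_ \in _). Qed.

Let gfield_wgt_le a p phi K x : E x -> 0 <= K ->
  a + 1 = ptheta * (1 - p^-1) ->
  (forall s, `|s| <= Lam -> cmod (phi s) <= K) ->
  enorm (G a phi x) <= K * tau * wgt p x.
Proof.
move=> Ex K0 ap h; have h1 j : cmod (phi (lr x j)) <= K by apply: h; exact: E_lrho.
apply: (le_trans (gfield_le uW0 uW1 a K0 h1)).
rewrite -mulrA ler_wpM2l// /wgt indicE mem_set// mul1r -ap.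
exact: (wsize_powR_le W0 W1 theta g tau0 a x).
Qed.

Lemma pair_le0 phi v K x : 0 <= K ->
  (forall s, `|s| <= Lam -> cmod (phi s) <= K) ->
  cmod (pairing_at phi v x) <= K * tau * (wgt p0 x * enorm (W0 x *m v x)).
Proof.
move=> K0 h; have [Ex|nEx] := pselect (E x); last first.
  rewrite /pairing_at indicE memNset// mul0r cmod0.
  exact: (mulr_ge0 (mulr_ge0 K0 (ltW tau0)) (mulr_ge0 (wgt_ge0 _ _) (enorm_ge0 _))).
rewrite pairing_atE indicE mem_set// mul1r; apply: (le_trans (cmod_sum_le _ _)).
rewrite mulrA; apply: ler_pM; rewrite ?sqrtr_ge0//; last first.
  by rewrite -enorm_W0 sqrtr_sqr ger0_norm ?enorm_ge0.
apply: le_trans (@gfield_wgt_le dual_exp p0 phi K x Ex K0 _ h).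
  rewrite -[leRHS]ger0_norm ?enorm_ge0// -sqrtr_sqr enorm_gfield.
  rewrite le_eqVlt; apply/orP; left; apply/eqP; congr Num.sqrt.
  apply: eq_bigr => j _; congr (_ ^+ 2); rewrite 2!cmodM cmod_real.
  rewrite ger0_norm ?expR_ge0//; congr (_ * _).
  by case: (coord _ _ _ _ _) => a b; rewrite !cmodE/= sqrrN.
by rewrite /dual_exp; ring.
Qed.

(** A factor l_j is moved from the dual field to [v], which turns [W0 v] into [W1 v]. As 1 / l_j =
    rho_j / c, the dual exponent drops by [gam] and the symbol gains exp s. *)
Lemma pair_le1 phi v K x : 0 <= K ->
  (forall s, `|s| <= Lam -> cmod ((expR s)%:C%C * phi s) <= K) ->
  cmod (pairing_at phi v x) <= K * tau * (wgt p1 x * enorm (W1 x *m v x)).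
Proof.
move=> K0 h; have [Ex|nEx] := pselect (E x); last first.
  rewrite /pairing_at indicE memNset// mul0r cmod0.
  exact: (mulr_ge0 (mulr_ge0 K0 (ltW tau0)) (mulr_ge0 (wgt_ge0 _ _) (enorm_ge0 _))).
rewrite pairing_atE indicE mem_set// mul1r.
pose a j : C := (expR (- (lsp W0 W1 x j / 2)))%:C%C *
  ((expR (dual_exp * lwsize W0 W1 theta g tau x + theta / 2 * lsp W0 W1 x j))%:C%C *
    phi (lr x j) * (coord W0 W1 x (g x) j)^*%C).
pose b j : C := (expR (lsp W0 W1 x j / 2))%:C%C * coord W0 W1 x (v x) j.
rewrite (_ : \sum_j _ = \sum_j a j * b j); last first.
  apply: eq_bigr => j _; rewrite /a /b mulrACA -rmorphM -expRD addNr expR0.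
  by rewrite rmorph1 mul1r.
apply: (le_trans (cmod_sum_le _ _)); rewrite mulrA; apply: ler_pM;
  rewrite ?sqrtr_ge0//; last first.
  rewrite -[leRHS]ger0_norm ?enorm_ge0// -sqrtr_sqr (enorm_W1 uW0 uW1).
  rewrite le_eqVlt; apply/orP; left; apply/eqP; congr Num.sqrt.
  apply: eq_bigr => j _; congr (_ ^+ 2).
  by rewrite cmodM cmod_real ger0_norm ?expR_ge0.
have e : dual_exp - gam + 1 = ptheta * (1 - p1^-1) by rewrite /dual_exp; ring.
apply: le_trans (@gfield_wgt_le (dual_exp - gam) p1
  (fun s => (expR s)%:C%C * phi s) K x Ex K0 e h).
rewrite -[leRHS]ger0_norm ?enorm_ge0// -sqrtr_sqr enorm_gfield.
rewrite le_eqVlt; apply/orP; left; apply/eqP; congr Num.sqrt.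
apply: eq_bigr => j _; congr (_ ^+ 2); rewrite /a !cmodM !cmod_real.
rewrite !ger0_norm ?expR_ge0// !mulrA; congr (_ * _ * _).
  by rewrite -!expRD; congr expR; rewrite /lrho; field; rewrite !gt_eqF.
by case: (coord _ _ _ _ _) => u w; rewrite !cmodE/= sqrrN.
Qed.

Lemma measurable_wgt p : measurable_fun [set: T] (wgt p).
Proof.
apply: measurable_funM; first exact: measurable_indic.
have m : measurable_fun [set: T] (fun x => sz x / tau).
  by apply: measurable_funM; [exact: measurable_wsize | exact: measurable_cst].
exact: (measurableT_comp (@measurable_powR R (ptheta * (1 - p^-1))) m).
Qed.

Lemma wgt_hoelder p (W : T -> 'M[C]_n) (v : T -> 'cV[C]_n) : 1 <= p -> measurable_fun_mx W -> measurable_fun_mx v ->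
  (\int[mu]_x (wgt p x * enorm (W x *m v x))%:E <=
   mnorm mu p (fun x => W x *m v x))%E.
Proof.
move=> p1' mW mv; pose w x := enorm (W x *m v x).
have mw : measurable_fun [set: T] w.
  by apply: measurable_enorm; exact: measurable_mxM.
have w0 x : 0 <= w x by exact: enorm_ge0.
(* For p = 1 the conjugate exponent is infinite; the weight is then the indicator of E, which is at
   most 1. *)
have [p1E|pn1] := eqVneq p 1.
  rewrite /mnorm p1E invr1 poweRe1; last first.
    by apply: integral_ge0 => x _; rewrite lee_fin powR_ge0.
  apply: ge0_le_integral => //.
  - by move=> x _; rewrite lee_fin (mulr_ge0 (wgt_ge0 1 x) (w0 x)).
  - by apply/measurable_EFinP; apply: measurable_funM => //; exact: measurable_wgt.
  - by apply/measurable_EFinP; exact: (measurableT_comp (@measurable_powR R 1) mw).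
  - move=> x _; rewrite lee_fin -/(w x) powRr1// ler_piMl// /wgt invr1 subrr mulr0.
    by rewrite powRr0 mulr1 indicE; case: (_ \in _).
have pgt1 : 1 < p by rewrite lt_def pn1.
have p0' : 0 < p by exact: lt_trans pgt1.
have q0 : 0 < 1 - p^-1 by rewrite subr_gt0 invf_lt1.
pose q := (1 - p^-1)^-1.
have q0' : 0 < q by rewrite invr_gt0.
have pq : q^-1 + p^-1 = 1 by rewrite /q invrK subrK.
have := hoelder mu (measurable_wgt p) mw q0' p0' pq.
have en x : `|((wgt p \* w) x)%:E|%E = (wgt p x * w x)%:E.
  by rewrite /= ger0_norm// (mulr_ge0 (wgt_ge0 p x) (w0 x)).
rewrite Lnorm1 (eq_integral _ _ (fun x _ => en x)).
move=> /le_trans; apply.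
have -> : ('N[mu]_q%:E[EFin \o wgt p] = 1)%E.
  rewrite unlock; have Eq x : (`|(EFin \o wgt p) x| `^ q)%E =
      (\1_E x * (sz x / tau) `^ ptheta)%:E.
    rewrite [X in (X `^ q)%E](_ : _ = (wgt p x)%:E) ?poweR_EFin /wgt; last first.
      by rewrite -[LHS]/(`|wgt p x|%:E) (ger0_norm (wgt_ge0 p x)).
    congr _%:E.
    have i0 : 0 <= \1_E x :> R by rewrite indicE; case: (_ \in _).
    rewrite (powRM _ i0 (powR_ge0 _ _)).
    rewrite -powRrM /q mulfK ?gt_eqF// indicE.
    case: (_ \in _); first by rewrite powR1.
    by rewrite powR0 ?gt_eqF.
  under eq_integral do rewrite Eq.
  by rewrite E_int poweR1r.
rewrite mul1e unlock /mnorm.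
have Ew x : (`|(EFin \o w) x| `^ p)%E = ((enorm (W x *m v x)) `^ p)%:E.
  by rewrite [X in (X `^ p)%E](_ : _ = (w x)%:E) ?poweR_EFin// -[LHS]/(`|w x|%:E) ger0_norm.
by under eq_integral do rewrite Ew.
Qed.

End pairing.

(** * The pairing on classes of functions *)

Section pairing_L0.
Context {d : measure_display} {T : measurableType d} {R : realType}.
Local Notation C := R[i].
Variables (mu : {measure set T -> \bar R}) (n : nat) (W0 W1 : T -> 'M[C]_n).
Hypothesis mW0 : measurable_fun_mx W0.
Hypothesis mW1 : measurable_fun_mx W1.
Hypothesis uW0 : invertible_field W0.
Hypothesis uW1 : invertible_field W1.
Variables (p0 p1 theta ptheta tau : R) (g : T -> 'cV[C]_n).
Hypothesis p01 : 1 <= p0.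
Hypothesis p11 : 1 <= p1.
Hypothesis ptheta0 : 0 < ptheta.
Hypothesis tau0 : 0 < tau.
Hypothesis mg : measurable_fun_mx g.

Local Notation gam := (ptheta / p1 - ptheta / p0).
Local Notation N0 := (@Lp_norm _ _ _ mu n p0 W0).
Local Notation N1 := (@Lp_norm _ _ _ mu n p1 W1).
Local Notation sz := (wsize W0 W1 theta g).
Local Notation lr := (lrho W0 W1 theta g tau gam).

Variables (E : set T) (Lam : R).
Hypothesis mE : measurable E.
Hypothesis Lam0 : 0 <= Lam.
Hypothesis E_lrho : forall x j, E x -> `|lr x j| <= Lam.
Hypothesis E_int : (\int[mu]_x (\1_E x * (sz x / tau) `^ ptheta)%:E = 1)%E.

Local Notation pr := (pairing_at W0 W1 p0 p1 theta ptheta tau g E).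

Definition pairing (phi : R -> C) (V : L0 mu n) : C := cint mu (pr phi (ofL0 V)).

(** On E every value ln rho_j lies in [-Lam, Lam], so the symbol matters only there. *)
Definition cbounded (phi : R -> C) (K : R) : Prop :=
  forall s, `|s| <= Lam -> cmod (phi s) <= K.

Let mpr phi (V : L0 mu n) : ccont phi -> cmeas (pr phi (ofL0 V)).
Proof.
move=> c; exact: (cmeas_pair mW0 mW1 uW0 uW1 p0 p1 theta ptheta tau mg mE c (measurable_ofL0 V)).
Qed.

Let dom (phi : R -> C) (V : L0 mu n) (K M : R) (h : T -> R) :
  ccont phi -> 0 <= K -> measurable_fun [set: T] h -> (forall x, 0 <= h x) ->
  (forall x, cmod (pr phi (ofL0 V) x) <= K * tau * h x) ->
  (\int[mu]_x (h x)%:E <= M%:E)%E ->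
  cintegrable mu (pr phi (ofL0 V)) /\ cmod (pairing phi V) <= K * tau * M.
Proof.
move=> c K0 mh h0 le ih; have Kt : 0 <= K * tau by rewrite mulr_ge0// ltW.
have mh' : measurable_fun [set: T] (fun x => K * tau * h x).
  by apply: measurable_funM => //; exact: measurable_cst.
have int_le : (\int[mu]_x (K * tau * h x)%:E <= (K * tau * M)%:E)%E.
  under eq_integral do rewrite EFinM.
  rewrite ge0_integralZl_EFin//.
  - by rewrite [leRHS]EFinM; apply: lee_wpmul2l => //; rewrite lee_fin.
  - by move=> x _; rewrite lee_fin.
  - exact/measurable_EFinP.
have iu : cintegrable mu (pr phi (ofL0 V)).
  apply: (cintegrable_dom (mpr V c) mh' le).
  by apply: (le_lt_trans int_le); rewrite ltry.
split=> //; rewrite -lee_fin; apply: (le_trans (cmod_cint_le iu)).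
apply: le_trans int_le; apply: ge0_le_integral => //.
- by move=> x _; rewrite lee_fin cmod_ge0.
- by apply/measurable_EFinP; apply: cmeas_cmod; exact: mpr.
- by apply/measurable_EFinP.
- by move=> x _; rewrite lee_fin.
Qed.

Let mwv p (W : T -> 'M[C]_n) (v : T -> 'cV[C]_n) : measurable_fun_mx W ->
  measurable_fun_mx v ->
  measurable_fun [set: T] (fun x => wgt W0 W1 theta ptheta tau g E p x * enorm (W x *m v x)).
Proof.
move=> mW mv; apply: measurable_funM.
  exact: (measurable_wgt mW0 mW1 uW0 uW1 theta ptheta tau mg mE p).
by apply: measurable_enorm; exact: measurable_mxM.
Qed.

Lemma pairing_bound0 phi V K M : ccont phi -> 0 <= K -> cbounded phi K ->
  (N0 V <= M%:E)%E ->
  cintegrable mu (pr phi (ofL0 V)) /\ cmod (pairing phi V) <= K * tau * M.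
Proof.
move=> c K0 b NM; have mV := measurable_ofL0 V.
apply: (dom c K0 (mwv p0 mW0 mV)).
- by move=> x; rewrite mulr_ge0 ?enorm_ge0// wgt_ge0.
- move=> x; exact: (pair_le0 uW0 uW1 tau0 E_lrho (ofL0 V) x K0 b).
- apply: le_trans NM; rewrite Lp_normE.
  exact: (wgt_hoelder mW0 mW1 uW0 uW1 mg mE E_int p01 mW0 mV).
Qed.

Lemma pairing_bound1 phi V K M : ccont phi -> 0 <= K ->
  cbounded (fun s => (expR s)%:C%C * phi s) K -> (N1 V <= M%:E)%E ->
  cintegrable mu (pr phi (ofL0 V)) /\ cmod (pairing phi V) <= K * tau * M.
Proof.
move=> c K0 b NM; have mV := measurable_ofL0 V.
apply: (dom c K0 (mwv p1 mW1 mV)).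
- by move=> x; rewrite mulr_ge0 ?enorm_ge0// wgt_ge0.
- move=> x; exact: (pair_le1 uW0 uW1 p01 p11 tau0 E_lrho (ofL0 V) x K0 b).
- apply: le_trans NM; rewrite Lp_normE.
  exact: (wgt_hoelder mW0 mW1 uW0 uW1 mg mE E_int p11 mW1 mV).
Qed.

Let ofL0D (U V : L0 mu n) : ofL0 (U + V) = (fun x => ofL0 U x + ofL0 V x) %[ae mu].
Proof.
have mU := measurable_ofL0 U; have mV := measurable_ofL0 V.
have := toL0D mu mU mV; rewrite !toL0_ofL0 => <-.
exact: (ofL0_toL0 mu (measurable_mxD mU mV)).
Qed.

Let ofL0Z (a : C) (V : L0 mu n) : ofL0 (a *: V) = (fun x => a *: ofL0 V x) %[ae mu].
Proof.
have mV := measurable_ofL0 V.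
have := toL0Z mu a mV; rewrite toL0_ofL0 => <-.
exact: (ofL0_toL0 mu (measurable_mxZ (cmeas_cst a) mV)).
Qed.

Definition pairable phi (V : L0 mu n) : Prop := cintegrable mu (pr phi (ofL0 V)).

Lemma pairingD phi U V : ccont phi -> pairable phi U -> pairable phi V ->
  pairable phi (U + V) /\ pairing phi (U + V) = pairing phi U + pairing phi V.
Proof.
move=> c iU iV; have i2 := cintegrableD iU iV.
rewrite /pairing -(cintD iU iV).
have [j e] : cintegrable mu (pr phi (ofL0 (U + V))) /\
    cint mu (fun x => pr phi (ofL0 U) x + pr phi (ofL0 V) x) =
    cint mu (pr phi (ofL0 (U + V))).
  apply: (cint_ae _ _ _ i2).
  - exact: (cmeasD (mpr U c) (mpr V c)).
  - exact: mpr.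
  - have h := ofL0D U V; apply: filterS h => x h I0.
    by rewrite -(pairDr W0 W1 p0 p1 theta ptheta tau g E phi (ofL0 U) (ofL0 V) x) /pairing_at (h I0).
by split; [exact: j | exact: esym].
Qed.

Lemma pairingZ phi a V : ccont phi -> pairable phi V ->
  pairable phi (a *: V) /\ pairing phi (a *: V) = a * pairing phi V.
Proof.
move=> c iV; have [i2 <-] := cintZ a iV.
have [j e] : cintegrable mu (pr phi (ofL0 (a *: V))) /\
    cint mu (fun x => a * pr phi (ofL0 V) x) = cint mu (pr phi (ofL0 (a *: V))).
  apply: (cint_ae _ _ _ i2).
  - exact: (cmeasM (cmeas_cst a) (mpr V c)).
  - exact: mpr.
  - have h := ofL0Z a V; apply: filterS h => x h I0.
    by rewrite -(pairZr W0 W1 p0 p1 theta ptheta tau g E phi a (ofL0 V) x) /pairing_at (h I0).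
by split; [exact: j | exact: esym].
Qed.

Lemma pairing_linl phi psi a V : pairable phi V -> pairable psi V ->
  pairable (fun s => a * phi s + psi s) V /\
  pairing (fun s => a * phi s + psi s) V = a * pairing phi V + pairing psi V.
Proof.
move=> i1 i2; have [j1 e1] := cintZ a i1.
rewrite /pairable /pairing -e1 -(cintD j1 i2).
have e : pr (fun s => a * phi s + psi s) (ofL0 V) =
    (fun x => a * pr phi (ofL0 V) x + pr psi (ofL0 V) x).
  by apply/funext => x; exact: pair_linl.
by rewrite e; split=> //; exact: (cintegrableD j1 i2).
Qed.

(** Given a decomposition V = y + z that nearly attains the sum norm, the first bound applies to y
    and the second to z. The factor exp Lam lets one constant dominate both [phi] and exp(s) phi on
    [-Lam, Lam]. *)
Lemma pairing_boundS phi V K r : ccont phi -> 0 <= K -> cbounded phi K ->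
  (sum_norm N0 N1 V < r%:E)%E ->
  pairable phi V /\ cmod (pairing phi V) <= K * (expR Lam * tau) * r.
Proof.
move=> c K0 b /ereal_inf_lt[_ [[y z] yz <-] lt].
rewrite /= in yz lt.
have N0y : (0 <= N0 y)%E by exact: Lnorm_ge0.
have N1z : (0 <= N1 z)%E by exact: Lnorm_ge0.
move: N0y N1z lt; case E0 : (N0 y) => [r0| |] //; case E1 : (N1 z) => [r1| |] //.
rewrite !lee_fin -EFinD lte_fin => r00 r10 lt.
have KL : K <= K * expR Lam.
  by rewrite ler_peMr// -[leLHS]expR0 ler_expR.
have KL0 : 0 <= K * expR Lam by exact: le_trans KL.
have b0 : cbounded phi (K * expR Lam).
  by move=> s sL; exact: le_trans (b s sL) KL.
have b1 : cbounded (fun s => (expR s)%:C%C * phi s) (K * expR Lam).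
  move=> s sL; rewrite cmodM cmod_real ger0_norm ?expR_ge0// mulrC.
  apply: ler_pM; rewrite ?cmod_ge0 ?expR_ge0//; first exact: b.
  by rewrite ler_expR (le_trans (ler_norm s)).
have N0y : (N0 y <= r0%:E)%E by rewrite E0.
have N1z : (N1 z <= r1%:E)%E by rewrite E1.
have [i0 h0] := pairing_bound0 c KL0 b0 N0y.
have [i1 h1] := pairing_bound1 c KL0 b1 N1z.
have [i e] := pairingD c i0 i1; rewrite yz in i e; split; first exact: i.
rewrite e.
apply: (le_trans (cmodD _ _)).
apply: (le_trans (lerD h0 h1)).
rewrite -mulrDr -(mulrA K).
have t0 := ltW tau0; have e0 := expR_ge0 Lam.
by apply: ler_wpM2l; [rewrite !mulr_ge0 | exact: ltW].
Qed.

End pairing_L0.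

(** * Holomorphy of the paired function, for an abstract pairing *)

Section pairing_three_lines.
Context {R : realType} {V : lmodType R[i]}.
Local Notation C := R[i].
Variables (N0 N1 : V -> \bar R) (Lam A tau : R).
Variables (pairs : (R -> C) -> V -> Prop) (P : (R -> C) -> V -> C).
Hypothesis N00 : forall x, (0 <= N0 x)%E.
Hypothesis N10 : forall x, (0 <= N1 x)%E.
Hypothesis Lam0 : 0 <= Lam.
Hypothesis A0 : 0 <= A.
Local Notation S := (sum_norm N0 N1).
Hypothesis PD : forall phi x y, ccont phi -> pairs phi x -> pairs phi y ->
  pairs phi (x + y) /\ P phi (x + y) = P phi x + P phi y.
Hypothesis PZ : forall phi a x, ccont phi -> pairs phi x ->
  pairs phi (a *: x) /\ P phi (a *: x) = a * P phi x.
Hypothesis P_linl : forall phi psi a x, pairs phi x -> pairs psi x ->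
  pairs (fun s => a * phi s + psi s) x /\
  P (fun s => a * phi s + psi s) x = a * P phi x + P psi x.
Hypothesis PS : forall phi x K r, ccont phi -> 0 <= K -> cbounded Lam phi K ->
  (S x < r%:E)%E -> pairs phi x /\ cmod (P phi x) <= K * A * r.
Hypothesis P0 : forall phi x M, ccont phi -> cbounded Lam phi 1 ->
  (N0 x <= M%:E)%E -> cmod (P phi x) <= tau * M.
Hypothesis P1 : forall phi x M, ccont phi ->
  cbounded Lam (fun s => (expR s)%:C%C * phi s) 1 ->
  (N1 x <= M%:E)%E -> cmod (P phi x) <= tau * M.

Definition rpow (z : C) (s : R) : C := cexp (- z * s%:C%C).
Definition drpow (z : C) (s : R) : C := (- s)%:C%C * rpow z s.
(** The second-order Taylor remainder of z |-> exp(- z s), written as two nested combinations a phi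
    + psi so that [P_linl] applies literally. *)
Definition rpow2 (z h : C) (s : R) : C :=
  (- h) * drpow z s + (-1 * rpow z s + rpow (z + h) s).

(** The 2 allows for points z + h with z in the strip and |h| <= 1, whose real parts are at most 2
    in absolute value. In [K2] the 4 is that of [cexp_taylor]; one factor [e2] bounds rho^-z, the
    other the exponential in the remainder. *)
Let e2 := expR (2 * Lam).
Let K2 := 4 * e2 ^+ 2 * Lam ^+ 2.
Let e20 : 0 <= e2. Proof. exact: expR_ge0. Qed.
Let K20 : 0 <= K2. Proof. by rewrite !mulr_ge0 ?sqr_ge0 ?exprn_ge0. Qed.

Lemma ccont_rpow z : ccont (rpow z). Proof. exact: ccont_cexp. Qed.

Lemma ccont_drpow z : ccont (drpow z).
Proof.
apply: ccontM; last exact: ccont_rpow.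
by apply: ccont_real => s; apply: cvgN; exact: cvg_id.
Qed.

Lemma ccont_rpow2 z h : ccont (rpow2 z h).
Proof.
apply: ccontD; first exact: (ccontM (ccont_cst _) (ccont_drpow z)).
exact: (ccontD (ccontM (ccont_cst _) (ccont_rpow z)) (ccont_rpow _)).
Qed.

Lemma cmod_rpow z s : cmod (rpow z s) = expR (- complex.Re z * s).
Proof. by rewrite cmod_cexp_real ReN. Qed.

Lemma rpow_bounded z : `|complex.Re z| <= 2 -> cbounded Lam (rpow z) e2.
Proof.
move=> z2 s sL; rewrite cmod_rpow ler_expR (le_trans (ler_norm _))//.
by rewrite normrM normrN ler_pM.
Qed.

Lemma drpow_bounded z : `|complex.Re z| <= 2 -> cbounded Lam (drpow z) (Lam * e2).
Proof.
move=> z2 s sL; rewrite cmodM cmod_real normrN ler_pM ?cmod_ge0//.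
exact: rpow_bounded.
Qed.

Lemma rpow2_bounded z h : `|complex.Re z| <= 2 -> cmod h <= 1 ->
  cbounded Lam (rpow2 z h) (K2 * cmod h ^+ 2).
Proof.
move=> z2 h1 s sL.
have -> : rpow2 z h s = rpow z s * (cexp (- h * s%:C%C) - 1 - (- h * s%:C%C)).
  rewrite /rpow2 /drpow /rpow opprD mulrDl cexpD rmorphN/=; ring.
rewrite cmodM; set w := - h * s%:C%C.
have wE : cmod w = cmod h * `|s| by rewrite cmodM cmodN cmod_real.
have wL : cmod w <= cmod h * Lam by rewrite wE ler_wpM2l// cmod_ge0.
have wL1 : cmod w <= 2 * Lam.
  by apply: (le_trans wL); have := ler_wpM2r Lam0 h1; have := Lam0; lra.
have h2 := cexp_taylor w; have h3 := rpow_bounded z2 sL.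
apply: (@le_trans _ _ (e2 * (4 * (cmod h * Lam) ^+ 2 * e2))).
  apply: ler_pM; rewrite ?cmod_ge0//; apply: (le_trans h2).
  have wsq : cmod w ^+ 2 <= (cmod h * Lam) ^+ 2.
    by rewrite ler_pXn2r ?nnegrE ?cmod_ge0// mulr_ge0// cmod_ge0.
  apply: ler_pM; [by rewrite mulr_ge0 ?sqr_ge0 | exact: expR_ge0 | lra |].
  by rewrite ler_expR.
by rewrite le_eqVlt; apply/orP; left; apply/eqP; rewrite /K2; ring.
Qed.

Lemma P_rpow_shift z h x r : `|complex.Re z| <= 1 -> cmod h <= 1 ->
  (S x < r%:E)%E ->
  P (rpow (z + h)) x = P (rpow z) x + h * P (drpow z) x + P (rpow2 z h) x.
Proof.
move=> z1 h1 Sx; have z2 : `|complex.Re z| <= 2 by lra.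
have zh : `|complex.Re (z + h)| <= 2.
  rewrite ReD (le_trans (ler_normD _ _))//.
  by have := Re_le_cmod h; lra.
have [q0 _] := PS (ccont_rpow z) e20 (rpow_bounded z2) Sx.
have [q1 _] := PS (ccont_rpow (z + h)) e20 (rpow_bounded zh) Sx.
have [q2 _] := PS (ccont_drpow z) (mulr_ge0 Lam0 e20) (drpow_bounded z2) Sx.
have [q3 E3] := P_linl (-1) q0 q1.
have [_ E] := P_linl (- h) q2 q3.
by rewrite -[P (rpow2 z h) x]/(P (fun s => (- h) * drpow z s +
  (-1 * rpow z s + rpow (z + h) s)) x) E E3; ring.
Qed.

Variable F : R[i]^o -> V.
Hypothesis HF : calderon_F N0 N1 F.
Let Phi (z : C) : C := P (rpow z) (F z).

Let strip1 (z : C) : in_strip z -> `|complex.Re z| <= 1.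
Proof. by case/andP=> z0 z1; rewrite ger0_norm. Qed.

Let S_fin x : (S x < +oo)%E -> exists r : R, 0 <= r /\ (S x < r%:E)%E.
Proof.
move=> Sx; have S0 := sum_norm_ge0 N00 N10 x.
move: S0 Sx; case: (S x) => [r| |]// r0 _; exists (r + 1); split.
  by rewrite addr_ge0.
by rewrite lte_fin ltrDl.
Qed.

Let F_bd : exists r : R, 0 <= r /\ forall z : C, in_strip z -> (S (F z) < r%:E)%E.
Proof.
have [[M HM] _ _ _ _] := HF; exists (`|M| + 1); split; first by rewrite addr_ge0.
move=> z zs; apply: (le_lt_trans (HM z zs)); rewrite lte_fin.
by apply: (le_lt_trans (ler_norm M)); rewrite ltrDl.
Qed.

Lemma pairing_strip_continuous : strip_continuous Phi.
Proof.
have [_ cF _ _ _] := HF; have [r [r0 Fr]] := F_bd.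
move=> z zs e e0; have z1 := strip1 zs.
have z2 : `|complex.Re z| <= 2 by lra.
pose B := (Lam * e2 + K2) * A * r.
have B0 : 0 <= B by rewrite !mulr_ge0 ?addr_ge0 ?mulr_ge0.
have eA : 0 <= e2 * A by rewrite mulr_ge0.
have e10 : 0 < e / (4 * (e2 * A + 1)) by rewrite divr_gt0// mulr_gt0// ltr_wpDl.
have [d1 d10 H1] := ecvg0_within_inv (fun w => sum_norm_ge0 N00 N10 (F w - F z)) (cF z zs) e10.
exists (Num.min d1 (Num.min 1 (e / (2 * (B + 1))))).
  by rewrite !lt_min d10 ltr01 divr_gt0// mulr_gt0// ltr_wpDl.
move=> w ws; rewrite !lt_min => /andP[wd /andP[/ltW wz1 wB]].
have Sd : (S (F w - F z) < (2 * (e / (4 * (e2 * A + 1))))%:E)%E.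
  by apply: (le_lt_trans (H1 w ws wd)); rewrite lte_fin; lra.
have w2 : `|complex.Re w| <= 2 by have := strip1 ws; lra.
have [q1 b1] := PS (ccont_rpow w) e20 (rpow_bounded w2) Sd.
have [q2 _] := PS (ccont_rpow w) e20 (rpow_bounded w2) (Fr z zs).
have [_ ED] := PD (ccont_rpow w) q1 q2.
have ES := P_rpow_shift z1 wz1 (Fr z zs).
have [_ b2] := PS (ccont_drpow z) (mulr_ge0 Lam0 e20) (drpow_bounded z2) (Fr z zs).
have K2h : 0 <= K2 * cmod (w - z) ^+ 2 by rewrite mulr_ge0 ?sqr_ge0.
have [_ b3] := PS (ccont_rpow2 z (w - z)) K2h (rpow2_bounded z2 wz1) (Fr z zs).
rewrite subrK in ED; rewrite addrC subrK in ES.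
(* The variation of F at the symbol of w, plus the variation of the symbol at the fixed vector F z,
   expanded to second order. *)
have -> : Phi w - Phi z = P (rpow w) (F w - F z) +
    ((w - z) * P (drpow z) (F z) + P (rpow2 z (w - z)) (F z)).
  by rewrite /Phi ED ES; ring.
move: (P (rpow w) (F w - F z)) (P (drpow z) (F z)) (P (rpow2 z (w - z)) (F z)) b1 b2 b3.
move=> a b c b1 b2 b3; apply: (le_trans (cmodD _ _)).
rewrite [e]splitr; apply: lerD.
  apply: (le_trans b1); rewrite mulrCA mulrA; have : 0 < e2 * A + 1 by lra.
  move=> k0; rewrite (_ : 2 * (e2 * A) * (e / (4 * (e2 * A + 1))) =
    e / 2 * ((e2 * A) / (e2 * A + 1))); last by field; rewrite gt_eqF.
  rewrite ler_piMr//; first by rewrite divr_ge0// ltW.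
  by rewrite ler_pdivrMr//; lra.
apply: (le_trans (cmodD _ _)); rewrite cmodM.
have h0 := cmod_ge0 (w - z).
apply: (@le_trans _ _ (cmod (w - z) * B)).
  have k1 : cmod (w - z) * cmod b <= cmod (w - z) * (Lam * e2 * A * r).
    by rewrite ler_wpM2l.
  have k2 : K2 * cmod (w - z) ^+ 2 * A * r <= cmod (w - z) * (K2 * A * r).
    rewrite (_ : _ * r = cmod (w - z) * (K2 * A * r) * cmod (w - z)); last by ring.
    by rewrite ler_piMr// !mulr_ge0.
  by rewrite /B; lra.
move: wB; rewrite ltr_pdivlMr; last by rewrite mulr_gt0// ltr_wpDl.
by lra.
Qed.

Lemma pairing_cderiv z : 0 < complex.Re z < 1 -> exists D, cderiv Phi z D.
Proof.
have [_ _ dF _ _] := HF; have [r [r0 Fr]] := F_bd.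
move=> oz; have zs : in_strip z by case/andP: oz => ? ?; apply/andP; split; exact: ltW.
have z1 := strip1 zs; have z2 : `|complex.Re z| <= 2 by lra.
have [D /S_fin[q [q0 Dq]] cD] := dF z oz.
exists (P (rpow z) D + P (drpow z) (F z)) => e e0.
pose B := K2 * A * r + Lam * e2 * A * q + K2 * A * q.
have B0 : 0 <= B by rewrite !addr_ge0 ?mulr_ge0.
have eA : 0 <= e2 * A by rewrite mulr_ge0.
have e10 : 0 < e / (4 * (e2 * A + 1)) by rewrite divr_gt0// mulr_gt0// ltr_wpDl.
have [d1 d10 H1] := ecvg0_within_inv
  (fun h => sum_norm_ge0 N00 N10 (h^-1 *: (F (z + h) - F z) - D)) cD e10.
exists (Num.min d1 (Num.min 1 (e / (2 * (B + 1))))).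
  by rewrite !lt_min d10 ltr01 divr_gt0// mulr_gt0// ltr_wpDl.
move=> h; rewrite !lt_min => /andP[hd /andP[/ltW h1 hB]].
have [->|h0] := eqVneq h 0.
  by rewrite addr0 subrr sub0r mulr0 oppr0 cmod0 mulr0.
have hd' : cmod (h - 0) < d1 by rewrite subr0.
have zh : `|complex.Re (z + h)| <= 2.
  rewrite ReD (le_trans (ler_normD _ _))//.
  by have := Re_le_cmod h; lra.
pose U := h^-1 *: (F (z + h) - F z) - D.
have SU : (S U < (2 * (e / (4 * (e2 * A + 1))))%:E)%E.
  by apply: (le_lt_trans (H1 h h0 hd')); rewrite lte_fin; lra.
have FE : F (z + h) = h *: (U + D) + F z.
  by rewrite /U subrK scalerA mulfV// scale1r subrK.
have c1 := ccont_rpow (z + h).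
have [u1 b1] := PS c1 e20 (rpow_bounded zh) SU.
have [u2 _] := PS c1 e20 (rpow_bounded zh) Dq.
have [u3 _] := PS c1 e20 (rpow_bounded zh) (Fr z zs).
have [v1 E1] := PD c1 u1 u2.
have [v2 E2] := PZ h c1 v1.
have [_ E3] := PD c1 v2 u3.
have K2h : 0 <= K2 * cmod h ^+ 2 by rewrite mulr_ge0 ?sqr_ge0.
have [_ b2] := PS (ccont_drpow z) (mulr_ge0 Lam0 e20) (drpow_bounded z2) Dq.
have [_ b3] := PS (ccont_rpow2 z h) K2h (rpow2_bounded z2 h1) Dq.
have [_ b4] := PS (ccont_rpow2 z h) K2h (rpow2_bounded z2 h1) (Fr z zs).
(* The product rule for a bilinear pairing. [U] is the error of the difference quotient of F, small
   in the sum norm; the other terms are of second order in h. *)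
have -> : Phi (z + h) - Phi z - (P (rpow z) D + P (drpow z) (F z)) * h =
    h * P (rpow (z + h)) U + (P (rpow2 z h) (F z) + h * h * P (drpow z) D
    + h * P (rpow2 z h) D).
  rewrite /Phi FE E3 E2 E1 (P_rpow_shift z1 h1 Dq) (P_rpow_shift z1 h1 (Fr z zs)).
  by ring.
move: (P _ U) (P (drpow z) D) (P (rpow2 z h) (F z)) (P (rpow2 z h) D) b1 b2 b4 b3.
move=> a b c c' b1 b2 b3 b4.
have hh := cmod_ge0 h.
apply: (le_trans (cmodD _ _)); rewrite (_ : e * cmod h = cmod h * (e / 2) + cmod h * (e / 2)); last first.
  by field.
apply: lerD.
  rewrite cmodM ler_wpM2l//; apply: (le_trans b1); have : 0 < e2 * A + 1 by lra.
  move=> k0; rewrite (_ : e2 * A * (2 * (e / (4 * (e2 * A + 1)))) =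
    e / 2 * ((e2 * A) / (e2 * A + 1))); last by field; rewrite gt_eqF.
  rewrite ler_piMr//; first by rewrite divr_ge0// ltW.
  by rewrite ler_pdivrMr//; lra.
apply: (@le_trans _ _ (cmod h * (cmod h * B))); last first.
  rewrite ler_wpM2l//; move: hB; rewrite ltr_pdivlMr; last by rewrite mulr_gt0// ltr_wpDl.
  by lra.
apply: (le_trans (cmodD _ _)).
have k0 := cmodD c (h * h * b).
have k1 : cmod (h * h * b) <= cmod h * cmod h * (Lam * e2 * A * q).
  by rewrite !cmodM ler_wpM2l// mulr_ge0.
have k2 : cmod (h * c') <= cmod h * cmod h * (K2 * A * q).
  rewrite cmodM -[leRHS]mulrA ler_wpM2l//; apply: (le_trans b4).
  rewrite [leLHS](_ : _ = cmod h * (K2 * A * q) * cmod h); last by ring.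
  by rewrite ler_piMr// !mulr_ge0.
by move: b3; rewrite /B; lra.
Qed.

(** On Re z = 0 the symbol rho^-z has modulus 1, and on Re z = 1 this is true of exp(s) rho^-z;
    these are the two symbols that the boundary estimates ask to be bounded by 1. *)
Lemma pairing_le M t : (calderon_F_norm N0 N1 F <= M%:E)%E -> 0 <= t <= 1 ->
  cmod (P (rpow t%:C%C) (F t%:C%C)) <= tau * M.
Proof.
move=> FM t01; have [r [r0 Fr]] := F_bd.
apply: (@three_lines R Phi (e2 * A * r) (tau * M) t pairing_strip_continuous
  pairing_cderiv _ _ t01).
- move=> z zs; have z2 : `|complex.Re z| <= 2 by have := strip1 zs; lra.
  by have [] := PS (ccont_rpow z) e20 (rpow_bounded z2) (Fr z zs).
- move: FM; rewrite /calderon_F_norm ge_max => /andP[M0 M1] [a b] /= [->|->].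
  + apply: (P0 (ccont_rpow _)).
      by move=> s _; rewrite cmod_rpow/= oppr0 mul0r expR0.
    by apply: le_trans M0; apply: ereal_sup_ubound; exists b.
  + apply: (P1 (ccont_rpow _)).
      move=> s _; rewrite cmodM cmod_real ger0_norm ?expR_ge0// cmod_rpow/=.
      by rewrite -expRD mulN1r subrr expR0.
    by apply: le_trans M1; apply: ereal_sup_ubound; exists b.
Qed.

End pairing_three_lines.

(** * Lower bound on a set where all quantities are controlled *)

Section lower_bound.
Context {d : measure_display} {T : measurableType d} {R : realType}.
Local Notation C := R[i].
Variables (mu : {measure set T -> \bar R}) (n : nat) (W0 W1 : T -> 'M[C]_n).
Hypothesis mW0 : measurable_fun_mx W0.
Hypothesis mW1 : measurable_fun_mx W1.
Hypothesis uW0 : invertible_field W0.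
Hypothesis uW1 : invertible_field W1.
Variables (p0 p1 theta ptheta : R).
Hypothesis p01 : 1 <= p0.
Hypothesis p11 : 1 <= p1.
Hypothesis theta01 : 0 < theta < 1.
Hypothesis ptheta0 : 0 < ptheta.
Hypothesis hptheta : ptheta^-1 = (1 - theta) / p0 + theta / p1.

Local Notation N0 := (@Lp_norm _ _ _ mu n p0 W0).
Local Notation N1 := (@Lp_norm _ _ _ mu n p1 W1).
Variables (F : R[i]^o -> L0 mu n) (M : R).
Hypothesis HF : calderon_F N0 N1 F.
Hypothesis FM : (calderon_F_norm N0 N1 F <= M%:E)%E.

Local Notation gam := (ptheta / p1 - ptheta / p0).
Local Notation f := (F theta%:C%C).
Local Notation g := (ofL0 f).
Local Notation sz := (wsize W0 W1 theta g).

Let mg : measurable_fun_mx g. Proof. exact: measurable_ofL0. Qed.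

Section level_set.
Variables (E : set T) (Lam tau : R).
Hypothesis mE : measurable E.
Hypothesis Lam0 : 0 <= Lam.
Hypothesis tau0 : 0 < tau.
Hypothesis E_lrho : forall x j, E x -> `|lrho W0 W1 theta g tau gam x j| <= Lam.
Hypothesis E_int : (\int[mu]_x (\1_E x * (sz x / tau) `^ ptheta)%:E = 1)%E.
Hypothesis E_sz : forall x, E x -> 0 < sz x.

(** The exponents of h / tau add up to dual_exp - theta gam = ptheta - 2. The remaining sum of
    l_j^(2 theta) |u_j|^2 is h^2, and (h / tau)^(ptheta - 2) h^2 = tau^2 (h / tau)^ptheta. *)
Lemma pair_theta x : pairing_at W0 W1 p0 p1 theta ptheta tau g E (rpow theta%:C%C) g x =
  (tau ^+ 2 * (\1_E x * (sz x / tau) `^ ptheta))%:C%C.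
Proof.
rewrite pairing_atE indicE; case: (boolP (x \in E)) => [|_]; last by rewrite !mul0r mulr0.
rewrite inE => Ex; have s0 := E_sz Ex; rewrite !mul1r.
have e : dual_exp p0 ptheta - theta * gam = ptheta - 2.
  have pp : ptheta * ((1 - theta) / p0 + theta / p1) = 1.
    by rewrite -hptheta mulfV// gt_eqF.
  transitivity (ptheta - 1 - ptheta * ((1 - theta) / p0 + theta / p1)).
    by rewrite /dual_exp; ring.
  by rewrite pp; ring.
have cE (a b c : R) (z : C) : a%:C%C * cexp (- b%:C%C * c%:C%C) * z^*%C * z =
    (expR (- b * c) * a * cmod z ^+ 2)%:C%C.
  rewrite cmod_sqr; case: z => u v; apply/eqP; rewrite eq_complex/= !mulr0.
  rewrite !(subr0, oppr0, mul0r, addr0, sin0, cos0, mulr1, mulr0).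
  by apply/andP; split; apply/eqP; ring.
transitivity (\sum_j (expR ((ptheta - 2) * lwsize W0 W1 theta g tau x) *
  (expR (theta / 2 * lsp W0 W1 x j) * cmod (coord W0 W1 x (g x) j)) ^+ 2)%:C%C).
  apply: eq_bigr => j _; rewrite cE; congr (_%:C%C).
  rewrite exprMn [RHS]mulrA; congr (_ * _).
  rewrite [X in _ = _ * X]expr2 -!expRD; congr expR.
  by rewrite -e /lrho; field; rewrite !gt_eqF// ?(lt_le_trans ltr01 p01) ?(lt_le_trans ltr01 p11).
rewrite -rmorph_sum/= -mulr_sumr -(wsize_sqr uW0 uW1); congr (_%:C%C).
have st : 0 < sz x / tau by rewrite divr_gt0.
have sE : sz x = tau * (sz x / tau) by rewrite mulrCA divff ?mulr1// gt_eqF.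
rewrite [in LHS]sE exprMn mulrCA; congr (_ * _).
rewrite /powR gt_eqF// -/(lwsize W0 W1 theta g tau x) mulrBl expRD -mulrA.
rewrite -mulNr -[(sz x / tau) ^+ 2](_ : expR (2 * lwsize W0 W1 theta g tau x) = _).
  by rewrite -expRD mulNr addNr expR0 mulr1.
by rewrite expRM_natl lnK.
Qed.

Lemma level_set_le : tau <= M.
Proof.
have hP0 phi (x : L0 mu n) (M' : R) : ccont phi -> cbounded Lam phi 1 ->
    (N0 x <= M'%:E)%E ->
    cmod (pairing W0 W1 p0 p1 theta ptheta tau g E phi x) <= tau * M'.
  move=> c b h; rewrite -[X in _ <= X * _]mul1r.
  by have [] := pairing_bound0 mW0 mW1 uW0 uW1 p01 tau0 mg mE E_lrho E_int c ler01 b h.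
have hP1 phi (x : L0 mu n) (M' : R) : ccont phi ->
    cbounded Lam (fun s => (expR s)%:C%C * phi s) 1 -> (N1 x <= M'%:E)%E ->
    cmod (pairing W0 W1 p0 p1 theta ptheta tau g E phi x) <= tau * M'.
  move=> c b h; rewrite -[X in _ <= X * _]mul1r.
  by have [] := pairing_bound1 mW0 mW1 uW0 uW1 p01 p11 tau0 mg mE E_lrho E_int c ler01 b h.
have h := @pairing_le R (L0 mu n) N0 N1 Lam (expR Lam * tau) tau
  (pairable W0 W1 p0 p1 theta ptheta tau g E)
  (pairing W0 W1 p0 p1 theta ptheta tau g E)
  (fun x => Lnorm_ge0 _ _ _) (fun x => Lnorm_ge0 _ _ _) Lam0
  (mulr_ge0 (expR_ge0 Lam) (ltW tau0))
  (fun phi x y => @pairingD _ _ _ mu _ _ _ mW0 mW1 uW0 uW1 p0 p1 theta ptheta tau g mg E mE phi x y)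
  (fun phi a x => @pairingZ _ _ _ mu _ _ _ mW0 mW1 uW0 uW1 p0 p1 theta ptheta tau g mg E mE phi a x)
  (fun phi psi a x => @pairing_linl _ _ _ mu _ W0 W1 p0 p1 theta ptheta tau g E phi psi a x)
  (fun phi x K r c K0 b Sx =>
    pairing_boundS mW0 mW1 uW0 uW1 p01 p11 tau0 mg mE Lam0 E_lrho E_int c K0 b Sx)
  hP0 hP1 F HF M theta FM.
have th01 : 0 <= theta <= 1 by case/andP: theta01 => /ltW -> /ltW ->.
have := le_trans (Re_le_cmod _) (h th01).
have -> : complex.Re (pairing W0 W1 p0 p1 theta ptheta tau g E (rpow theta%:C%C) f) =
    tau ^+ 2.
  rewrite -[LHS]/(\int[mu]_x complex.Re (pairing_at W0 W1 p0 p1 theta ptheta tau g E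
    (rpow theta%:C%C) g x)).
  have e x : complex.Re (pairing_at W0 W1 p0 p1 theta ptheta tau g E (rpow theta%:C%C) g x) =
      tau ^+ 2 * (\1_E x * (sz x / tau) `^ ptheta) by rewrite pair_theta.
  rewrite (eq_Rintegral mu (fun x _ => e x)) /Rintegral.
  under eq_integral do rewrite EFinM.
  rewrite ge0_integralZl_EFin ?sqr_ge0//.
  - by rewrite E_int mule1.
  - by move=> x _; rewrite lee_fin mulr_ge0 ?powR_ge0// indicE; case: (_ \in _).
  - apply/measurable_EFinP; apply: measurable_funM; first exact: measurable_indic.
    have m : measurable_fun [set: T] (fun x => sz x / tau).
      apply: measurable_funM; last exact: measurable_cst.
      exact: (measurable_wsize mW0 mW1 uW0 uW1 theta mg).
    exact: (measurableT_comp (@measurable_powR R ptheta) m).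
by rewrite ger0_norm ?sqr_ge0// expr2 ler_pM2l.
Qed.

End level_set.
End lower_bound.

(** Makes symmetric functions of the spectrum measurable. Hence the use below of [lsp2], a sum over
    all eigenvalues that still controls each of them. *)
Lemma trace_fcalc (R : realType) n (phi : R -> R[i]) (X : 'M[R[i]]_n) :
  \tr (fcalc phi X) = \sum_j phi (spec X j).
Proof.
rewrite fcalcE mxtrace_mulC mulmxA mulmxV ?spectral_unit// mul1mx mxtrace_diag.
by apply: eq_bigr => j _; rewrite mxE.
Qed.

(** * Exhaustion by level sets of finite measure *)

Section exhaustion.
Context {d : measure_display} {T : measurableType d} {R : realType}.
Local Notation C := R[i].
Variables (mu : {measure set T -> \bar R}) (n : nat) (W0 W1 : T -> 'M[C]_n).
Hypothesis sfmu : sigma_finite [set: T] mu.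
Hypothesis mW0 : measurable_fun_mx W0.
Hypothesis mW1 : measurable_fun_mx W1.
Hypothesis uW0 : invertible_field W0.
Hypothesis uW1 : invertible_field W1.
Variables (p0 p1 theta ptheta : R).
Hypothesis p01 : 1 <= p0.
Hypothesis p11 : 1 <= p1.
Hypothesis theta01 : 0 < theta < 1.
Hypothesis ptheta0 : 0 < ptheta.
Hypothesis hptheta : ptheta^-1 = (1 - theta) / p0 + theta / p1.

Local Notation N0 := (@Lp_norm _ _ _ mu n p0 W0).
Local Notation N1 := (@Lp_norm _ _ _ mu n p1 W1).
Variables (F : R[i]^o -> L0 mu n) (M : R).
Hypothesis HF : calderon_F N0 N1 F.
Hypothesis FM : (calderon_F_norm N0 N1 F <= M%:E)%E.

Local Notation gam := (ptheta / p1 - ptheta / p0).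
Local Notation f := (F theta%:C%C).
Local Notation g := (ofL0 f).
Local Notation sz := (wsize W0 W1 theta g).

Let mg : measurable_fun_mx g. Proof. exact: measurable_ofL0. Qed.

Definition lsp2 x : R := \sum_j (lsp W0 W1 x j / 2) ^+ 2.

Let measurable_lsp2 : measurable_fun [set: T] lsp2.
Proof.
have cphi : ccont (fun s : R => (s ^+ 2)%:C%C).
  by apply: ccont_real => s; exact: exprn_continuous.
have m0 := @measurable_cst _ _ T R setT 0.
have m := mcalc_log mW0 mW1 uW0 uW1 0 m0 m0 cphi.
have e x : lsp2 x = complex.Re (\tr (fcalc (fun t => (expR (0 + 0 * ln t))%:C%C *
    ((0 - ln t / 2) ^+ 2)%:C%C) (gram W0 W1 x))).
  rewrite trace_fcalc /lsp2 /lsp (raddf_sum (@complex.Re R)); apply: eq_bigr => j _.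
  by rewrite mul0r addr0 expR0 mul1r sub0r sqrrN.
have -> : lsp2 = (fun x => \sum_i complex.Re (fcalc (fun t => (expR (0 + 0 * ln t))%:C%C *
    ((0 - ln t / 2) ^+ 2)%:C%C) (gram W0 W1 x) i i)).
  by apply/funext => x; rewrite e /mxtrace raddf_sum.
by apply: measurable_sum => i; have [] := m i i.
Qed.

(** Bounds h from above and below where h > 0, and all l_j at the same time. It is formed with tau =
    1, since [tau] will depend on the level set. *)
Definition bnd x : R := `|lwsize W0 W1 theta g 1 x| + lsp2 x.

Let measurable_bnd : measurable_fun [set: T] bnd.
Proof.
apply: measurable_funD; last exact: measurable_lsp2.
apply: measurableT_comp => //.
exact: (measurable_lsize mW0 mW1 uW0 uW1 theta 1 mg).
Qed.

Let msz : measurable_fun [set: T] sz.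
Proof. exact: (measurable_wsize mW0 mW1 uW0 uW1 theta mg). Qed.

Let mszp : measurable_fun [set: T] (fun x => sz x `^ ptheta).
Proof. exact: (measurableT_comp (@measurable_powR R ptheta) msz). Qed.

Let lsp2_ge0 x : 0 <= lsp2 x. Proof. by apply: sumr_ge0 => j _; exact: sqr_ge0. Qed.

Let bnd_sz x : 0 < sz x -> sz x <= expR (bnd x).
Proof.
move=> s0; rewrite -[leLHS](@lnK R)// ler_expR /bnd /lwsize divr1.
by apply: (le_trans (ler_norm _)); rewrite lerDl.
Qed.

(** Replacing 1 by [tau] shifts ln h by ln tau. The term k + 1 comes from |y| <= y^2 + 1 with y = ln
    l_j. *)
Let bnd_lrho tau k x j : 0 < tau -> 0 < sz x -> bnd x <= k ->
  `|lrho W0 W1 theta g tau gam x j| <= `|gam| * (k + `|ln tau|) + (k + 1).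
Proof.
move=> tau0 s0 bk; rewrite /lrho; apply: (le_trans (ler_normB _ _)).
have lE : lwsize W0 W1 theta g tau x = lwsize W0 W1 theta g 1 x - ln tau.
  by rewrite /lwsize divr1 ln_div.
have l2 := lsp2_ge0 x; have l0 := normr_ge0 (lwsize W0 W1 theta g 1 x).
apply: lerD.
  rewrite normrM ler_wpM2l// lE; apply: (le_trans (ler_normB _ _)).
  by move: bk; rewrite /bnd; lra.
have h : (lsp W0 W1 x j / 2) ^+ 2 <= lsp2 x.
  rewrite /lsp2 (bigD1 j)//= lerDl; apply: sumr_ge0 => i _; exact: sqr_ge0.
have := real_normK (num_real (lsp W0 W1 x j / 2)).
move: bk h; rewrite /bnd; move: (lsp W0 W1 x j / 2) => y bk h.
by have := normr_ge0 y; nra.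
Qed.

Section level.
Variable A : set T.
Hypothesis mA : measurable A.
Hypothesis finA : (mu A < +oo)%E.

Definition level (k : R) := A `&` (bnd @^-1` [set` `]-oo, k]%R] `&` sz @^-1` [set` `]0, +oo[%R]).

Lemma measurable_level k : measurable (level k).
Proof.
apply: measurableI => //; apply: measurableI; rewrite -[X in measurable X]setTI.
  exact: measurable_bnd.
exact: msz.
Qed.

Lemma level_int k : (\int[mu]_(x in level k) (sz x `^ ptheta)%:E <= (M `^ ptheta)%:E)%E.
Proof.
have mlev := measurable_level k; set S := (\int[mu]_(x in _) _)%E.
have S0 : (0 <= S)%E by apply: integral_ge0 => x _; rewrite lee_fin powR_ge0.
have Soo : (S < +oo)%E.
  apply: (@le_lt_trans _ _ (\int[mu]_(x in level k) (expR k `^ ptheta)%:E)%E).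
    apply: ge0_le_integral => //.
    - by move=> x _; rewrite lee_fin powR_ge0.
    - by apply/measurable_EFinP; apply: measurable_funTS; exact: mszp.
    - move=> x [_ [/= bk s0]]; rewrite !in_itv/= ?andbT in bk s0.
      rewrite lee_fin; apply: le_powR; rewrite ?(ltW ptheta0) ?(ltW s0)//.
      by apply: (le_trans (bnd_sz s0)); rewrite ler_expR.
  rewrite integral_cst//; apply: lte_mul_pinfty; rewrite ?lee_fin ?powR_ge0//.
  apply: le_lt_trans finA; apply: le_measure; rewrite ?inE//.
  by move=> x [].
have [s SE] : exists s, S = s%:E by move: S0 Soo; case: (S) => [s| |]//; exists s.
have s0 : 0 <= s by rewrite -lee_fin -SE.
rewrite SE lee_fin; have [->|sn0] := eqVneq s 0; first exact: powR_ge0.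
have sgt0 : 0 < s by rewrite lt_def sn0.
(* The norm of f over the level set, which normalises the integral to 1; that it is finite was
   secured by the bound on h and the finite measure of A. *)
pose tau := s `^ ptheta^-1; have tau0 : 0 < tau by exact: powR_gt0.
have tauE : tau `^ ptheta = s by rewrite -powRrM mulVf ?powRr1 ?gt_eqF.
rewrite -tauE; apply: le_powR; rewrite ?(ltW ptheta0) ?(ltW tau0)//.
have E_lrho x j : level k x -> `|lrho W0 W1 theta g tau gam x j| <=
    Num.norm (`|gam| * (k + `|ln tau|) + (k + 1)).
  move=> [_ [/= bk s1]]; rewrite !in_itv/= ?andbT in bk s1.
  exact: (le_trans (bnd_lrho j tau0 s1 bk) (ler_norm _)).
apply: (level_set_le mW0 mW1 uW0 uW1 p01 p11 theta01 ptheta0 hptheta HF FM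
  (measurable_level k) (normr_ge0 _) tau0 E_lrho).
- have e x : (\1_(level k) x * (sz x / tau) `^ ptheta)%:E =
      (s^-1%:E * ((fun x => (sz x `^ ptheta)%:E) \_ (level k)) x)%E.
    rewrite patchE indicE; case: (x \in _); last by rewrite mul0r mule0.
    have q0 : 0 <= sz x / tau by rewrite divr_ge0 ?wsize_ge0// ltW.
    have -> : sz x `^ ptheta = (sz x / tau) `^ ptheta * s.
      by rewrite -tauE -powRM// ?ltW// divfK// gt_eqF.
    by rewrite mul1r -EFinM mulrCA mulVf// mulr1.
  rewrite (eq_integral _ _ (fun x _ => e x)) ge0_integralZl_EFin//.
  - by rewrite -integral_mkcond -/S SE -EFinM mulVf.
  - by move=> x _; apply: erestrict_ge0 => y _; rewrite lee_fin; exact: powR_ge0.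
  - apply/(measurable_restrictT _ (measurable_level k)).
    by apply/measurable_EFinP; apply: measurable_funTS; exact: mszp.
  - by rewrite invr_ge0.
- by move=> x [_ [_ /=]]; rewrite in_itv/= andbT.
Qed.

End level.

Lemma wsize_int_le : (\int[mu]_x (sz x `^ ptheta)%:E <= (M `^ ptheta)%:E)%E.
Proof.
have /sigma_finiteP[A [AT ndA mA]] := sfmu.
pose E k := level (A k) k%:R.
have mE k : measurable (E k) by exact: (measurable_level (mA k).1).
have ndE : nondecreasing_seq E.
  move=> i j ij; rewrite subsetEset => x [Ax [/= bx sx]]; split; last split.
  - have /subsetPset := ndA _ _ ij; exact.
  - rewrite /= !in_itv/= in bx *; apply: (le_trans bx); by rewrite ler_nat.
  - exact: sx.
(* Zeros of the size belong to no level set, but they do not contribute to the integral. *)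
have UE : \bigcup_k E k = [set x | 0 < sz x].
  apply/seteqP; split=> [x [k _ [_ [_ /=]]]|x /= sx]; first by rewrite in_itv/= andbT.
  have : [set: T] x by []. rewrite AT => -[i _ Ax].
  pose j := Num.bound `|bnd x|; have bj : bnd x < j%:R := le_lt_trans (ler_norm _) (archi_boundP (normr_ge0 _)).
  exists (maxn i j) => //; split; last split.
  - have /subsetPset := ndA _ _ (leq_maxl i j); exact.
  - rewrite /= in_itv/=; apply: (le_trans (ltW bj)); by rewrite ler_nat leq_maxr.
  - by rewrite /= in_itv/= sx.
have h : (\int[mu]_(x in E k) (sz x `^ ptheta)%:E @[k --> \oo] -->
    \int[mu]_(x in \bigcup_k E k) (sz x `^ ptheta)%:E)%E.
  apply: ge0_nondecreasing_set_cvg_integral => //.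
  - by move=> i; apply/measurable_EFinP; apply: measurable_funTS; exact: mszp.
  - by move=> i x _; rewrite lee_fin powR_ge0.
have <- : (\int[mu]_(x in \bigcup_k E k) (sz x `^ ptheta)%:E =
    \int[mu]_x (sz x `^ ptheta)%:E)%E.
  rewrite UE integral_mkcond; apply: eq_integral => x _; rewrite patchE.
  case: ifPn => //; rewrite notin_setE/= => /negP; rewrite -leNgt => sx.
  have -> : sz x = 0 by apply/eqP; rewrite eq_le sx wsize_ge0.
  by rewrite powR0 ?gt_eqF.
rewrite -(cvg_lim _ h)//; apply: lime_le.
  by apply/cvg_ex; eexists; exact: h.
by near=> k; apply: level_int; [exact: (mA k).1 | exact: (mA k).2].
Unshelve. all: by end_near. Qed.

Lemma interp_norm_ge : (Lp_norm mu ptheta (interp_weight W0 W1 theta) f <= M%:E)%E.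
Proof.
have M0 : 0 <= M.
  rewrite -lee_fin; apply: le_trans FM; rewrite /calderon_F_norm le_max.
  apply/orP; left; apply: (@le_trans _ _ (N0 (F (Complex 0 0)))); first exact: Lnorm_ge0.
  by apply: ereal_sup_ubound; exists 0.
rewrite Lp_normE -(poweR_powRV M0 ptheta0); apply: le_poweR.
- by rewrite invr_ge0 ltW.
- exact: pint_ge0.
- exact: wsize_int_le.
Qed.

End exhaustion.

(** * Boundedness along the boundary lines *)

Section boundary_bounded.
Context {R : realType} {V : lmodType R[i]}.
Variables (N : V -> \bar R) (G : R -> V).
Hypothesis N_ge0 : forall x, (0 <= N x)%E.
Hypothesis ND : forall x y, (N (x + y) <= N x + N y)%E.

(** The definition only gives a finite norm at each t, whereas the lower bound requires a common
    finite constant. Decay handles large |t|, and continuity with compactness the rest. *)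
Lemma boundary_line_bounded : boundary_line_ok N G ->
  exists K : R, forall t, (N (G t) <= K%:E)%E.
Proof.
move=> [Gfin Gc Gp Gm].
have /(ecvg0_inv (fun t => N_ge0 (G t)) Gp)[A [Ar HA]] := @ltr01 R.
have /(ecvg0_inv (fun t => N_ge0 (G t)) Gm)[B [Br HB]] := @ltr01 R.
(* Compactness with the bound K as a parameter tending to infinity: local bounds near each t combine
   into one K for the segment. *)
have /compact_near_coveringP/(_ _ (pinfty_nbhs R) (fun K t => (N (G t) <= K%:E)%E)) :=
  @segment_compact R (B - 1) (A + 1).
case=> [t _|K [Kr HK]].
  have fin : N (G t) \is a fin_num by rewrite ge0_fin_numE.
  have near_t : \forall s \near t, (N (G s) <= (fine (N (G t)) + 1)%:E)%E.
    have h1 := ecvg0_inv (fun s => N_ge0 (G s - G t)) (Gc t) (@ltr01 R).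
    apply: filterS (h1 (nbhs_filter t)) => s h; rewrite -[G s](subrK (G t)); apply: (le_trans (ND _ _)).
    by rewrite addeC EFinD fineK//; apply: leeD.
  exists ([set s | (N (G s) <= (fine (N (G t)) + 1)%:E)%E],
    [set K | fine (N (G t)) + 1 <= K]).
    by split; [exact: near_t | apply: nbhs_pinfty_ge; exact: num_real].
  by move=> [s K] [/= h1 h2]; apply: (le_trans h1); rewrite lee_fin.
exists (Num.max 1 (K + 1)) => t.
have [tA|At] := ltP A t.
  by apply: (le_trans (HA t tA)); rewrite lee_fin le_max lexx.
have [tB|Bt] := ltP t B.
  by apply: (le_trans (HB t tB)); rewrite lee_fin le_max lexx.
apply: (@le_trans _ _ (K + 1)%:E); last by rewrite lee_fin le_max lexx orbT.
by apply: HK => /=; rewrite ?in_itv/=; lra.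
Qed.

End boundary_bounded.

(** * The triangle inequality in weighted L^p *)

Section Lp_triangle.
Context {d : measure_display} {T : measurableType d} {R : realType}.
Local Notation C := R[i].

Lemma enormD m (u v : 'cV[C]_m) : enorm (u + v) <= enorm u + enorm v.
Proof.
have h0 := addr_ge0 (enorm_ge0 u) (enorm_ge0 v).
rewrite -(@ler_pXn2r _ 2) ?nnegrE ?enorm_ge0// sqrrD !enorm_sqr.
have cs := cauchy_schwarz_sum (fun i => cmod_ge0 (u i 0)) (fun i => cmod_ge0 (v i 0)).
rewrite -!enormE in cs.
apply: (@le_trans _ _ (\sum_i (cmod (u i 0) ^+ 2 +
    cmod (u i 0) * cmod (v i 0) *+ 2 + cmod (v i 0) ^+ 2))).
  apply: ler_sum => i _; rewrite -sqrrD mxE ler_pXn2r ?nnegrE ?cmod_ge0 ?cmodD//.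
  by rewrite addr_ge0 ?cmod_ge0.
by rewrite 2!big_split sumrMnl lerD2r lerD2l lerMn2r cs orbT.
Qed.

Variables (mu : {measure set T -> \bar R}) (n : nat) (p : R) (W : T -> 'M[C]_n).
Hypothesis mW : measurable_fun_mx W.
Hypothesis p1 : 1 <= p.

Lemma Lp_normD (U V : L0 mu n) :
  (Lp_norm mu p W (U + V)%R <= Lp_norm mu p W U + Lp_norm mu p W V)%E.
Proof.
have mU := measurable_ofL0 U; have mV := measurable_ofL0 V.
have p0 : 0 < p by exact: lt_le_trans p1.
have := toL0D mu mU mV; rewrite !toL0_ofL0 => <-.
rewrite (Lp_norm_toL0 mu p mW (measurable_mxD mU mV)).
pose u x := enorm (W x *m ofL0 U x); pose v x := enorm (W x *m ofL0 V x).
have m1 : measurable_fun [set: T] u by apply: measurable_enorm; exact: measurable_mxM.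
have m2 : measurable_fun [set: T] v by apply: measurable_enorm; exact: measurable_mxM.
apply: le_trans (minkowski_EFin mu m1 m2 p1).
rewrite unlock; apply: le_poweR; [by rewrite invr_ge0 ltW | exact: pint_ge0 |].
have muv : measurable_fun [set: T] (fun x => (u x + v x) `^ p).
  exact: (measurableT_comp (@measurable_powR R p) (measurable_funD m1 m2)).
have e x : (`|(EFin \o (u \+ v)%R) x| `^ p)%E = (((u x + v x) `^ p)%R)%:E.
  rewrite [X in (X `^ p)%E](_ : _ = (u x + v x)%:E) ?poweR_EFin//.
  by rewrite -[LHS]/(`|u x + v x|%:E) ger0_norm// addr_ge0 ?enorm_ge0.
rewrite (eq_integral _ _ (fun x _ => e x)); apply: ge0_le_integral => //.
- by move=> x ?; rewrite lee_fin; exact: powR_ge0.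
- apply/measurable_EFinP.
  exact: (measurable_enorm_powR p mW (measurable_mxD mU mV)).
- by apply/measurable_EFinP.
- move=> x ?; rewrite lee_fin; apply: (le_powR (ltW p0) (enorm_ge0 _)).
  by rewrite mulmxDr; exact: enormD.
Qed.

End Lp_triangle.

(** * The interpolation identity for weights invertible everywhere *)

Section regular_weights.
Context {d : measure_display} {T : measurableType d} {R : realType}.
Local Notation C := R[i].
Variables (mu : {measure set T -> \bar R}) (n : nat) (W0 W1 : T -> 'M[C]_n).
Hypothesis sfmu : sigma_finite [set: T] mu.
Hypothesis mW0 : measurable_fun_mx W0.
Hypothesis mW1 : measurable_fun_mx W1.
Hypothesis uW0 : invertible_field W0.
Hypothesis uW1 : invertible_field W1.
Variables (p0 p1 theta ptheta : R).
Hypothesis p01 : 1 <= p0.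
Hypothesis p11 : 1 <= p1.
Hypothesis theta01 : 0 < theta < 1.
Hypothesis ptheta0 : 0 < ptheta.
Hypothesis hptheta : ptheta^-1 = (1 - theta) / p0 + theta / p1.

Local Notation N0 := (@Lp_norm _ _ _ mu n p0 W0).
Local Notation N1 := (@Lp_norm _ _ _ mu n p1 W1).
Local Notation N := (@Lp_norm _ _ _ mu n ptheta (interp_weight W0 W1 theta)).

Lemma interp_space_sub (f : L0 mu n) : interp_space N0 N1 theta f -> (N f < +oo)%E.
Proof.
move=> [F HF <-]; have [_ _ _ b0 b1] := HF.
have [K0 h0] := boundary_line_bounded (fun x => Lnorm_ge0 _ _ _) (Lp_normD mW0 p01) b0.
have [K1 h1] := boundary_line_bounded (fun x => Lnorm_ge0 _ _ _) (Lp_normD mW1 p11) b1.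
have FM : (calderon_F_norm N0 N1 F <= (Num.max K0 K1)%:E)%E.
  rewrite /calderon_F_norm ge_max; apply/andP; split; apply: ge_ereal_sup => _ [t _ <-].
    by apply: (le_trans (h0 t)); rewrite lee_fin le_max lexx.
  by apply: (le_trans (h1 t)); rewrite lee_fin le_max lexx orbT.
have h := interp_norm_ge sfmu mW0 mW1 uW0 uW1 p01 p11 theta01 ptheta0 hptheta HF FM.
by apply: (le_lt_trans h); rewrite ltry.
Qed.

Lemma interp_norm_lb (f : L0 mu n) : (N f <= interp_norm N0 N1 theta f)%E.
Proof.
apply: le_ereal_inf_tmp => _ [F [HF <-] <-].
(* As [fine] sends +oo to 0, this comparison separates a finite norm from an infinite one. *)
have [FM|] := leP (calderon_F_norm N0 N1 F) (fine (calderon_F_norm N0 N1 F))%:E.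
  apply: le_trans (interp_norm_ge sfmu mW0 mW1 uW0 uW1 p01 p11 theta01 ptheta0 hptheta HF FM) _.
  have : (0 <= calderon_F_norm N0 N1 F)%E.
    rewrite /calderon_F_norm le_max; apply/orP; left.
    apply: (@le_trans _ _ (N0 (F (Complex 0 0)))); first exact: Lnorm_ge0.
    by apply: ereal_sup_ubound; exists 0.
  by case: (calderon_F_norm N0 N1 F) => // _; rewrite leey.
by case: (calderon_F_norm N0 N1 F) => [r| |]/=; rewrite ?ltxx// leey.
Qed.

Lemma wsize_int_le1 (f : L0 mu n) tau : 0 < tau -> (N f <= tau%:E)%E ->
  (\int[mu]_x (((wsize W0 W1 theta (ofL0 f) x / tau) `^ ptheta)%:E) <= 1)%E.
Proof.
move=> tau0; rewrite Lp_normE => h.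
have t0 : 0 < tau `^ ptheta by exact: powR_gt0.
have I0 := pint_ge0 mu ptheta (interp_weight W0 W1 theta) (ofL0 f).
have hI : (pint mu ptheta (interp_weight W0 W1 theta) (ofL0 f) <= (tau `^ ptheta)%:E)%E.
  have := le_poweR (ltW ptheta0) (poweR_ge0 _ _) h.
  by rewrite -poweRrM mulVf ?gt_eqF// poweRe1// poweR_EFin.
have mg := measurable_ofL0 f.
have ms := measurable_enorm_powR ptheta (measurable_interp_weight mW0 mW1 uW0 uW1 theta) mg.
have e x : ((wsize W0 W1 theta (ofL0 f) x / tau) `^ ptheta)%:E =
    ((tau `^ ptheta)^-1%:E * (wsize W0 W1 theta (ofL0 f) x `^ ptheta)%:E)%E.
  have q0 : 0 <= wsize W0 W1 theta (ofL0 f) x / tau.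
    by rewrite divr_ge0 ?wsize_ge0// ltW.
  have -> : wsize W0 W1 theta (ofL0 f) x `^ ptheta =
      (wsize W0 W1 theta (ofL0 f) x / tau) `^ ptheta * tau `^ ptheta.
    by rewrite -powRM// ?ltW// divfK// gt_eqF.
  by rewrite -EFinM mulrCA mulVf ?gt_eqF// mulr1.
rewrite (eq_integral _ _ (fun x _ => e x)) ge0_integralZl_EFin//.
- apply: (@le_trans _ _ ((tau `^ ptheta)^-1%:E * (tau `^ ptheta)%:E)%E).
    by apply: lee_wpmul2l => //; rewrite lee_fin invr_ge0 ltW.
  by rewrite -EFinM mulVf ?gt_eqF.
- by move=> x _; rewrite lee_fin; exact: powR_ge0.
- exact/measurable_EFinP.
- by rewrite invr_ge0 ltW.
Qed.

Lemma calderon_approx (f : L0 mu n) tau k : 0 < tau -> (N f <= tau%:E)%E -> 1 < k ->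
  exists F, [/\ calderon_F N0 N1 F, F theta%:C%C = f &
    (calderon_F_norm N0 N1 F <= (k / (k - 1) * tau)%:E)%E].
Proof.
move=> tau0 ft k1; have I := wsize_int_le1 tau0 ft.
have p00 : 0 < p0 by exact: lt_le_trans p01.
have p10 : 0 < p1 by exact: lt_le_trans p11.
have [h1 h2] := calderon_fun_ok mW0 mW1 uW0 uW1 p00 p10 theta01 tau0 I k1.
have h3 := calderon_fun_theta W1 uW0 tau f p00 p10 ptheta0 hptheta k1.
by exists (calderon_fun W0 W1 p0 p1 theta ptheta tau f k).
Qed.

Theorem regular_interpolation :
  interp_space N0 N1 theta = Lp_space mu ptheta (interp_weight W0 W1 theta) /\
  (forall f : L0 mu n, interp_space N0 N1 theta f ->
     interp_norm N0 N1 theta f = N f).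
Proof.
split=> [|f /interp_space_sub foo].
  apply/seteqP; split=> f; first exact: interp_space_sub.
  rewrite /Lp_space/= => foo.
  have f0 : (0 <= N f)%E by exact: Lnorm_ge0.
  have [r r0 fr] : exists2 r : R, 0 <= r & N f = r%:E.
    by move: f0 foo; case: (N f) => [r| |]//; exists r.
  (* The construction divides by [tau], so a positive bound is taken even when the norm is 0. *)
  have r1 : 0 < r + 1 by lra.
  have fr1 : (N f <= (r + 1)%:E)%E by rewrite fr lee_fin; lra.
  have k1 : (1 : R) < 2 by lra.
  by have [F [HF Ff _]] := calderon_approx r1 fr1 k1; exists F.
have f0 : (0 <= N f)%E by exact: Lnorm_ge0.
have [r r0 fr] : exists2 r : R, 0 <= r & N f = r%:E.
  by move: f0 foo; case: (N f) => [r| |]//; exists r.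
apply/eqP; rewrite eq_le interp_norm_lb andbT fr.
apply/lee_addgt0Pr => e e0; have e20 : 0 < e / 2 by rewrite divr_gt0.
pose tau := r + e / 2; have tau0 : 0 < tau by rewrite /tau; lra.
have ft : (N f <= tau%:E)%E by rewrite fr lee_fin /tau; lra.
have q0 : 0 < tau / (e / 2) by rewrite divr_gt0.
(* With this k the constant satisfies k / (k - 1) tau = tau + e / 2 = r + e. *)
have k1 : 1 < 1 + tau / (e / 2) by lra.
have [F [HF Ff FN]] := calderon_approx tau0 ft k1.
apply: (@le_trans _ _ (calderon_F_norm N0 N1 F)); first by apply: ereal_inf_lbound; exists F.
apply: (le_trans FN); rewrite -EFinD lee_fin.
rewrite (_ : _ * tau = tau + e / 2); first by rewrite /tau; lra.
have key (t u : R) : t != 0 -> u != 0 ->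
    (1 + t / (u / 2)) / (1 + t / (u / 2) - 1) * t = t + u / 2.
  by move=> t0 u0; rewrite addrAC subrr add0r; field; rewrite t0 u0.
by apply: key; rewrite gt_eqF.
Qed.

End regular_weights.

Lemma posdefmx_unit (R : realType) n (A : 'M[R[i]]_n) : posdefmx A -> A \in unitmx.
Proof.
move=> pA; rewrite unitmxE unitfE; apply/negP; rewrite -det_tr => /det0P[v v0 vA].
have vt0 : v^T != 0 by rewrite -(inj_eq trmx_inj) trmxK trmx0.
have := pA _ vt0; rewrite -mulmxA (_ : A *m v^T = 0) ?mulmx0 ?mxE ?ltxx//.
by apply: trmx_inj; rewrite trmx_mul trmxK vA trmx0.
Qed.

(** * Changing the weights on a null set *)

Section null_set.
Context {d : measure_display} {T : measurableType d} {R : realType}.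
Local Notation C := R[i].
Variables (mu : {measure set T -> \bar R}) (Z : set T).
Hypothesis mZ : measurable Z.
Hypothesis Z0 : mu Z = 0%E.
Import HBNNSimple.

(** Stated without measurability of [h] and [k], because the interpolated weight is not known to be
    measurable on the exceptional set. A simple function below [h], cut off outside Z, lies below
    [k] and has the same integral. *)
Lemma ge0_le_integral_null (h k : T -> \bar R) : (forall x, 0 <= h x)%E ->
  (forall x, 0 <= k x)%E -> (forall x, ~ Z x -> (h x <= k x)%E) ->
  (\int[mu]_x h x <= \int[mu]_x k x)%E.
Proof.
move=> h0 k0 hk; rewrite !ge0_integralTE//.
apply: ge_ereal_sup => _ [g /= gh <-].
have mZC : measurable (~` Z) by exact: measurableC.
rewrite -integralT_nnsfun.
rewrite (ge0_negligible_integral mZ _ _ _ Z0)//; last 2 first.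
  by apply/measurable_EFinP; exact: measurable_funP.
  by move=> x _; rewrite lee_fin.
rewrite setTD integral_nnsfun//; apply: ereal_sup_ubound.
exists (proj_nnsfun g mZC) => /=.
  move=> x; rewrite mindicE; case: (boolP (x \in ~` Z)) => [|_].
    by rewrite inE /= mulr1 => Zx; exact: le_trans (gh x) (hk x Zx).
  by rewrite mulr0 k0.
by rewrite -mrestrict.
Qed.

Lemma ge0_eq_integral_null (h k : T -> \bar R) : (forall x, 0 <= h x)%E ->
  (forall x, 0 <= k x)%E -> (forall x, ~ Z x -> h x = k x) ->
  (\int[mu]_x h x = \int[mu]_x k x)%E.
Proof.
move=> h0 k0 hk; apply/eqP; rewrite eq_le.
by rewrite !ge0_le_integral_null// => x /hk ->.
Qed.

Variable n : nat.

Lemma eq_Lp_norm_null p (W W' : T -> 'M[C]_n) (f : L0 mu n) :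
  (forall x, ~ Z x -> W x = W' x) -> Lp_norm mu p W f = Lp_norm mu p W' f.
Proof.
move=> WW; rewrite (Lp_normE p W f) (Lp_normE p W' f).
have e : pint mu p W (ofL0 f) = pint mu p W' (ofL0 f).
  apply: ge0_eq_integral_null.
  - by move=> x; rewrite lee_fin; exact: powR_ge0.
  - by move=> x; rewrite lee_fin; exact: powR_ge0.
  - move=> x Zx; exact: (congr1 (fun A => ((enorm (A *m ofL0 f x)) `^ p)%:E) (WW x Zx)).
by rewrite e.
Qed.

(** The indicators make measurability immediate; the identity matrix is an arbitrary invertible
    value on Z. *)
Definition regularize (W : T -> 'M[C]_n) x : 'M[C]_n :=
  (\1_Z x)%:C%C *: 1%:M + (\1_(~` Z) x)%:C%C *: W x.

Lemma regularizeE W x : regularize W x = if x \in Z then 1%:M else W x.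
Proof.
rewrite /regularize !indicE in_setC; case: (x \in Z) => /=.
  by rewrite scale1r scale0r addr0.
by rewrite scale1r scale0r add0r.
Qed.

Lemma measurable_regularize W : measurable_fun_mx W ->
  measurable_fun_mx (regularize W).
Proof.
move=> mW; apply: measurable_mxD; apply: measurable_mxZ.
- by apply: cmeas_real; exact: measurable_indic.
- exact: measurable_mx_cst.
- by apply: cmeas_real; apply: measurable_indic; exact: measurableC.
- exact: mW.
Qed.

Lemma regularize_unit W : (forall x, ~ Z x -> W x \in unitmx) ->
  invertible_field (regularize W).
Proof.
move=> WZ x; rewrite regularizeE; case: (boolP (x \in Z)) => [_|].
  exact: unitmx1.
by rewrite notin_setE => /WZ.
Qed.

End null_set.

Theorem theorem7p2 (d : measure_display) (T : measurableType d) (R : realType)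
    (mu : {sigma_finite_measure set T -> \bar R}) (n : nat)
    (p0 p1 ptheta theta : R) (W0 W1 : T -> 'M[R[i]]_n)
    (hp0 : 1 <= p0) (hp1 : 1 <= p1) (htheta0 : 0 < theta) (htheta1 : theta < 1)
    (hptheta : ptheta^-1 = (1 - theta) / p0 + theta / p1)
    (hW0 : matrix_weight mu W0) (hW1 : matrix_weight mu W1) :
  let N0 := Lp_norm mu p0 W0 in
  let N1 := Lp_norm mu p1 W1 in
  let W := fun x : T =>
    powmx (absmx (W1 x *m invmx (W0 x))) theta *m W0 x in
  interp_space N0 N1 theta = Lp_space mu ptheta W /\
  (forall f : L0 mu n, interp_space N0 N1 theta f ->
     interp_norm N0 N1 theta f = Lp_norm mu ptheta W f).

Proof.
move=> N0 N1 W.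
have theta01 : 0 < theta < 1 by rewrite htheta0.
have [p00 p10] : 0 < p0 /\ 0 < p1 by split; exact: lt_le_trans ltr01 _.
have ptheta0 : 0 < ptheta.
  rewrite -invr_gt0 hptheta addr_gt0// ?divr_gt0//.
  by rewrite subr_gt0.
have [mW0 [Z0 [mZ0 Z00 sZ0]]] := hW0.
have [mW1 [Z1 [mZ1 Z10 sZ1]]] := hW1.
pose Z := Z0 `|` Z1.
have mZ : measurable Z by exact: measurableU.
have muZ : mu Z = 0%E.
  have z0 : mu Z0 = 0%E := Z00; have z1 : mu Z1 = 0%E := Z10.
  apply/eqP; rewrite eq_le measure_ge0 andbT.
  have z : (mu Z0 + mu Z1 <= 0)%E by rewrite z0 z1 adde0.
  exact: (le_trans (measureU2 _ mZ0 mZ1) z).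
have Z0P x : ~ Z x -> posdefmx (W0 x).
  by move=> Zx; apply: contrapT => /(sZ0 x) Zx0; apply: Zx; left.
have Z1P x : ~ Z x -> posdefmx (W1 x).
  by move=> Zx; apply: contrapT => /(sZ1 x) Zx0; apply: Zx; right.
(* Off the null set Z both weights are invertible. Replacing them by the identity on Z alters none
   of the three norms, so the result for everywhere invertible fields applies. *)
have uW0 := regularize_unit (fun x Zx => posdefmx_unit (Z0P x Zx)).
have uW1 := regularize_unit (fun x Zx => posdefmx_unit (Z1P x Zx)).
have rE V x : ~ Z x -> V x = regularize Z V x :> 'M[R[i]]_n.
  by move=> Zx; rewrite regularizeE memNset.
have E0 : N0 = Lp_norm mu p0 (regularize Z W0).
  by apply/funext => f; exact: (eq_Lp_norm_null mZ muZ p0 f (rE W0)).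
have E1 : N1 = Lp_norm mu p1 (regularize Z W1).
  by apply/funext => f; exact: (eq_Lp_norm_null mZ muZ p1 f (rE W1)).
have E : Lp_norm mu ptheta W =
    Lp_norm mu ptheta (interp_weight (regularize Z W0) (regularize Z W1) theta).
  apply/funext => f; apply: (eq_Lp_norm_null mZ muZ ptheta f) => x Zx.
  by rewrite /interp_weight /ratio -(rE W0 x Zx) -(rE W1 x Zx).
have [h1 h2] := regular_interpolation (sigma_finiteT mu)
  (measurable_regularize mZ mW0) (measurable_regularize mZ mW1) uW0 uW1
  hp0 hp1 theta01 ptheta0 hptheta.
by rewrite /Lp_space E0 E1 E.
Qed.
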